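(* Let $a_1,\dots,a_k,c_1,\dots,c_k$ be complex numbers with $|c_i|<1$ for all $i$, let $A=\{a_1,\dots,a_k\}$, $C=\{c_1,\dots,c_k\}$, and $$g(e^{i\theta})=\prod_{i=1}^k\frac{1-a_ie^{i\theta}}{1-c_ie^{i\theta}}.$$ Let $N=2m$. Then $$\int_{USp(2m)}\det g(U)\,dU=\sum_{S\subset A}S^N\,Z_S(A-S+S^{-1};C).$$
   Context: For a matrix $U$ with eigenvalues $e^{i\theta_1},\dots,e^{i\theta_n}$, $\det g(U)=\prod_j g(e^{i\theta_j})$; $USp(2m)$ is the unitary symplectic group of $2m\times 2m$ matrices with normalized Haar measure. For finite sets (multisets) of complex numbers: $Z(A,B)=\prod_{a\in A,b\in B}(1-ab)^{-1}$; if $A=\{a_1,\dots,a_k\}$ then $Z_S(A)=\prod_{1\le i\le j\le k}(1-a_ia_j)^{-1}$ and $Z_O(A)=\prod_{1\le i<j\le k}(1-a_ia_j)^{-1}$; $Z_S(A;C)=\frac{Z_S(A)Z_O(C)}{Z(A,C)}$. For $S\subset A$, $A-S+S^{-1}$ is $A$ with the elements of $S$ removed and their reciprocals added, and $S^N=\prod_{a\in S}a^N$ (empty product $=1$). *)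

(* Defs.v *)
From HB Require Import structures.
From mathcomp Require Import all_boot all_order all_algebra.
From mathcomp Require Import complex.
From mathcomp Require Import all_classical all_reals all_analysis.

Set Implicit Arguments.
Unset Strict Implicit.
Unset Printing Implicit Defensive.

Import Order.TTheory GRing.Theory Num.Theory.
Import numFieldNormedType.Exports.

Local Open Scope classical_set_scope.
Local Open Scope ring_scope.

(* R[i] packaged as a numClosedFieldType, so that it carries the norm topology
   of numFieldNormedType; R[i] itself has no topology in the libraries. *)
Definition C (R : realType) : numClosedFieldType := R[i].

Section UnitarySymplecticGroup.
Variables (R : realType) (m : nat).

Definition sympJ : 'M[C R]_(m + m) := block_mx 0 1%:M (- 1%:M) 0.

Definition USp : set 'M[C R]_(m + m) :=
  [set U | U \is unitarymx /\ U^T *m sympJ *m U = sympJ].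

Definition borel_mx : measurableType _ :=
  g_sigma_algebraType (@open 'M[C R]_(m + m)).

(* Haar measure on USp(2m), viewed as a Borel measure on the ambient matrix
   space which is carried by USp(2m). On this compact metrizable group the two
   conditions determine the measure (regularity and right invariance are
   automatic). *)
Definition is_haar_USp (mu : probability borel_mx R) : Prop :=
  mu USp = 1%E /\
  forall (V : 'M[C R]_(m + m)) (E : set borel_mx),
    USp V -> measurable E -> E `<=` USp ->
    mu [set V *m U | U in E] = mu E.

End UnitarySymplecticGroup.

Arguments USp : clear implicits.

Definition integralC d (T : measurableType d) (R : realType)
    (mu : {measure set T -> \bar R}) (D : set T) (f : T -> C R) : C R :=
  Complex (Rintegral mu D (fun x => complex.Re (f x)))
          (Rintegral mu D (fun x => complex.Im (f x))).

(* The roots of the characteristic polynomial, listed with multiplicity; they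
   are determined up to order. *)
Definition eigenvalues (R : realType) (n : nat) (U : 'M[C R]_n) : seq (C R) :=
  sval (closed_field_poly_normal (char_poly U)).

Definition detg (R : realType) (n : nat) (g : C R -> C R)
    (U : 'M[C R]_n) : C R :=
  \prod_(z <- eigenvalues U) g z.

(* A multiset {a_1, ..., a_k} is the row vector of its elements, and S `<=` A
   is a set of indices. *)
Section Ratios.
Variables (R : realType) (k : nat).
Implicit Types (a c : 'rV[C R]_k) (S : {set 'I_k}).

Definition gratio a c (z : C R) : C R :=
  \prod_(i < k) ((1 - a 0 i * z) / (1 - c 0 i * z)).

Definition Z a c : C R :=
  \prod_(i < k) \prod_(j < k) (1 - a 0 i * c 0 j)^-1.

Definition ZS a : C R :=
  \prod_(i < k) \prod_(j < k | (i <= j)%N) (1 - a 0 i * a 0 j)^-1.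

Definition ZO a : C R :=
  \prod_(i < k) \prod_(j < k | (i < j)%N) (1 - a 0 i * a 0 j)^-1.

(* If some a_i c_j = 1 then Z a c has a pole; since 0^-1 = 0, the division
   below still gives the intended factor \prod (1 - a_i c_j) = 0. *)
Definition ZSC a c : C R := ZS a * ZO c / Z a c.

Definition swap a S : 'rV[C R]_k :=
  \row_i (if i \in S then (a 0 i)^-1 else a 0 i).

Definition ratio_sum (N : nat) a c : C R :=
  \sum_(S : {set 'I_k}) (\prod_(i in S) a 0 i ^+ N) * ZSC (swap a S) c.

(* The points where no reciprocal a_i^-1 and no factor of Z_S(A - S + S^-1)
   is singular, for any S. *)
Definition generic a : Prop :=
  [/\ forall i, a 0 i != 0,
      forall i j, a 0 i * a 0 j != 1 &
      forall i j, i != j -> a 0 i != a 0 j].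

End Ratios.

(* Main.v *)
Require Import Defs.
From HB Require Import structures.
From mathcomp Require Import all_boot all_order all_algebra.
From mathcomp Require Import complex.
From mathcomp Require Import all_classical all_reals all_analysis.
From mathcomp Require Import perm cyclic separable cyclotomic.
From mathcomp Require Import measurable_realfun ring zify.

(* Let z_l, 1/z_l be the eigenvalues of U, x_l = z_l + 1/z_l, alpha = a + 1/a,
   and let E be the Haar average. Invariance of E under Cayley transforms of tX,
   to second order in t and summed over an orthogonal basis of the Lie algebra
   (the Casimir element), says that Vdm(alpha) E prod_(i,l) (alpha_i - x_l) is an
   eigenvector of a second order operator in the alpha_i. That operator is
   diagonal on products of Chebyshev polynomials of the second kind, and only the
   top antisymmetric one has the right eigenvalue, so the function is
   det (U_(m+j)(alpha_i)).
   The Weyl integration formula with the angles restricted to L-th roots of unity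
   gives the same value for large L, by Andreief's identity and discrete
   orthogonality. So both averages agree on prod_(i,l) (alpha_i - x_l), and hence
   on ratios, because 1 / (1 - c z) is, up to the factor 1 - (c z)^L -> 1, the
   product of the 1 - c w z over the L-th roots of unity w <> 1.
   The discrete average of a ratio is computed by a mixed Cauchy-Vandermonde
   determinant; as L -> oo it becomes the k x k determinant of
   1 / (gamma_j - alpha_i) - sum_(p < m) U_p(alpha_i) c_j^(p+1), gamma = c + 1/c.
   Each row is a sum of two terms exchanged by a_i <-> 1/a_i; expanding over the
   choices S and evaluating Cauchy determinants gives the sum over S.
   This needs the |c_j| distinct, nonzero and different from the |a_i|^(+-1); the
   general case follows by uniform convergence of the integrands. *)

Set Implicit Arguments.
Unset Strict Implicit.
Unset Printing Implicit Defensive.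

Import Order.TTheory GRing.Theory Num.Theory.
Import numFieldNormedType.Exports.

Local Open Scope classical_set_scope.
Local Open Scope ring_scope.

Local Open Scope sesquilinear_scope.

(** * Spectrum of unitary symplectic matrices *)

(** The Haar measure is used only through translation invariance, so no joint law of the eigenvalues
    is known beforehand. Three obstacles shape the proof. The average has to be differentiated in t
    and in the alpha_i. The Cayley transform is rational in t, so after clearing powers of det (1 -
    t X) everything is polynomial, and each coefficient is a finite linear combination of values;
    only linearity of the average is then needed. The Casimir identity applies to numerators, not to
    poles. A ratio is reached as a uniform limit of products of numerators, whose points alpha must
    be pairwise distinct: this is what the conditions on the moduli of the c_j secure for all
    rotated poles at once. The quadrature is the functional on which denominators can be treated
    exactly, before L grows. Finally, the eigenvalue angles of U are selected by choice and need not
    be measurable in U; measurability always comes from the determinants det (1 - b U) and from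
    limits of their products. *)

Lemma pair_inverses (K : numFieldType) (s : seq K) :
  perm_eq s (map GRing.inv s) -> \prod_(z <- s) z = 1 -> ~~ odd (size s) ->
  exists2 t : seq K, size t = (size s)./2 & perm_eq s (t ++ map GRing.inv t).
Proof.
have [n] := ubnP (size s); elim: n s => // n IHn s; rewrite ltnS => sn sV s1 s2.
have nz z : z \in s -> z != 0.
  move=> zs; apply/eqP => z0; move: s1; rewrite (big_rem z) //= z0 mul0r.
  by move/esym/eqP; rewrite oner_eq0.
have [->|s0] := eqVneq s [::]; first by exists [::].
have [z zs zVs] : exists2 z, z \in s & z^-1 \in rem z s.
  have [/hasP[z zs zV]|/hasPn self] := boolP (has (fun z => z != z^-1) s).
    exists z => //; have: z^-1 \in s by rewrite (perm_mem sV) map_f.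
    by rewrite (perm_mem (perm_to_rem zs)) inE eq_sym (negPf zV).
  (* All elements are now 1 or -1. If the head does not recur, the others are all its opposite and
     odd in number, so the product is -1. *)
  case: s s0 {IHn sn} sV s1 s2 nz self => // z s _ _ s1 s2 nz self.
  have zV w : w \in z :: s -> w^-1 = w by move/self; rewrite negbK => /eqP<-.
  have [zs|zs] := boolP (z \in s).
    by exists z; rewrite ?mem_head //= eqxx zV ?mem_head.
  have sq w : w \in z :: s -> w ^+ 2 = 1.
    by move=> ws; rewrite expr2 -{1}(zV _ ws) mulVf // nz.
  have /all_pred1P sE : all (pred1 (- z)) s.
    apply/allP => w ws /=.
    have: (w - z) * (w + z) = 0.
      by rewrite -subr_sqr !sq ?subrr // inE ?eqxx ?ws ?orbT.
    move/eqP; rewrite mulf_eq0 subr_eq0 addr_eq0 => /orP[/eqP wz|//].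
    by rewrite wz (negPf zs) in ws.
  move: s1 s2; rewrite big_cons sE /= size_nseq negbK.
  move: (size s) => p; rewrite big_nseq iter_mulr_1.
  move=> E op; exfalso; move: E.
  have -> : z * (- z) ^+ p = -1.
    rewrite -(odd_double_half p) op exprD expr1 -mul2n exprM sqrrN.
    by rewrite sq ?mem_head // expr1n mulr1 mulrN -expr2 sq ?mem_head.
  by move=> /eqP; rewrite eq_sym -addr_eq0 -mulr2n pnatr_eq0.
have E : perm_eq s (z :: z^-1 :: rem z^-1 (rem z s)).
  by rewrite (perm_trans (perm_to_rem zs)) // perm_cons perm_to_rem.
set s' := rem z^-1 (rem z s) in E.
have sz : size s = (size s').+2 by rewrite (perm_size E).
have s'V : perm_eq s' (map GRing.inv s').
  rewrite -(perm_cons z^-1) -(perm_cons z) -(permPl E) (permPl sV).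
  rewrite (permPl (perm_map _ E)) /= invrK.
  exact/permPl/(perm_catCA [:: z^-1] [:: z]).
have s'1 : \prod_(w <- s') w = 1.
  move: s1; rewrite (perm_big _ E) /= !big_cons mulrA divff ?mul1r //.
  exact: nz.
have [||t st pt] := IHn s' _ s'V s'1; rewrite ?sz /= ?negbK in sn s2 *.
- by rewrite (leq_trans _ sn) //.
- by [].
exists (z :: t); first by rewrite /= st.
rewrite (perm_trans E) //= perm_cons perm_sym.
rewrite (permPl (permEl (perm_catCA t [:: z^-1] _))) /= perm_cons.
by rewrite perm_sym.
Qed.

Lemma mxform_eq0 (K : numClosedFieldType) n (x : 'rV[K]_n) :
  x *m x ^t* = 0 -> x = 0.
Proof.
move=> /matrixP/(_ 0 0); rewrite !mxE => xx0.
apply/rowP => j; apply/eqP; rewrite mxE -normr_eq0 -sqrf_eq0.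
apply/eqP; move: j (isT) => j /=; move: j.
suff H j : true -> x 0 j * (x ^t*) j 0 = 0 by move=> j _; rewrite -(H j isT) normCK !mxE.
move: j; apply: psumr_eq0P => // j _.
by rewrite !mxE -normCK exprn_ge0.
Qed.

Lemma mulmx_conj_tr_eq0 (K : numClosedFieldType) n p (u : 'rV[K]_n)
    (k : 'M[K]_(n, p)) : u *m map_mx Num.conj k *m k^T = 0 ->
  u *m map_mx Num.conj k = 0.
Proof.
move=> uk; apply: mxform_eq0.
have -> : (u *m map_mx Num.conj k) ^t* = k^T *m u ^t*.
  rewrite trmx_mul map_mxM; congr (_ *m _).
    by apply/matrixP => i j; rewrite !mxE; exact: conjCK.
by rewrite mulmxA uk mul0mx.
Qed.

(* [S] is built from the left kernel of [A] so that [A + C S] only misses what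
   both [A] and [C] miss. *)
Lemma lagrangian_shear (K : numClosedFieldType) m (A C : 'M[K]_m) :
  A *m C^T = C *m A^T -> row_free (row_mx A C) ->
  exists2 S : 'M[K]_m, S^T = S & A + C *m S \in unitmx.
Proof.
move=> AC free; have [r [k [kfree kA ksub]]] : exists r, exists k : 'M[K]_(r, m),
    [/\ row_free k, A *m k^T = 0 & forall v : 'rV_m, A *m v^T = 0 -> (v <= k)%MS].
  exists (\rank (kermx A^T)), (row_base (kermx A^T)); split.
  - exact: row_base_free.
  - apply: trmx_inj; rewrite trmx_mul trmxK trmx0; apply/sub_kermxP.
    by rewrite eq_row_base.
  - move=> v Av; rewrite eq_row_base; apply/sub_kermxP; apply: trmx_inj.
    by rewrite trmx_mul trmxK Av trmx0.
have kconj (u : 'rV_r) : u *m map_mx Num.conj k = 0 -> u = 0.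
  move=> u0; apply/eqP; rewrite -(map_mx_eq0 Num.conj); apply/eqP.
  apply: (row_free_inj kfree); rewrite mul0mx; apply/matrixP => i j.
  have -> : (0 : 'M[K]_(1, m)) i j = Num.conj ((u *m map_mx Num.conj k) i j).
    by rewrite u0 !mxE conjC0.
  rewrite !mxE rmorph_sum /=; apply: eq_bigr => l _.
  by rewrite !mxE rmorphM /= conjCK.
(* The witness must be symmetric and not Hermitian, hence the conjugate of [k] in both factors.
   Multiplying v (A + C S) = 0 by [k^T] removes the term in [A], and positivity does the rest. *)
exists (k ^t* *m map_mx Num.conj k).
  by rewrite trmx_mul !map_trmx trmxK.
rewrite -row_free_unit; apply: inj_row_free => v.
rewrite mulmxDr => v0.
set u := v *m C *m k ^t*.
have u0 : u = 0.
  apply: kconj; apply: mulmx_conj_tr_eq0.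
  move/(congr1 (mulmx^~ k^T)): v0; rewrite mul0mx mulmxDl -(mulmxA v A) kA mulmx0 add0r.
  by rewrite !mulmxA.
have vA : v *m A = 0.
  by move: v0; rewrite !mulmxA -/u u0 mul0mx addr0.
have /submxP[w vC] : (v *m C <= k)%MS.
  by apply: ksub; rewrite trmx_mul mulmxA AC -mulmxA -trmx_mul vA trmx0 mulmx0.
have vC0 : v *m C = 0.
  rewrite vC; apply: mxform_eq0; rewrite trmx_mul map_mxM mulmxA -vC -/u u0.
  by rewrite mul0mx.
by apply: (row_free_inj free); rewrite mul_mx_row vA vC0 row_mx0 mul0mx.
Qed.

Lemma sympJ_sqr (R : realType) m : sympJ R m *m sympJ R m = - 1%:M.
Proof.
rewrite /sympJ scalar_mx_block opp_block_mx mulmx_block.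
by rewrite !mul0mx !mulmx0 mul1mx mulmx1 !add0r addr0 oppr0.
Qed.

Lemma sympJ_tr (R : realType) m : (sympJ R m)^T = - sympJ R m.
Proof.
by rewrite /sympJ tr_block_mx opp_block_mx !trmx0 linearN /= !trmx1 opprK !oppr0.
Qed.

(** Taking determinants in the hypothesis only gives [\det U ^ 2 = 1]. The sign is settled by block
    elimination, which needs an invertible corner; a symplectic shear supplies one. *)
Lemma symplectic_det (R : realType) m (U : 'M[C R]_(m + m)) :
  U^T *m sympJ R m *m U = sympJ R m -> \det U = 1.
Proof.
rewrite -[U]submxK.
set A := ulsubmx U; set B := ursubmx U; set C1 := dlsubmx U; set D := drsubmx U.
move=> sU; have Uu : block_mx A B C1 D \in unitmx.
  have : \det (sympJ R m) != 0.
    apply/eqP => d0; have := congr1 determinant (sympJ_sqr R m).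
    rewrite det_mulmx d0 mul0r -scaleN1r detZ det1 mulr1 => /esym/eqP.
    by rewrite signr_eq0.
  rewrite -[in X in X -> _]sU !det_mulmx !mulf_eq0 !negb_or => /andP[_ d].
  by rewrite unitmxE unitfE.
move: (sU); rewrite /sympJ tr_block_mx !mulmx_block.
rewrite !mulmx0 !mulmx1 !add0r !mulmxN !mulmx1 !addr0.
move=> /eq_block_mx[e11 e12 _ _].
have AC : A^T *m C1^T^T = C1^T *m A^T^T.
  by rewrite !trmxK; apply/eqP; rewrite -subr_eq0 -e11 addrC mulNmx.
have [|S Ssym AS] := lagrangian_shear AC.
  rewrite -tr_col_mx /row_free mxrank_tr.
  have -> : col_mx A C1 = block_mx A B C1 D *m col_mx 1%:M 0.
    by rewrite mul_block_col !mulmx1 !mulmx0 !addr0.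
  rewrite -mxrank_tr trmx_mul mxrankMfree ?row_free_unit ?unitmx_tr // mxrank_tr.
  by rewrite -addsmxE addsmx0 mxrank1.
pose A' := A + S *m C1.
have A'u : A' \in unitmx.
  by rewrite -unitmx_tr linearD /= trmx_mul Ssym.
(* The lower block row of the product of the two left factors is (-C1^T, A^T), the first block row
   of [U^T J], so it sends [U] to (0, 1). *)
have E : block_mx 1%:M 0 (- C1^T) A'^T *m block_mx 1%:M S 0 1%:M *m block_mx A B C1 D
    = block_mx A' (B + S *m D) 0 1%:M.
  rewrite mulmx_block !mul0mx !mulmx0 !mul1mx !mulmx1 !addr0.
  have -> : - C1^T *m S + A'^T = A^T.
    by rewrite /A' linearD /= trmx_mul Ssym mulNmx addrC addrK.
  by rewrite mulmx_block !mul1mx e11 e12.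
move/(congr1 determinant): E; rewrite !det_mulmx det_lblock !det_ublock !det1.
rewrite !mul1r !mulr1 det_tr => E; apply: (mulfI (x := \det A')).
  by rewrite -unitfE -unitmxE.
by rewrite mulr1 E.
Qed.

Lemma char_poly_conj (K : fieldType) n (P A : 'M[K]_n) : P \in unitmx ->
  char_poly (invmx P *m A *m P) = char_poly A.
Proof.
move=> Pu; rewrite /char_poly /char_poly_mx.
have PP : map_mx polyC (invmx P) *m map_mx polyC P = 1%:M.
  by rewrite -map_mxM mulVmx // map_mx1.
have -> : 'X%:M - map_mx polyC (invmx P *m A *m P) =
    map_mx polyC (invmx P) *m ('X%:M - map_mx polyC A) *m map_mx polyC P.
  rewrite !map_mxM mulmxBr mulmxBl; congr (_ - _).
  by rewrite mul_mx_scalar -scalemxAl PP scalemx1.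
by rewrite !det_mulmx mulrAC -det_mulmx PP det1 mul1r.
Qed.

Lemma char_poly_diag (K : fieldType) n (d : 'rV[K]_n) :
  char_poly (diag_mx d) = \prod_(z <- [seq d 0 i | i : 'I_n]) ('X - z%:P).
Proof.
rewrite char_poly_trig ?diag_mx_is_trig // big_image /=.
by apply: eq_bigr => i _; rewrite mxE eqxx mulr1n.
Qed.

Lemma char_poly_trmx (K : fieldType) n (A : 'M[K]_n) :
  char_poly A^T = char_poly A.
Proof.
rewrite /char_poly -det_tr /char_poly_mx linearB /= tr_scalar_mx.
by rewrite -map_trmx trmxK.
Qed.

Section Diagonal.
Variables (K : fieldType) (N : nat) (P : 'M[K]_N) (d : 'rV[K]_N).
Hypothesis Pu : P \in unitmx.
Local Notation dg v := (invmx P *m diag_mx v *m P).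

Lemma dg_mul (u v : 'rV[K]_N) : dg u *m dg v = dg (\row_i (u 0 i * v 0 i)).
Proof.
rewrite -!mulmxA; congr (_ *m _); rewrite (mulmxA P) mulmxV // mul1mx mulmxA.
by rewrite mulmx_diag.
Qed.

Lemma dg_tr (v : 'rV[K]_N) : \tr (dg v) = \sum_i v 0 i.
Proof. by rewrite mxtrace_mulC mulmxA mulmxV // mul1mx mxtrace_diag. Qed.

Lemma dg_det (v : 'rV[K]_N) : \det (dg v) = \prod_i v 0 i.
Proof. by rewrite !det_mulmx mulrAC -det_mulmx mulVmx // det1 mul1r det_diag. Qed.

Lemma dg_add (u v : 'rV[K]_N) : dg u + dg v = dg (u + v).
Proof. by rewrite -mulmxDl -mulmxDr -linearD. Qed.

Lemma dg_scale c (v : 'rV[K]_N) : c *: dg v = dg (c *: v).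
Proof. by rewrite scalemxAl scalemxAr -linearZ. Qed.

Lemma dg_sum (I : finType) (F : I -> 'rV[K]_N) : \sum_i dg (F i) = dg (\sum_i F i).
Proof. by rewrite linear_sum mulmx_sumr mulmx_suml. Qed.

Lemma dg1 : dg (const_mx 1) = 1%:M.
Proof. by rewrite diag_const_mx mulmx1 mulVmx. Qed.

Lemma dg_inv (v : 'rV[K]_N) : (forall i, v 0 i != 0) ->
  invmx (dg v) = dg (\row_i (v 0 i)^-1).
Proof.
move=> v0; have E : dg v *m dg (\row_i (v 0 i)^-1) = 1%:M.
  rewrite dg_mul -dg1; congr (_ *m diag_mx _ *m _); apply/rowP => i.
  by rewrite !mxE divff.
have [Vu _] := mulmx1_unit E.
by rewrite -[RHS](mulKmx Vu) E mulmx1.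
Qed.

Lemma dg_affine b : 1%:M + b *: dg d = dg (\row_i (1 + b * d 0 i)).
Proof.
rewrite -dg1 dg_scale dg_add; congr (_ *m diag_mx _ *m _).
by apply/rowP => i; rewrite !mxE.
Qed.

End Diagonal.

Lemma unitary_spectrum (K : numClosedFieldType) n (U : 'M[K]_n) : U \is unitarymx ->
  exists P : 'M[K]_n, exists d : 'rV[K]_n,
    [/\ P \in unitmx, U = invmx P *m diag_mx d *m P & forall i, `|d 0 i| = 1].
Proof.
move=> Uu; have Unorm : U \is normalmx.
  have UU : U *m U ^t* = 1%:M by apply/unitarymxP.
  by apply/normalmxP; rewrite UU; exact/esym/mulmx1C.
have [P [d [Pu UE]]] : exists P : 'M[K]_n, exists d : 'rV[K]_n,
    P \is unitarymx /\ U = invmx P *m diag_mx d *m P.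
  exists (spectralmx U), (spectral_diag U); split; first exact: spectral_unitarymx.
  exact/orthomx_spectralP.
have Punit : P \in unitmx by exact: unitarymx_unit.
exists P, d; split => // i.
have dE : diag_mx d = P *m U *m P ^t*.
  by rewrite UE -invmx_unitary // !mulmxA mulmxV // mul1mx mulmxK.
have : diag_mx d *m (diag_mx d) ^t* = 1%:M.
  apply/unitarymxP; rewrite dE !mul_unitarymx //.
  by rewrite trmxC_unitary.
move/matrixP/(_ i i); rewrite mul_diag_mx !mxE eqxx mulr1n -normCK => /eqP.
by rewrite sqrp_eq1 // => /eqP.
Qed.

(** [J] conjugates [U^T] into the inverse of [U], so the spectrum is stable under inversion. At the
    fixed points 1 and -1 of the inversion this does not yet give pairs, which is where determinant
    1 enters. *)
Lemma symplectic_spectrum (K : numClosedFieldType) m (J U : 'M[K]_(m + m)) :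
  J \in unitmx -> U \is unitarymx -> U^T *m J *m U = J -> \det U = 1 ->
  exists zeta : 'I_m -> K, exists2 P : 'M[K]_(m + m), P \in unitmx &
  (forall l, `|zeta l| = 1) /\ exists2 d : 'rV[K]_(m + m),
    U = invmx P *m diag_mx d *m P &
    perm_eq [seq d 0 i | i : 'I_(m + m)]
      ([seq zeta l | l : 'I_m] ++ [seq (zeta l)^-1 | l : 'I_m]).
Proof.
move=> Ju Uu Us Ud; have [P [d [Pu UE d1]]] := unitary_spectrum Uu.
have cd : char_poly U = \prod_(z <- [seq d 0 i | i : 'I_(m + m)]) ('X - z%:P).
  by rewrite UE char_poly_conj // char_poly_diag.
have Uunit : U \in unitmx by exact: unitarymx_unit.
have cV : char_poly (invmx U) = char_poly U.
  have -> : invmx U = invmx J *m U^T *m J.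
    by rewrite -mulmxA -[U^T *m _](mulmxK Uunit) Us mulmxA mulVmx // mul1mx.
  by rewrite char_poly_conj // char_poly_trmx.
have d0 i : d 0 i != 0 by rewrite -normr_gt0 d1.
set s := [seq d 0 i | i : 'I_(m + m)] in cd *.
have sV : perm_eq s (map GRing.inv s).
  apply: prod_XsubC_eq; rewrite -cd -cV UE dg_inv // char_poly_conj // char_poly_diag.
  by congr (\prod_(z <- _) _); rewrite /s -map_comp; apply: eq_map => i; rewrite /= mxE.
have s1 : \prod_(z <- s) z = 1.
  by rewrite big_image /= -(dg_det Pu) -UE.
have ss : size s = m.*2 by rewrite size_map size_enum_ord addnn.
have [|t st pt] := pair_inverses sV s1; first by rewrite ss odd_double.
rewrite ss doubleK in st.
exists (fun l => t`_l), P => //.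
have tE : [seq t`_l | l : 'I_m] = t.
  apply: (@eq_from_nth _ 0); rewrite size_map size_enum_ord // => i im.
  by rewrite (nth_map (Ordinal im)) ?size_enum_ord // nth_enum_ord.
split.
  move=> l; have : t`_l \in s.
    by rewrite (perm_mem pt) mem_cat mem_nth // st.
  by move=> /mapP[i _ ->].
exists d => //; rewrite -/s (permPl pt).
have -> : [seq (t`_l)^-1 | l : 'I_m] = map GRing.inv t by rewrite -[in RHS]tE -map_comp.
by rewrite tE.
Qed.

Lemma USp_spectrum (R : realType) m (U : 'M[C R]_(m + m)) : USp R m U ->
  exists zeta : 'I_m -> C R, exists2 P : 'M[C R]_(m + m), P \in unitmx &
  (forall l, `|zeta l| = 1) /\ exists2 d : 'rV[C R]_(m + m),
    U = invmx P *m diag_mx d *m P &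
    perm_eq [seq d 0 i | i : 'I_(m + m)]
      ([seq zeta l | l : 'I_m] ++ [seq (zeta l)^-1 | l : 'I_m]).
Proof.
move=> [Uu Us].
have Ju : sympJ R m \in unitmx.
  have : \det (sympJ R m *m sympJ R m) != 0.
    by rewrite sympJ_sqr -scaleN1r detZ det1 mulr1 signr_eq0.
  by rewrite unitmxE unitfE det_mulmx mulf_eq0 negb_or => /andP[].
exact: (symplectic_spectrum Ju Uu Us (symplectic_det Us)).
Qed.

(** * Haar averages *)

Lemma ReD (R : realType) (x y : C R) : complex.Re (x + y) = complex.Re x + complex.Re y.
Proof. by case: x; case: y. Qed.
Lemma ImD (R : realType) (x y : C R) : complex.Im (x + y) = complex.Im x + complex.Im y.
Proof. by case: x; case: y. Qed.
Lemma ReM (R : realType) (x y : C R) :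
  complex.Re (x * y) = complex.Re x * complex.Re y - complex.Im x * complex.Im y.
Proof. by case: x; case: y. Qed.
Lemma ImM (R : realType) (x y : C R) :
  complex.Im (x * y) = complex.Re x * complex.Im y + complex.Im x * complex.Re y.
Proof. by case: x; case: y. Qed.
Lemma ReN (R : realType) (x : C R) : complex.Re (- x) = - complex.Re x.
Proof. by case: x. Qed.
Lemma ImN (R : realType) (x : C R) : complex.Im (- x) = - complex.Im x.
Proof. by case: x. Qed.
Lemma Re_conj (R : realType) (x : C R) : complex.Re (x^*) = complex.Re x.
Proof. by case: x. Qed.
Lemma Im_conj (R : realType) (x : C R) : complex.Im (x^*) = - complex.Im x.
Proof. by case: x. Qed.

Lemma norm_Re_le (R : realType) (x : C R) : `|complex.Re x|%:C%C <= `|x|.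
Proof. exact: normc_ge_Re. Qed.
Lemma norm_Im_le (R : realType) (x : C R) : `|complex.Im x|%:C%C <= `|x|.
Proof.
have := norm_Re_le (x * 'i%C : C R).
rewrite ReiNIm normrN => /le_trans; apply; rewrite normrM.
have -> : `|('i%C : C R)| = 1; last by rewrite mulr1.
by rewrite normc_def /= expr0n expr1n add0r sqrtr1.
Qed.

Lemma Re_continuous (R : realType) : continuous (@complex.Re R : C R -> R).
Proof.
move=> x; have Fx := @nbhs_filter (C R) x.
apply/(@cvgrPdist_le R R (C R) (nbhs x) Fx (@complex.Re R)) => e e0; near=> y.
rewrite -ReN -ReD; have xy : `|x - y| <= e%:C%C.
  apply/ltW; near: y.
  have := @nbhsx_ballx _ (C R) x e%:C%C; rewrite -ball_normE; apply.
  by rewrite ltcR.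
have := le_trans (norm_Re_le (x - y)) xy.
by rewrite lecR.
Unshelve. all: by end_near. Qed.

Lemma Im_continuous (R : realType) : continuous (@complex.Im R : C R -> R).
Proof.
move=> x; have Fx := @nbhs_filter (C R) x.
apply/(@cvgrPdist_le R R (C R) (nbhs x) Fx (@complex.Im R)) => e e0; near=> y.
rewrite -ImN -ImD; have xy : `|x - y| <= e%:C%C.
  apply/ltW; near: y.
  have := @nbhsx_ballx _ (C R) x e%:C%C; rewrite -ball_normE; apply.
  by rewrite ltcR.
have := le_trans (norm_Im_le (x - y)) xy.
by rewrite lecR.
Unshelve. all: by end_near. Qed.

(** * Measurable complex functions *)

Section ComplexMeasurable.
Variables (R : realType) (d : measure_display) (T : measurableType d).
Implicit Types (D : set T) (f g : T -> C R).

Definition cmeas D f :=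
  measurable_fun D (fun x => complex.Re (f x)) /\
  measurable_fun D (fun x => complex.Im (f x)).

Lemma cmeas_cst D c : cmeas D (fun=> c).
Proof. by split; exact: measurable_cst. Qed.

Lemma cmeasD D f g : cmeas D f -> cmeas D g -> cmeas D (fun x => f x + g x).
Proof.
move=> [f1 f2] [g1 g2]; split.
  by under eq_fun do rewrite ReD; exact: measurable_funD.
by under eq_fun do rewrite ImD; exact: measurable_funD.
Qed.

Lemma cmeasM D f g : cmeas D f -> cmeas D g -> cmeas D (fun x => f x * g x).
Proof.
move=> [f1 f2] [g1 g2]; split.
  under eq_fun do rewrite ReM.
  by apply: measurable_funB; exact: measurable_funM.
under eq_fun do rewrite ImM.
by apply: measurable_funD; exact: measurable_funM.
Qed.

Lemma cmeas_conj D f : cmeas D f -> cmeas D (fun x => (f x)^*).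
Proof.
move=> [f1 f2]; split; first by under eq_fun do rewrite Re_conj.
under eq_fun do rewrite Im_conj.
exact: measurableT_comp.
Qed.

Lemma cmeas_sum D (I : Type) (r : seq I) (P : pred I) (F : I -> T -> C R) :
  (forall i, cmeas D (F i)) -> cmeas D (fun x => \sum_(i <- r | P i) F i x).
Proof.
move=> mF; elim: r => [|i r IH].
  by under eq_fun do rewrite big_nil; exact: cmeas_cst.
under eq_fun do rewrite big_cons.
by case: (P i) => //; exact: cmeasD.
Qed.

Lemma cmeas_prod D (I : Type) (r : seq I) (P : pred I) (F : I -> T -> C R) :
  (forall i, cmeas D (F i)) -> cmeas D (fun x => \prod_(i <- r | P i) F i x).
Proof.
move=> mF; elim: r => [|i r IH].
  by under eq_fun do rewrite big_nil; exact: cmeas_cst.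
under eq_fun do rewrite big_cons.
by case: (P i) => //; exact: cmeasM.
Qed.

Lemma cmeas_det D n (M : T -> 'M[C R]_n) :
  (forall i j, cmeas D (fun x => M x i j)) -> cmeas D (fun x => \det (M x)).
Proof.
move=> mM; apply: cmeas_sum => s; apply: cmeasM; first exact: cmeas_cst.
by apply: cmeas_prod.
Qed.

Lemma cmeas_eq D f g : (forall x, D x -> f x = g x) -> cmeas D f -> cmeas D g.
Proof.
move=> fg [f1 f2]; split.
  by apply: eq_measurable_fun f1 => x /set_mem/fg ->.
by apply: eq_measurable_fun f2 => x /set_mem/fg ->.
Qed.

Lemma cmeasS D D' f : measurable D' -> D `<=` D' -> cmeas D' f -> cmeas D f.
Proof. by move=> mD' DD' [f1 f2]; split; apply: measurable_funS; eassumption. Qed.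

Lemma cmeas_cvg D (F : (T -> C R)^nat) f : measurable D ->
  (forall n, cmeas D (F n)) -> (forall x, D x -> F ^~ x @ \oo --> f x) ->
  cmeas D f.
Proof.
move=> mD mF Ff; split.
  apply: (@measurable_fun_cvg _ _ _ _ (fun n x => complex.Re (F n x))) => //.
    by move=> n; have [] := mF n.
  move=> x Dx; apply: (cvg_comp _ _ (Ff x Dx)); exact: Re_continuous.
apply: (@measurable_fun_cvg _ _ _ _ (fun n x => complex.Im (F n x))) => //.
  by move=> n; have [] := mF n.
move=> x Dx; apply: (cvg_comp _ _ (Ff x Dx)); exact: Im_continuous.
Qed.

Lemma cmeas_level D f c : measurable D -> cmeas D f ->
  measurable (D `&` [set x | f x = c]).
Proof.
move=> mD [f1 f2].
have -> : D `&` [set x | f x = c] =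
    (D `&` (fun x => complex.Re (f x)) @^-1` [set complex.Re c]) `&`
    (D `&` (fun x => complex.Im (f x)) @^-1` [set complex.Im c]).
  apply/seteqP; split => [x /= [Dx ->] //|x /= [[Dx fr] [_ fi]]]; split => //.
  by move: (f x) c fr fi => [? ?] [? ?] /= -> ->.
by apply: measurableI; [exact: f1|exact: f2].
Qed.

End ComplexMeasurable.

Lemma cvg_sum_seq (K : numFieldType) (T I : Type) (F : set_system T) (FF : Filter F)
    (r : seq I) (P : pred I) (f : I -> T -> K) (l : I -> K) :
  (forall i, P i -> f i x @[x --> F] --> l i) ->
  \sum_(i <- r | P i) f i x @[x --> F] --> \sum_(i <- r | P i) l i.
Proof.
move=> fl; elim: r => [|i r IH].
  by under eq_fun do rewrite big_nil; rewrite big_nil; exact: cvg_cst.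
under eq_fun do rewrite big_cons; rewrite big_cons.
by case: ifP => // Pi; apply: cvgD => //; exact: fl.
Qed.

Lemma cvg_prod_seq (K : numFieldType) (T I : Type) (F : set_system T) (FF : Filter F)
    (r : seq I) (P : pred I) (f : I -> T -> K) (l : I -> K) :
  (forall i, P i -> f i x @[x --> F] --> l i) ->
  \prod_(i <- r | P i) f i x @[x --> F] --> \prod_(i <- r | P i) l i.
Proof.
move=> fl; elim: r => [|i r IH].
  by under eq_fun do rewrite big_nil; rewrite big_nil; exact: cvg_cst.
under eq_fun do rewrite big_cons; rewrite big_cons.
by case: ifP => // Pi; apply: cvgM => //; exact: fl.
Qed.

Lemma continuous_mx (T K : topologicalType) (n p : nat) (f : T -> 'M[K]_(n, p)) x :
  (forall i j, {for x, continuous (fun y => f y i j)}) -> {for x, continuous f}.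
Proof.
move=> cf A [P nP PA]; apply: (@filterS _ (nbhs x) _ [set y | forall i j, P i j (f y i j)]).
  by move=> y; exact: PA.
apply: filter_forall => i; apply: filter_forall => j.
exact: (cf i j (P i j) (nP i j)).
Qed.

(** * Borel structure on matrices and on the symplectic group *)

Section Entries.
Variables (R : realType) (m : nat).
Local Notation bmx := (borel_mx R m).

Lemma open_measurable_mx (A : set 'M[C R]_(m + m)) :
  open A -> measurable (A : set bmx).
Proof. by move=> oA; apply: sub_sigma_algebra. Qed.

Lemma measurable_continuous_mx (f : bmx -> R) :
  continuous (f : 'M[C R]_(m + m) -> R) -> measurable_fun setT f.
Proof.
move=> cf; apply: (measurability _ (RGenOpens.measurableE R)).
move=> _ [_ [a [b ->] <-]]; rewrite setTI; apply: open_measurable_mx.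
by apply: open_comp => // x _; exact: cf.
Qed.

Lemma cmeas_entry i j : cmeas setT (fun U : bmx => (U : 'M[C R]__) i j).
Proof.
split; apply: measurable_continuous_mx => U.
  apply: (@continuous_comp _ _ _ (fun U : 'M[C R]_(m + m) => U i j)
    (@complex.Re R : C R -> R)).
    exact: coord_continuous.
  exact: Re_continuous.
apply: (@continuous_comp _ _ _ (fun U : 'M[C R]_(m + m) => U i j)
  (@complex.Im R : C R -> R)).
  exact: coord_continuous.
exact: Im_continuous.
Qed.

Lemma measurable_mulmx (V : 'M[C R]_(m + m)) :
  measurable_fun setT (fun U : bmx => V *m U : bmx).
Proof.
apply: (@measurability _ _ bmx bmx setT _ (@open 'M[C R]_(m + m)) erefl).
move=> _ [B oB <-]; rewrite setTI; apply: open_measurable_mx.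
apply: open_comp => // U _; apply: continuous_mx => i j.
have -> : (fun U : 'M[C R]_(m + m) => (V *m U) i j) =
    (fun U => \sum_l V i l * U l j) by apply/funext => W; rewrite mxE.
have FU := @nbhs_filter 'M[C R]_(m + m) U.
apply: (@cvg_sum_seq _ _ _ _ FU) => l _.
apply: (@cvgM _ _ _ FU); first exact: cvg_cst.
exact: coord_continuous.
Qed.

(** The defining equations are read entry by entry, as level sets of polynomials in the entries and
    their conjugates. *)
Lemma measurable_USp : measurable (USp R m : set bmx).
Proof.
have -> : USp R m = \bigcap_(ij in [set: 'I_(m + m) * 'I_(m + m)])
  ((setT `&` [set U : bmx | ((U : 'M[C R]__) *m (map_mx Num.conj (U : 'M[C R]__)^T)) ij.1 ij.2 = (1%:M : 'M[C R]__) ij.1 ij.2]) `&`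
  (setT `&` [set U : bmx | ((U : 'M[C R]__)^T *m sympJ R m *m U) ij.1 ij.2 = sympJ R m ij.1 ij.2])).
  apply/seteqP; split => [U [uU sU] [i j] _ /=|U UP].
    by rewrite sU; move/unitarymxP : uU => ->.
  split.
    by apply/unitarymxP/matrixP => i j; have [[_ ?] _] := UP (i, j) I.
  by apply/matrixP => i j; have [_ [_ ?]] := UP (i, j) I.
apply: fin_bigcap_measurable => // -[i j] _; apply: measurableI.
  apply: (@cmeas_level _ _ _ _ (fun U : bmx => (U *m _) i j)) => //.
  under eq_fun do rewrite mxE.
  apply: cmeas_sum => l; apply: cmeasM; first exact: cmeas_entry.
  under eq_fun do rewrite !mxE.
  by apply: cmeas_conj; exact: cmeas_entry.
apply: (@cmeas_level _ _ _ _ (fun U : bmx => (_ *m _ *m U) i j)) => //.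
under eq_fun do rewrite mxE.
apply: cmeas_sum => l; apply: cmeasM; last exact: cmeas_entry.
under eq_fun do rewrite mxE.
apply: cmeas_sum => l'; apply: cmeasM; last exact: cmeas_cst.
under eq_fun do rewrite mxE.
exact: cmeas_entry.
Qed.

End Entries.

Lemma USpM (R : realType) m (U V : 'M[C R]_(m + m)) :
  USp R m U -> USp R m V -> USp R m (U *m V).
Proof.
move=> [uU sU] [uV sV]; split; first exact: mul_unitarymx.
by rewrite trmx_mul !mulmxA -(mulmxA _ U^T) -(mulmxA _ (_ *m _) U) sU.
Qed.

Lemma USp_inv (R : realType) m (U : 'M[C R]_(m + m)) :
  USp R m U -> USp R m (invmx U).
Proof.
move=> [uU sU]; have Uu := unitarymx_unit uU.
split; first by rewrite invmx_unitary // trmxC_unitary.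
rewrite -[in LHS]sU !mulmxA -trmx_mul mulmxV // trmx1 mul1mx.
by rewrite -mulmxA mulmxV // mulmx1.
Qed.

Lemma USp_entry (R : realType) m (U : 'M[C R]_(m + m)) i j :
  USp R m U -> `|U i j| <= 1.
Proof.
move=> [/unitarymxP/matrixP/(_ i i) + _]; rewrite !mxE eqxx => E.
rewrite -(@ler_pXn2r _ 2) ?nnegrE // expr1n normCK -[leRHS]E.
rewrite (bigD1 j) //= !mxE lerDl sumr_ge0 // => l _.
by rewrite !mxE -normCK exprn_ge0.
Qed.

(** * The Haar average as a linear functional *)

Section Haar.
Variables (R : realType) (m : nat) (mu : probability (borel_mx R m) R).
Hypothesis haar : is_haar_USp mu.
Local Notation G := (USp R m).
Local Notation bmx := (borel_mx R m).
Implicit Types f g : bmx -> C R.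

Definition bounded_USp f := exists M : R, forall U, G U -> `|f U| <= M%:C%C.
(** Boundedness is asked for instead of integrability so that the class is closed under products. *)
Definition test f := cmeas (G : set bmx) f /\ bounded_USp f.
Definition haarE f : C R := integralC mu G f.

Lemma test_cst c : test (fun=> c).
Proof.
split; first exact: cmeas_cst.
exists (Num.sqrt (complex.Re c ^+ 2 + complex.Im c ^+ 2)) => U _.
by rewrite normc_def.
Qed.

Lemma test_entry i j : test (fun U => (U : 'M[C R]__) i j).
Proof.
split; first by apply: (@cmeasS _ _ _ _ setT); last exact: cmeas_entry.
by exists 1 => U GU; exact: USp_entry.
Qed.

Lemma testD f g : test f -> test g -> test (fun U => f U + g U).
Proof.
move=> [mf [M fM]] [mg [N gN]]; split; first exact: cmeasD.
exists (M + N) => U GU; rewrite rmorphD /=.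
by apply: le_trans (ler_normD _ _) _; rewrite lerD ?fM ?gN.
Qed.

Lemma testM f g : test f -> test g -> test (fun U => f U * g U).
Proof.
move=> [mf [M fM]] [mg [N gN]]; split; first exact: cmeasM.
exists (M * N) => U GU; rewrite rmorphM /= normrM.
by rewrite ler_pM ?fM ?gN.
Qed.

Lemma test_eq f g : (forall U, G U -> f U = g U) -> test f -> test g.
Proof.
move=> fg [mf [M fM]]; split; first exact: cmeas_eq mf.
by exists M => U GU; rewrite -fg // fM.
Qed.

Lemma test_sum (I : Type) (r : seq I) (P : pred I) (F : I -> bmx -> C R) :
  (forall i, test (F i)) -> test (fun U => \sum_(i <- r | P i) F i U).
Proof.
move=> tF; elim: r => [|i r IH].
  by under eq_fun do rewrite big_nil; exact: test_cst.
under eq_fun do rewrite big_cons.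
by case: (P i) => //; exact: testD.
Qed.

Lemma test_prod (I : Type) (r : seq I) (P : pred I) (F : I -> bmx -> C R) :
  (forall i, test (F i)) -> test (fun U => \prod_(i <- r | P i) F i U).
Proof.
move=> tF; elim: r => [|i r IH].
  by under eq_fun do rewrite big_nil; exact: test_cst.
under eq_fun do rewrite big_cons.
by case: (P i) => //; exact: testM.
Qed.

Lemma test_det n (M : bmx -> 'M[C R]_n) :
  (forall i j, test (fun U => M U i j)) -> test (fun U => \det (M U)).
Proof.
move=> mM; apply: test_sum => s; apply: testM; first exact: test_cst.
by apply: test_prod.
Qed.

Let bounded_real (h : bmx -> R) (M : R) :
  (forall U, G U -> `|h U| <= M) -> [bounded h U | U in (G : set bmx)].
Proof.
move=> hM; exists M; split; first exact: num_real.
by move=> x Mx U GU; apply: le_trans (hM U GU) (ltW Mx).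
Qed.

Let muG_fin : (mu (G : set bmx) < +oo)%E.
Proof. by rewrite haar.1 ltry. Qed.

Lemma test_integrable f : test f ->
  mu.-integrable G (EFin \o (fun U => complex.Re (f U))) /\
  mu.-integrable G (EFin \o (fun U => complex.Im (f U))).
Proof.
move=> [[f1 f2] [M fM]]; split; apply: measurable_bounded_integrable => //;
  try exact: measurable_USp; apply: (@bounded_real _ M) => U GU; rewrite -lecR.
  exact: le_trans (norm_Re_le _) (fM U GU).
exact: le_trans (norm_Im_le _) (fM U GU).
Qed.

Lemma haarE_eq f g : (forall U, G U -> f U = g U) -> haarE f = haarE g.
Proof.
move=> fg; rewrite /haarE /integralC; congr Complex.
  by apply: eq_Rintegral => U /set_mem/fg ->.
by apply: eq_Rintegral => U /set_mem/fg ->.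
Qed.

Lemma haarE_cst c : haarE (fun=> c) = c.
Proof.
rewrite /haarE /integralC !Rintegral_cst; try exact: measurable_USp.
have muG1 : (mu : {measure set bmx -> \bar R}) (G : set bmx) = 1%E := haar.1.
by rewrite /= muG1 /= !mulr1; case: c.
Qed.

Lemma haarED f g : test f -> test g ->
  haarE (fun U => f U + g U) = haarE f + haarE g.
Proof.
move=> /test_integrable[f1 f2] /test_integrable[g1 g2].
rewrite /haarE /integralC.
under eq_Rintegral do rewrite ReD.
under [X in Complex _ X]eq_Rintegral do rewrite ImD.
by rewrite !RintegralD //; exact: measurable_USp.
Qed.

Lemma haarEZ c f : test f -> haarE (fun U => c * f U) = c * haarE f.
Proof.
move=> /test_integrable[f1 f2]; have mG := @measurable_USp R m.
have E1 (a : R) : mu.-integrable G (EFin \o (fun U => a * complex.Re (f U))).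
  by apply: eq_integrable (integrableZl mG a f1).
have E2 (a : R) : mu.-integrable G (EFin \o (fun U => a * complex.Im (f U))).
  by apply: eq_integrable (integrableZl mG a f2).
rewrite /haarE /integralC.
under eq_Rintegral do rewrite ReM.
under [X in Complex _ X]eq_Rintegral do rewrite ImM.
rewrite RintegralB // RintegralD // !RintegralZl //.
by case: c.
Qed.

Lemma haarE_sum (I : Type) (r : seq I) (P : pred I) (F : I -> bmx -> C R) :
  (forall i, test (F i)) ->
  haarE (fun U => \sum_(i <- r | P i) F i U) = \sum_(i <- r | P i) haarE (F i).
Proof.
move=> tF; elim: r => [|i r IH].
  by under eq_fun do rewrite big_nil; rewrite big_nil haarE_cst.
under eq_fun do rewrite big_cons; rewrite big_cons.
case: (P i) => //; rewrite haarED ?IH //; exact: test_sum.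
Qed.

(** The factor 2 comes from bounding real and imaginary parts separately; it is harmless, since the
    bound serves only in limits. *)
Lemma haarE_norm f (M : R) : test f -> (forall U, G U -> `|f U| <= M%:C%C) ->
  `|haarE f| <= (2 * M)%:C%C.
Proof.
move=> /test_integrable[f1 f2] fM.
have mG := @measurable_USp R m.
have Rbound (h : bmx -> R) : mu.-integrable G (EFin \o h) ->
    (forall U, G U -> `|h U| <= M) -> `|\int[mu]_(U in G) h U| <= M.
  move=> ih hM; apply: le_trans (le_normr_Rintegral mG ih) _.
  apply: (@le_trans _ _ (\int[mu]_(U in G) M)).
    apply: le_Rintegral => //; first exact: (integrable_norm ih).
    by apply/measurable_bounded_integrable => //; apply: (@bounded_real _ `|M|).
  have muG1 : (mu : {measure set bmx -> \bar R}) (G : set bmx) = 1%E := haar.1.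
    by rewrite Rintegral_cst // muG1 mulr1.
have a1 := Rbound _ f1.
have a2 := Rbound _ f2.
rewrite [haarE f]complexE; apply: le_trans (ler_normD _ _) _.
rewrite mulr_natl mulr2n rmorphD /= lerD //.
  rewrite normc_def /= expr0n addr0 sqrtr_sqr lecR; apply: a1 => U GU.
  by rewrite -lecR; exact: le_trans (norm_Re_le _) (fM U GU).
rewrite normrM; have -> : `|('i%C : C R)| = 1.
  by rewrite normc_def /= expr0n expr1n add0r sqrtr1.
rewrite mul1r normc_def /= expr0n addr0 sqrtr_sqr lecR; apply: a2 => U GU.
by rewrite -lecR; exact: le_trans (norm_Im_le _) (fM U GU).
Qed.

(** The hypothesis on [mu] concerns images of subsets of [G]; it becomes the equality of [mu] and
    its pushforward on the measurable subsets of [G], which determines integrals over [G]. *)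
Lemma haarE_shift (V : 'M[C R]_(m + m)) f : G V ->
  cmeas setT f -> bounded_USp f ->
  haarE (fun U => f (V *m U)) = haarE f.
Proof.
move=> GV mf bf; have mG := @measurable_USp R m.
have Vu : V \in unitmx by apply: unitarymx_unit; case: GV.
pose phi := (fun U : bmx => V *m U : bmx).
have mphi : measurable_fun setT phi := @measurable_mulmx R m V.
have phiG : phi @^-1` G = G.
  apply/seteqP; split => U /= GU; last exact: USpM.
  by rewrite -[U](mulKmx Vu); apply: USpM => //; exact: USp_inv.
have inv A : measurable A -> A `<=` (G : set bmx) ->
    pushforward mu phi A = mu A.
  (* The preimage of [A] under multiplication by [V] is its image under multiplication by the
     inverse, the form in which invariance is given. *)
  move=> mA AG; rewrite -(haar.2 (invmx V) A (USp_inv GV) mA AG) /pushforward.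
  congr (mu _); apply/seteqP; split => [U /= AU|_ [U AU <-]] /=.
    by exists (phi U) => //; rewrite /phi mulKmx.
  by rewrite /phi mulKVmx.
have key (h : bmx -> R) : measurable_fun setT h ->
    (exists M : R, forall U, G U -> `|h U| <= M) ->
    \int[mu]_(U in G) h (V *m U) = \int[mu]_(U in G) h U.
  move=> mh [M hM]; rewrite /Rintegral; congr fine.
  rewrite -[RHS](eq_measure_integral mu inv).
  rewrite (@integral_pushforward _ _ _ _ _ _ mphi _ _ (EFin \o h)) ?phiG //.
    exact/measurable_EFinP.
  apply: (@measurable_bounded_integrable _ _ _ mu (h \o phi)) => //.
    by apply: measurable_funTS; apply: measurableT_comp.
  by apply: (@bounded_real _ M) => U GU; apply: hM; exact: USpM.
have [M fM] := bf.
rewrite /haarE /integralC; congr Complex; apply: (key (fun U => _ (f U))).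
- exact: mf.1.
- exists M => U GU; rewrite -lecR; exact: le_trans (norm_Re_le _) (fM U GU).
- exact: mf.2.
- exists M => U GU; rewrite -lecR; exact: le_trans (norm_Im_le _) (fM U GU).
Qed.

End Haar.

(** * The Casimir identity *)

Section Jets.
Variable K : numFieldType.
Implicit Types p q : {poly K}.

(* 2-jet at 0 of a polynomial with constant term 1, through the first two
   power sums of its reciprocal roots *)
Definition jet p s1 s2 := [/\ p`_0 = 1, p`_1 = - s1 & p`_2 *+ 2 = s1 ^+ 2 - s2].

Lemma jet1 : jet 1 0 0.
Proof. by split; rewrite coef1 /=; ring. Qed.

Lemma jetM p q a b a' b' : jet p a b -> jet q a' b' -> jet (p * q) (a + a') (b + b').
Proof.
move=> [p0 p1 p2] [q0 q1 q2]; split.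
- by rewrite coefM big_ord_recl big_ord0 /= p0 q0 mul1r addr0.
- by rewrite coefM !big_ord_recl big_ord0 /= p0 q0 q1 /= p1 mul1r mulr1 addr0 opprD addrC.
- rewrite coefM !big_ord_recl big_ord0 /= p0 q0 p1 q1 /bump /= mul1r mulr1 addr0.
  by rewrite !mulrnDl p2 q2; ring.
Qed.

Lemma jet_prod (I : Type) (r : seq I) (P : pred I) (F : I -> {poly K}) a b :
  (forall i, P i -> jet (F i) (a i) (b i)) ->
  jet (\prod_(i <- r | P i) F i) (\sum_(i <- r | P i) a i) (\sum_(i <- r | P i) b i).
Proof.
move=> jF; elim: r => [|i r IH]; first by rewrite !big_nil; exact: jet1.
by rewrite !big_cons; case: ifP => // Pi; apply: jetM => //; exact: jF.
Qed.

Lemma jet_lin z : jet (1 - z *: 'X) z (z ^+ 2).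
Proof.
by split; rewrite !(coefB, coefZ, coef1, coefX) /= ?mulr0 ?mulr1 ?subr0 ?sub0r ?mul0rn ?subrr.
Qed.

End Jets.

Definition det_pencil (K : comNzRingType) n (A B : 'M[K]_n) : {poly K} :=
  \det (map_mx polyC A - 'X *: map_mx polyC B).

Lemma horner_det_pencil (K : comNzRingType) n (A B : 'M[K]_n) t :
  (det_pencil A B).[t] = \det (A - t *: B).
Proof.
rewrite /det_pencil -[LHS]/(horner_eval t _) -det_map_mx; congr (\det _).
by apply/matrixP => i j; rewrite !mxE /= /horner_eval !hornerE.
Qed.

Lemma size_det_pencil (K : comNzRingType) n (A B : 'M[K]_n) :
  (size (det_pencil A B) <= n.+1)%N.
Proof.
apply: (leq_trans (size_sum _ _ _)); apply/bigmax_leqP => s _.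
rewrite -signr_odd; case: odd; rewrite ?expr1 ?mulN1r ?size_polyN ?expr0 ?mul1r.
all: apply: (leq_trans (size_prod_leq _ _)).
all: rewrite cardT size_enum_ord leq_subLR addnS ltnS.
all: apply: (@leq_trans (\sum_(i < n) 2)%N); last by rewrite sum_nat_const card_ord muln2 addnn.
all: apply: leq_sum => i _; rewrite !mxE (leq_trans (size_polyD _ _)) // geq_max.
all: rewrite (leq_trans (size_polyC_leq1 _)) // size_polyN.
all: by rewrite (leq_trans (size_polyMleq _ _)) // size_polyX /= ltnS size_polyC_leq1.
Qed.

Lemma det_pencil_mull (K : comNzRingType) n (A B D : 'M[K]_n) :
  det_pencil (A *m D) (B *m D) = (\det D)%:P * det_pencil A B.
Proof.
rewrite /det_pencil !map_mxM scalemxAl -mulmxBl det_mulmx mulrC.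
by rewrite det_map_mx.
Qed.

(** Schur triangularization turns the determinant into a product of linear factors, whose jets add
    up. *)
Lemma jet_det_pencil (K : numClosedFieldType) n (Y : 'M[K]_n) :
  jet (det_pencil 1%:M Y) (\tr Y) (\tr (Y *m Y)).
Proof.
case: n Y => [|n] Y.
  by rewrite /det_pencil det_mx00 /mxtrace !big_ord0; exact: jet1.
have [P Pu Ttrig] := @Schur K n.+1 Y isT.
have [T TE] : exists T, T = conjmx P Y by exists (conjmx P Y).
have {}Ttrig : is_trig_mx T by rewrite TE.
have Punit := unitarymx_unit Pu.
have YE : Y = invmx P *m T *m P.
  have PP : P ^t* *m P = 1%:M by apply: mulmx1C; apply/unitarymxP.
  by rewrite TE conjymx // invmx_unitary // -!mulmxA PP mulmx1 mulmxA PP mul1mx.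
have pE : det_pencil 1%:M Y = det_pencil 1%:M T.
  have PP : (\det (invmx P))%:P * (\det P)%:P = 1 :> {poly K}.
    by rewrite -polyCM -det_mulmx mulVmx // det1.
  have : det_pencil (1%:M *m P) (T *m P) = det_pencil (P *m 1%:M) (P *m Y).
    by rewrite mulmx1 mul1mx YE !mulmxA mulmxV // mul1mx.
  have -> : det_pencil (P *m 1%:M) (P *m Y) = (\det P)%:P * det_pencil 1%:M Y.
    by rewrite /det_pencil !map_mxM scalemxAr -mulmxBr det_mulmx det_map_mx.
  rewrite det_pencil_mull => /(congr1 (fun p => (\det (invmx P))%:P * p)).
  by rewrite !mulrA PP !mul1r.
have trE : \tr Y = \tr T.
  by rewrite YE mxtrace_mulC mulmxA mulmxV // mul1mx.
have trE2 : \tr (Y *m Y) = \tr (T *m T).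
  rewrite YE -!mulmxA (mulmxA P (invmx P)) mulmxV // mul1mx mxtrace_mulC.
  by rewrite -!mulmxA mulmxV // mulmx1.
rewrite pE trE trE2.
have -> : det_pencil 1%:M T = \prod_i (1 - T i i *: 'X).
  rewrite /det_pencil det_trig.
    by apply: eq_bigr => i _; rewrite !mxE eqxx mulrC mul_polyC.
  apply/is_trig_mxP => i j ij; rewrite !mxE (is_trig_mxP Ttrig) // mulr0 subr0.
  by rewrite -val_eqE /= ltn_eqF.
have -> : \tr (T *m T) = \sum_i T i i ^+ 2.
  apply: eq_bigr => i _; rewrite mxE (bigD1 i) //= big1 ?addr0 ?expr2 // => j ji.
  have [ij|ij] := ltnP i j; first by rewrite (is_trig_mxP Ttrig) // mul0r.
  by rewrite [T j i](is_trig_mxP Ttrig) ?mulr0 // ltn_neqAle ji.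
by apply: jet_prod => i _; exact: jet_lin.
Qed.

(** A coefficient depends linearly on finitely many values, so extracting it commutes with
    averaging; this stands in for differentiation under the integral at t = 0. *)
Lemma coef_from_values (K : fieldType) (N : nat) (t : 'I_N -> K) : injective t ->
  exists W : 'I_N -> 'I_N -> K, forall (p : {poly K}) (q : 'I_N),
    (size p <= N)%N -> p`_q = \sum_r W q r * p.[t r].
Proof.
move=> tinj; pose V := Vandermonde N (\row_j t j).
have Vu : V \in unitmx.
  rewrite unitmxE unitfE det_Vandermonde; apply/prodf_neq0 => i _.
  apply/prodf_neq0 => j ij; rewrite !mxE subr_eq0 (inj_eq tinj) neq_ltn.
  by rewrite ij orbT.
exists (fun q r => invmx V r q) => p q sp.
have -> : p`_q = (poly_rV p : 'rV_N) 0 q by rewrite mxE.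
rewrite -[poly_rV p](mulmxK Vu) mxE; apply: eq_bigr => r _.
rewrite mulrC; congr (_ * _); rewrite mxE (horner_coef_wide _ sp).
by apply: eq_bigr => i _; rewrite !mxE.
Qed.

(** * Cayley transforms of the compact Lie algebra *)

Section Cayley.
Variables (R : realType) (m : nat).
Local Notation J := (sympJ R m).
Implicit Types X : 'M[C R]_(m + m).

Definition usp X := X ^t* = - X /\ X^T *m J = - (J *m X).

Lemma real_conj (t : R) : Num.conj (t%:C%C : C R) = t%:C%C.
Proof. by apply/eqP; rewrite eq_complex /= oppr0 !eqxx. Qed.

(** A row [v] killed by 1 - t X satisfies v v^* = t v X v^*. The left side is real and, [X] being
    skew-Hermitian and [t] real, the right side is purely imaginary. *)
Lemma cayley_unit X (t : R) : X ^t* = - X -> 1%:M - t%:C%C *: X \in unitmx.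
Proof.
move=> Xh; rewrite -row_free_unit; apply: inj_row_free => v.
rewrite mulmxBr mulmx1 -scalemxAr => /eqP; rewrite subr_eq0 => /eqP vE.
apply: mxform_eq0.
have E : v *m v ^t* = t%:C%C *: (v *m X *m v ^t*) by rewrite {1}vE -scalemxAl.
have Eh : (v *m v ^t*) ^t* = v *m v ^t*.
  by rewrite trmx_mul map_mxM /= trmxCK.
have : v *m v ^t* = - (v *m v ^t*).
  rewrite -{1}Eh {1}E linearZ /= map_mxZ /= real_conj trmx_mul map_mxM trmx_mul map_mxM /=.
  by rewrite Xh trmxCK mulNmx mulmxN scalerN mulmxA E.
by move=> /eqP; rewrite -subr_eq0 opprK -mulr2n -scaler_nat scaler_eq0 pnatr_eq0 => /eqP.
Qed.

Lemma cayley_USp X (t : R) : usp X ->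
  USp R m (invmx (1%:M - t%:C%C *: X) *m (1%:M + t%:C%C *: X)).
Proof.
move=> [Xh Xs]; have Au := cayley_unit t Xh.
have Bu : 1%:M + t%:C%C *: X \in unitmx.
  have := cayley_unit (- t) Xh.
  by rewrite rmorphN /= scaleNr opprK.
have AB : (1%:M - t%:C%C *: X) *m (1%:M + t%:C%C *: X) =
          (1%:M + t%:C%C *: X) *m (1%:M - t%:C%C *: X).
  rewrite mulmxBl mulmxDl !mul1mx mulmxDr mulmxBr !mulmx1.
  by rewrite opprD !addrA addrK subrK.
have Ah : (1%:M - t%:C%C *: X) ^t* = 1%:M + t%:C%C *: X.
  by rewrite linearB linearZ /= trmx1 map_mxB map_mxZ /= real_conj map_mx1 Xh scalerN opprK.
have Bh : (1%:M + t%:C%C *: X) ^t* = 1%:M - t%:C%C *: X.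
  by rewrite linearD linearZ /= trmx1 map_mxD map_mxZ /= real_conj map_mx1 Xh scalerN.
have AJ : (1%:M - t%:C%C *: X)^T *m J = J *m (1%:M + t%:C%C *: X).
  rewrite linearB linearZ /= trmx1 mulmxBl mul1mx -scalemxAl Xs scalerN opprK.
  by rewrite mulmxDr mulmx1 -scalemxAr.
have BJ : (1%:M + t%:C%C *: X)^T *m J = J *m (1%:M - t%:C%C *: X).
  rewrite linearD linearZ /= trmx1 mulmxDl mul1mx -scalemxAl Xs scalerN.
  by rewrite mulmxBr mulmx1 -scalemxAr.
move: AB Ah Bh AJ BJ Au Bu.
move: (1%:M - t%:C%C *: X) (1%:M + t%:C%C *: X) => A B AB Ah Bh AJ BJ Au Bu.
split.
  apply/unitarymxP; rewrite trmx_mul map_mxM /= Bh.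
  have -> : (invmx A) ^t* = invmx B by rewrite trmx_inv map_invmx /= Ah.
  by rewrite mulmxA -(mulmxA _ B) -AB mulmxA mulVmx // mul1mx mulmxV.
have AVJ : (invmx A)^T *m J = J *m invmx B.
  rewrite trmx_inv -[J in LHS](mulmxK Bu) -AJ mulmxA mulKmx ?unitmx_tr //.
rewrite trmx_mul -(mulmxA _ _ J) AVJ mulmxA BJ -!mulmxA.
rewrite (mulmxA (invmx B)).
have -> : invmx B *m invmx A = invmx A *m invmx B.
  apply: (can_inj (mulKmx Au)); rewrite mulKVmx //.
  by apply: (can_inj (mulKmx Bu)); rewrite mulmxV // !mulmxA -AB -!mulmxA mulKVmx // mulmxV.
by rewrite -mulmxA mulVmx // mulmx1 mulmxV // mulmx1.
Qed.

End Cayley.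

Section Casimir.
Variables (R : realType) (m : nat) (mu : probability (borel_mx R m) R).
Hypothesis haar : is_haar_USp mu.
Local Notation G := (USp R m).
Local Notation mx := 'M[C R]_(m + m).
Local Notation E := (haarE mu).
Variables (n : nat) (a : 'I_n -> C R).

Definition numer (U : mx) : C R := \prod_i \det (1%:M - a i *: U).
Definition cay (b : C R) (U : mx) : mx := (1%:M + b *: U) *m invmx (1%:M - b *: U).

Hypothesis a_reg : forall U i, G U -> 1%:M - a i *: U \in unitmx.

Lemma test_affine (A B : mx) i j : test (fun U => (A + B *m U) i j).
Proof.
rewrite (_ : (fun U => _) = fun U : mx => A i j + \sum_l B i l * U l j).
  apply: testD; first exact: test_cst.
  by apply: test_sum => l; apply: testM; [exact: test_cst|exact: test_entry].
by apply/funext => U; rewrite !mxE.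
Qed.

Lemma test_numer : test numer.
Proof.
apply: test_prod => i; apply: test_det => k l.
have -> : (fun U : mx => (1%:M - a i *: U) k l) =
  (fun U : mx => (1%:M + (- a i)%:M *m U) k l).
  by apply/funext => U; rewrite mul_scalar_mx scaleNr.
exact: test_affine.
Qed.

(** With V = (1 - t X)^-1 (1 + t X), factor [i] at t equals det (1 - t X) det (1 - a_i V U), because
    (1 - t X) - a_i (1 + t X) U = (1 - a_i U) - t X (1 + a_i U). *)
Let pencil (X U : mx) : {poly C R} :=
  \prod_i det_pencil (1%:M - a i *: U) (X *m (1%:M + a i *: U)).

Let pencilE X U t : (pencil X U).[t] = \prod_i \det ((1%:M - t *: X) + (- a i *: (1%:M + t *: X)) *m U).
Proof.
rewrite horner_prod; apply: eq_bigr => i _; rewrite horner_det_pencil; congr (\det _).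
rewrite mulmxDr mulmx1 -scalemxAr -scalemxAl mulmxDl mul1mx -scalemxAl.
rewrite !scalerDr !scaleNr !scalerA (mulrC t) opprD !addrA; congr (_ - _).
by rewrite addrAC.
Qed.

Let pencil_jet X U : G U -> exists2 h, pencil X U = (numer U)%:P * h &
  jet h (\sum_i \tr (X *m cay (a i) U)) (\sum_i \tr (X *m cay (a i) U *m (X *m cay (a i) U))).
Proof.
move=> GU; exists (\prod_i det_pencil 1%:M (X *m cay (a i) U)); last first.
  by apply: jet_prod => i _; exact: jet_det_pencil.
rewrite rmorph_prod -big_split /=; apply: eq_bigr => i _.
rewrite -det_pencil_mull mul1mx; congr det_pencil.
by rewrite /cay -!mulmxA mulVmx ?mulmx1 ?a_reg.
Qed.

(** Twice the difference of the t^2 coefficients of [pencil X U] divided by [numer U] and of det (1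
    - t X) ^ n, both written through power sums as in [jet]. *)
Definition casimir_form (X U : mx) : C R :=
  (\sum_i \tr (X *m cay (a i) U)) ^+ 2
  - \sum_i \tr (X *m cay (a i) U *m (X *m cay (a i) U))
  - ((n%:R * \tr X) ^+ 2 - n%:R * \tr (X *m X)).

Lemma haarE_pencil X (t : R) : usp X ->
  E (fun U => (pencil X U).[t%:C%C]) = (det_pencil 1%:M X ^+ n).[t%:C%C] * E numer.
Proof.
move=> uX; set V := invmx (1%:M - t%:C%C *: X) *m (1%:M + t%:C%C *: X).
have GV : G V := cayley_USp t uX.
have mn : cmeas setT (numer : borel_mx R m -> C R).
  apply: cmeas_prod => i; apply: cmeas_det => k l.
  have -> : (fun U : borel_mx R m => (1%:M - a i *: (U : mx)) k l) =
      (fun U : borel_mx R m => (1%:M : mx) k l + (- a i) * (U : mx) k l).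
    by apply/funext => U; rewrite !mxE mulNr.
  by apply: cmeasD; [|apply: cmeasM; last exact: cmeas_entry]; exact: cmeas_cst.
rewrite -(haarE_shift haar GV mn test_numer.2) -(haarEZ haar); last first.
  apply: test_prod => i; apply: test_det => k l.
  have -> : (fun U : mx => (1%:M - a i *: (V *m U)) k l) =
    (fun U : mx => (1%:M + (- a i *: V) *m U) k l).
    by apply/funext => U; rewrite -scalemxAl scaleNr.
  exact: test_affine.
apply: haarE_eq => U GU; rewrite pencilE horner_exp horner_det_pencil.
rewrite -[X in _ ^+ X]card_ord -prodr_const -big_split; apply: eq_bigr => i _.
rewrite /= -det_mulmx; congr (\det _).
rewrite mulmxBr mulmx1 -scalemxAr mulmxA /V mulKVmx ?(cayley_unit t uX.1) //.
by rewrite -scalemxAl scaleNr.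
Qed.

(* The t^2 coefficient of the invariance of the measure under Cayley
   transforms of t X. *)
Lemma casimir_usp X : usp X ->
  test (fun U => numer U * casimir_form X U) /\
  E (fun U => numer U * casimir_form X U) = 0.
Proof.
move=> uX.
(* The degrees in t are at most (m + m) n; the extra room makes 2 a valid index even when n = 0. *)
pose N := ((m + m).+1 * n).+3.
pose t (r : 'I_N) : R := r%:R.
have tinj : injective (fun r => (t r)%:C%C : C R).
  by move=> r s /= [] /eqP; rewrite eqr_nat => /eqP/val_inj.
have [W WE] := coef_from_values tinj.
pose H := det_pencil 1%:M X ^+ n.
pose P U := pencil X U - (numer U)%:P * H.
have sprod k (g : 'I_n -> {poly C R}) : (forall i, (size (g i) <= k.+1)%N) ->
    (size (\prod_i g i)%R <= (k * n).+1)%N.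
  move=> gk; apply: (leq_trans (size_prod_leq _ _)).
  rewrite cardT size_enum_ord leq_subLR addnS ltnS -mulSn.
  apply: (@leq_trans (\sum_(i < n) k.+1)%N); first exact: leq_sum.
  by rewrite sum_nat_const card_ord mulnC.
have sP U : (size (P U) <= N)%N.
  have sG : (size (pencil X U) <= N)%N.
    by apply: (leq_trans (sprod (m + m)%N _ (fun i => size_det_pencil _ _))); rewrite /N; lia.
  have sH : (size H <= N)%N.
    rewrite /H -[X in _ ^+ X]card_ord -prodr_const.
    by apply: (leq_trans (sprod (m + m)%N _ (fun i => size_det_pencil _ _))); rewrite /N; lia.
  rewrite (leq_trans (size_polyD _ _)) // geq_max sG size_polyN mul_polyC.
  exact: leq_trans (size_scale_leq _ _) sH.
pose f U := \sum_r (2 * W (inord 2) r) *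
  ((pencil X U).[(t r)%:C%C] - H.[(t r)%:C%C] * numer U).
have fE U : G U -> f U = numer U * casimir_form X U.
  move=> GU; have [h hE [h0 h1 h2]] := pencil_jet X GU.
  have : (P U)`_2 *+ 2 = f U.
    have -> : (P U)`_2 = (P U)`_(inord 2 : 'I_N) by rewrite inordK.
    rewrite (WE _ (inord 2) (sP U)) -mulr_natl mulr_sumr; apply: eq_bigr => r _.
    by rewrite /P hornerD hornerN mul_polyC hornerZ mulrA [numer U * _]mulrC.
  have [H0 H1 H2] : jet H (n%:R * \tr X) (n%:R * \tr (X *m X)).
    rewrite /H -[X in _ ^+ X]card_ord -prodr_const.
    have nE (b : C R) : n%:R * b = \sum_(i < n) b by rewrite sumr_const card_ord mulr_natl.
    rewrite !nE.
    by apply: jet_prod => i _; exact: jet_det_pencil.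
  move=> <-; rewrite /P hE -mulrBr mul_polyC coefZ coefB -mulrnAr mulrnBl h2 H2.
  by [].
have tp r : test (fun U => (pencil X U).[(t r)%:C%C]).
  under eq_fun do rewrite pencilE.
  by apply: test_prod => i; apply: test_det => k l; exact: test_affine.
have td r : test (fun U => (pencil X U).[(t r)%:C%C] - H.[(t r)%:C%C] * numer U).
  under eq_fun do rewrite -mulNr.
  by apply: testD => //; apply: testM; [exact: test_cst|exact: test_numer].
have tf r : test (fun U => 2 * W (inord 2) r * ((pencil X U).[(t r)%:C%C] - H.[(t r)%:C%C] * numer U)).
  by apply: testM => //; exact: test_cst.
split; first by apply: (@test_eq _ _ f) => //; exact: test_sum.
rewrite -(@haarE_eq _ _ mu f _ fE) /f (haarE_sum haar) // big1 // => r _; rewrite (haarEZ haar) //.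
under eq_fun do rewrite -mulNr.
rewrite (haarED haar) //; last by apply: testM; [exact: test_cst|exact: test_numer].
rewrite (haarEZ haar) ?haarE_pencil ?mulNr ?subrr ?mulr0 //; exact: test_numer.
Qed.

End Casimir.

(** * Contraction over the symplectic Lie algebra *)

Section Contraction.
Variables (K : comNzRingType) (n : nat).
Local Notation mx := 'M[K]_n.
Variable J : mx.
Hypotheses (J_tr : J^T = - J) (J_sqr : J *m J = - 1%:M).
Implicit Types A B : mx.

(** The adjoint for the symplectic form, as J^-1 = -J. The complex symplectic Lie algebra consists
    of the X with [sadj X = - X]. *)
Definition sadj A : mx := - (J *m A^T *m J).

Lemma sadjM A B : sadj (A *m B) = sadj B *m sadj A.
Proof.
rewrite /sadj trmx_mul; move: A^T B^T J_sqr; move: J => j a b jj.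
rewrite mulNmx mulmxN opprK -!mulmxA (mulmxA j j) jj.
by rewrite mulNmx mul1mx !mulmxN.
Qed.

Lemma sadjD A B : sadj (A + B) = sadj A + sadj B.
Proof. by rewrite /sadj linearD /= mulmxDr mulmxDl opprD. Qed.

Lemma sadjN A : sadj (- A) = - sadj A.
Proof. by rewrite /sadj linearN /= mulmxN mulNmx. Qed.

Lemma sadjZ c A : sadj (c *: A) = c *: sadj A.
Proof. by rewrite /sadj linearZ /= -scalemxAr -scalemxAl scalerN. Qed.

Lemma sadj1 : sadj 1%:M = 1%:M.
Proof. by rewrite /sadj trmx1 mulmx1 J_sqr opprK. Qed.

Lemma sadj_sum (I : finType) (F : I -> mx) : sadj (\sum_i F i) = \sum_i sadj (F i).
Proof.
rewrite /sadj linear_sum /= mulmx_sumr mulmx_suml -sumrN //.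
Qed.

Lemma sadjK A : sadj (sadj A) = A.
Proof.
rewrite /sadj linearN /= !trmx_mul trmxK J_tr !mulNmx !mulmxN !opprK.
rewrite mulNmx opprK !mulmxA J_sqr -mulmxA J_sqr.
by rewrite mulmxN mulmx1 mulNmx mul1mx opprK.
Qed.

Lemma mxtrace_sadj A : \tr (sadj A) = \tr A.
Proof.
rewrite /sadj linearN /= mxtrace_mulC mulmxA J_sqr mulNmx mul1mx.
by rewrite linearN /= opprK mxtrace_tr.
Qed.

(** Twice the projection of a matrix unit to the Lie algebra. These elements span it without being
    independent, and the sum of [sp_unit p q] tensor [sp_unit q p] over all p, q is a multiple of
    the Casimir element. *)
Definition sp_unit p q : mx := delta_mx p q - sadj (delta_mx p q).

Lemma sadj_sp_unit p q : sadj (sp_unit p q) = - sp_unit p q.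
Proof. by rewrite /sp_unit sadjD sadjN sadjK opprB addrC. Qed.

Lemma mxtrace_delta p q A : \tr (delta_mx p q *m A) = A q p.
Proof.
rewrite /mxtrace (bigD1 p) //= mxE (bigD1 q) //= !mxE !eqxx mul1r.
rewrite !big1 ?addr0 //.
  move=> i ip; rewrite mxE big1 // => j _; rewrite mxE (negPf ip) mul0r //.
by move=> j jq; rewrite mxE (negPf jq) andbF mul0r.
Qed.

Lemma mxtrace_sp_unit p q A : \tr (sp_unit p q *m A) = (A - sadj A) q p.
Proof.
rewrite /sp_unit mulmxBl linearB /= mxtrace_delta -(mxtrace_sadj (sadj _ *m A)).
by rewrite sadjM sadjK mxtrace_mulC mxtrace_delta !mxE.
Qed.

Lemma mxtrace_entries A B : \sum_p \sum_q A q p * B p q = \tr (A *m B).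
Proof. by rewrite exchange_big; apply: eq_bigr => q _; rewrite mxE. Qed.

Lemma sum_mxtrace_sp_unit A B :
  \sum_p \sum_q \tr (sp_unit p q *m A) * \tr (sp_unit q p *m B) =
  \tr ((A - sadj A) *m (B - sadj B)).
Proof.
rewrite -mxtrace_entries; apply: eq_bigr => p _; apply: eq_bigr => q _.
by rewrite !mxtrace_sp_unit.
Qed.

Lemma mxtrace_delta2 p q r s A B :
  \tr (delta_mx p q *m A *m (delta_mx r s *m B)) = A q r * B s p.
Proof.
rewrite -mulmxA mxtrace_delta mxE (bigD1 r) //= big1 ?addr0.
  congr (_ * _); rewrite mxE (bigD1 s) //= !mxE !eqxx mul1r big1 ?addr0 //.
  by move=> j js; rewrite mxE (negPf js) andbF mul0r.
move=> j jr; rewrite mxE [X in _ * X]big1 ?mulr0 // => l _.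
by rewrite mxE (negPf jr) mul0r.
Qed.

(** Of the four terms of the expansion, the two unmixed ones give products of traces; in the two
    mixed ones [sadj] exchanges the indices of one matrix unit, which leaves a single trace. *)
Lemma sum_mxtrace_sp_unit2 A B :
  \sum_p \sum_q \tr (sp_unit p q *m A *m (sp_unit q p *m B)) =
  2 * (\tr A * \tr B) + 2 * \tr (sadj A *m B).
Proof.
have cross A' B' : \sum_p \sum_q \tr (delta_mx p q *m A' *m (sadj (delta_mx q p) *m B'))
    = - \tr (sadj A' *m B').
  transitivity (\sum_p \sum_q - ((A' *m J)^T p q * (J *m B') q p)).
    apply: eq_bigr => p _; apply: eq_bigr => q _.
    rewrite [(_ *m J)^T p q]mxE -mxtrace_delta2 /sadj trmx_delta mulNmx mulmxN linearN /=.
    by rewrite !mulmxA.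
  under eq_bigr do rewrite sumrN; rewrite sumrN exchange_big /= mxtrace_entries; congr (- _).
  rewrite trmx_mul J_tr /sadj !mulNmx; congr (\tr (- _)).
  by rewrite !mulmxA.
have diag A' B' : \sum_p \sum_q \tr (delta_mx p q *m A' *m (delta_mx q p *m B')) = \tr A' * \tr B'.
  rewrite mulr_sumr; apply: eq_bigr => p _; rewrite mulr_suml.
  by apply: eq_bigr => q _; rewrite mxtrace_delta2.
transitivity (\sum_p \sum_q (\tr (delta_mx p q *m A *m (delta_mx q p *m B))
    - \tr (delta_mx p q *m A *m (sadj (delta_mx q p) *m B))
    - \tr (delta_mx q p *m B *m (sadj (delta_mx p q) *m A))
    + \tr (delta_mx p q *m sadj B *m (delta_mx q p *m sadj A)))).
  apply: eq_bigr => p _; apply: eq_bigr => q _.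
  rewrite [\tr (delta_mx q p *m B *m _)]mxtrace_mulC.
  have <- : \tr (sadj (delta_mx p q) *m A *m (sadj (delta_mx q p) *m B)) =
      \tr (delta_mx p q *m sadj B *m (delta_mx q p *m sadj A)).
    rewrite -mxtrace_sadj !sadjM !sadjK mxtrace_mulC.
    by rewrite -!mulmxA mxtrace_mulC !mulmxA mxtrace_mulC !mulmxA.
  rewrite /sp_unit !mulmxBl !mulmxBr !linearB /=; ring.
under eq_bigr => p _ do rewrite big_split /= !sumrB.
rewrite big_split /= !sumrB !diag cross !mxtrace_sadj.
rewrite [X in _ - X + _]exchange_big /= cross.
have -> : \tr (sadj B *m A) = \tr (sadj A *m B) by rewrite -mxtrace_sadj sadjM sadjK.
ring.
Qed.

End Contraction.

Section UspUnits.
Variables (R : realType) (m : nat).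
Local Notation mx := 'M[C R]_(m + m).
Local Notation J := (sympJ R m).
Local Notation sadj := (sadj J).
Local Notation sp_unit := (sp_unit J).
Implicit Types A B X : mx.

Lemma sadj_conj A : sadj (A ^t*) = (sadj A) ^t*.
Proof.
have Jc : map_mx Num.conj J = J.
  by rewrite map_block_mx map_mx0 map_mxN map_mx1.
rewrite /sadj [in RHS]linearN /= map_mxN !trmx_mul !map_mxM /= trmxK sympJ_tr.
by rewrite !map_mxN /= Jc !mulNmx !mulmxN opprK map_trmx trmxK mulmxA.
Qed.

Lemma usp_sadj X : X ^t* = - X -> sadj X = - X -> usp X.
Proof.
move=> Xh Xs; split => //; rewrite -mulmxN -Xs /sadj mulmxN !mulmxA sympJ_sqr.
by rewrite mulNmx mul1mx mulNmx opprK.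
Qed.

Let ctB A B : (A - B) ^t* = A ^t* - B ^t*.
Proof. by rewrite linearB /= map_mxB. Qed.

Let ctD A B : (A + B) ^t* = A ^t* + B ^t*.
Proof. by rewrite linearD /= map_mxD. Qed.

Let ctZ c A : (c *: A) ^t* = c^* *: A ^t*.
Proof. by rewrite linearZ /= map_mxZ. Qed.

Lemma sp_unit_conj p q : (sp_unit p q) ^t* = sp_unit q p.
Proof.
have dE : (delta_mx p q : mx) ^t* = delta_mx q p.
  by rewrite trmx_delta map_delta_mx.
by rewrite /sp_unit ctB -sadj_conj dE.
Qed.

(** The conjugate transpose of [sp_unit p q] is [sp_unit q p], so this difference and i times the
    sum are the combinations that lie in the compact real form. *)
Lemma usp_sp_unit_sub p q : usp (sp_unit p q - sp_unit q p).
Proof.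
move: (sp_unit_conj p q) (sp_unit_conj q p) (sadj_sp_unit (sympJ_tr R m) (sympJ_sqr R m) p q)
  (sadj_sp_unit (sympJ_tr R m) (sympJ_sqr R m) q p).
move: (sp_unit p q) (sp_unit q p) => X Y cX cY aX aY.
by apply: usp_sadj; rewrite ?ctB ?cX ?cY ?sadjD ?sadjN ?aX ?aY ?opprB // opprK addrC.
Qed.

Lemma usp_sp_unit_add p q : usp ('i *: (sp_unit p q + sp_unit q p)).
Proof.
move: (sp_unit_conj p q) (sp_unit_conj q p) (sadj_sp_unit (sympJ_tr R m) (sympJ_sqr R m) p q)
  (sadj_sp_unit (sympJ_tr R m) (sympJ_sqr R m) q p).
move: (sp_unit p q) (sp_unit q p) => X Y cX cY aX aY.
apply: usp_sadj; last by rewrite sadjZ sadjD aX aY -opprD scalerN.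
by rewrite ctZ ctD cX cY conjCi scaleNr addrC.
Qed.

End UspUnits.

Section CasimirContraction.
Variables (K : numClosedFieldType) (N : nat) (J : 'M[K]_N).
Hypotheses (J_tr : J^T = - J) (J_sqr : J *m J = - 1%:M).
Variables (n : nat) (M : 'I_n -> 'M[K]_N).
Implicit Types X Y Z A B : 'M[K]_N.

(** This is [casimir_form] with arbitrary matrices in place of the Cayley matrices. *)
Definition casimir_quad (X : 'M[K]_N) : K :=
  (\sum_i \tr (X *m M i)) ^+ 2 - \sum_i \tr (X *m M i *m (X *m M i))
  - ((n%:R * \tr X) ^+ 2 - n%:R * \tr (X *m X)).

(** The last summand is the share of det (1 - t X) ^ n: for the identity matrix the first
    contraction is 0 and the second is 2 N (N + 1). *)
Definition casimir_contr : K :=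
  \tr ((\sum_i M i - sadj J (\sum_i M i)) *m (\sum_i M i - sadj J (\sum_i M i)))
  - \sum_i 2 * (\tr (M i) ^+ 2 + \tr (sadj J (M i) *m M i))
  + n%:R * (2 * N%:R * (N%:R + 1)).

Let quad X Y A : \tr ((X - Y) *m A *m ((X - Y) *m A)) +
    \tr (('i *: (X + Y)) *m A *m (('i *: (X + Y)) *m A)) =
    - 2 * (\tr (X *m A *m (Y *m A)) + \tr (Y *m A *m (X *m A))) :> K.
Proof.
rewrite -!scalemxAl -!scalemxAr !scalerA -expr2 sqrCi scaleN1r.
rewrite (mulmxBl X Y A) (mulmxDl X Y A); move: (X *m A) (Y *m A) => B D.
have trN (B' : 'M[K]_N) : \tr (- B') = - \tr B' :> K by rewrite linearN.
rewrite trN (mulmxBl B D) (mulmxDl B D) !mulmxBr !mulmxDr.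
by rewrite !(mxtraceD, trN); ring.
Qed.

(** For a quadratic form, the value at X - Y plus the value at i (X + Y) is -4 times the polar form
    at (X, Y), the squares cancelling because i^2 = -1. Thus real elements of the compact form yield
    the mixed pairings of [sp_unit p q] with [sp_unit q p]. *)
Lemma casimir_quad_polar X Y :
  casimir_quad (X - Y) + casimir_quad ('i *: (X + Y)) =
  - 4 * (\tr (X *m \sum_i M i) * \tr (Y *m \sum_i M i))
  + 2 * (\sum_i \tr (X *m M i *m (Y *m M i)) + \sum_i \tr (Y *m M i *m (X *m M i)))
  + (4 * n%:R ^+ 2) * (\tr (X *m 1%:M) * \tr (Y *m 1%:M))
  - (2 * n%:R) * (\tr (X *m 1%:M *m (Y *m 1%:M)) + \tr (Y *m 1%:M *m (X *m 1%:M))).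
Proof.
have sumS Z : \sum_i \tr (Z *m M i) = \tr (Z *m \sum_i M i).
  by rewrite mulmx_sumr linear_sum.
have q1 := quad X Y 1%:M; rewrite !mulmx1 in q1.
have qS : \sum_i \tr ((X - Y) *m M i *m ((X - Y) *m M i)) +
    \sum_i \tr (('i *: (X + Y)) *m M i *m (('i *: (X + Y)) *m M i)) =
    - 2 * (\sum_i \tr (X *m M i *m (Y *m M i)) + \sum_i \tr (Y *m M i *m (X *m M i))).
  by rewrite -!big_split mulr_sumr; apply: eq_bigr => i _; exact: quad.
have lin A : \tr (('i *: (X + Y)) *m A) = 'i * (\tr (X *m A) + \tr (Y *m A)).
  by rewrite -scalemxAl mulmxDl linearZ linearD.
have linB A : \tr ((X - Y) *m A) = \tr (X *m A) - \tr (Y *m A).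
  by rewrite mulmxBl linearB.
have lin1 : \tr ('i *: (X + Y)) = 'i * (\tr X + \tr Y) by rewrite linearZ linearD.
have linB1 : \tr (X - Y) = \tr X - \tr Y by rewrite linearB.
rewrite /casimir_quad !sumS lin linB lin1 linB1 !mulmx1.
transitivity ((\tr (X *m \sum_i M i) - \tr (Y *m \sum_i M i)) ^+ 2
  + 'i ^+ 2 * (\tr (X *m \sum_i M i) + \tr (Y *m \sum_i M i)) ^+ 2
  - (\sum_i \tr ((X - Y) *m M i *m ((X - Y) *m M i)) +
    \sum_i \tr (('i *: (X + Y)) *m M i *m (('i *: (X + Y)) *m M i)))
  - (n%:R ^+ 2 * ((\tr X - \tr Y) ^+ 2 + 'i ^+ 2 * (\tr X + \tr Y) ^+ 2)
     - n%:R * (\tr ((X - Y) *m (X - Y)) + \tr ('i *: (X + Y) *m ('i *: (X + Y)))))).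
  by ring.
rewrite qS q1 sqrCi; ring.
Qed.

Lemma sum_casimir_quad :
  \sum_p \sum_q (casimir_quad (sp_unit J p q - sp_unit J q p) +
                 casimir_quad ('i *: (sp_unit J p q + sp_unit J q p))) =
  - 4 * casimir_contr.
Proof.
under eq_bigr do under eq_bigr do rewrite casimir_quad_polar.
have S1 := sum_mxtrace_sp_unit J_tr J_sqr.
have S2 := sum_mxtrace_sp_unit2 J_tr J_sqr.
have S2' A B : \sum_p \sum_q \tr (sp_unit J q p *m A *m (sp_unit J p q *m B)) =
  2 * (\tr A * \tr B) + 2 * \tr (sadj J A *m B) by rewrite exchange_big S2.
transitivity (- 4 * (\sum_p \sum_q \tr (sp_unit J p q *m \sum_i M i) * \tr (sp_unit J q p *m \sum_i M i))
  + 2 * (\sum_i (\sum_p \sum_q \tr (sp_unit J p q *m M i *m (sp_unit J q p *m M i)))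
       + \sum_i (\sum_p \sum_q \tr (sp_unit J q p *m M i *m (sp_unit J p q *m M i))))
  + (4 * n%:R ^+ 2) * (\sum_p \sum_q \tr (sp_unit J p q *m 1%:M) * \tr (sp_unit J q p *m 1%:M))
  - (2 * n%:R) * (\sum_p \sum_q \tr (sp_unit J p q *m 1%:M *m (sp_unit J q p *m 1%:M))
     + \sum_p \sum_q \tr (sp_unit J q p *m 1%:M *m (sp_unit J p q *m 1%:M)))).
  have swap (F : 'I_n -> 'I_N -> 'I_N -> K) :
      \sum_i \sum_p \sum_q F i p q = \sum_p \sum_q \sum_i F i p q.
    by rewrite exchange_big; apply: eq_bigr => p _; rewrite exchange_big.
  have add2 (F F' : 'I_N -> 'I_N -> K) : \sum_p \sum_q (F p q + F' p q) =
      \sum_p \sum_q F p q + \sum_p \sum_q F' p q.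
    by rewrite -big_split; apply: eq_bigr => p _; rewrite big_split.
  have scale2 x (F : 'I_N -> 'I_N -> K) :
      \sum_p \sum_q x * F p q = x * \sum_p \sum_q F p q.
    by rewrite mulr_sumr; apply: eq_bigr => p _; rewrite mulr_sumr.
  have sub2 (F F' : 'I_N -> 'I_N -> K) : \sum_p \sum_q (F p q - F' p q) =
      \sum_p \sum_q F p q - \sum_p \sum_q F' p q.
    by rewrite -sumrB; apply: eq_bigr => p _; rewrite sumrB.
  by rewrite sub2 !add2 !scale2 !add2 -!swap.
rewrite (S1 (\sum_i M i) (\sum_i M i)) (S1 1%:M 1%:M) (S2 1%:M 1%:M) (S2' 1%:M 1%:M).
rewrite (eq_bigr _ (fun i _ => S2 (M i) (M i))) (eq_bigr _ (fun i _ => S2' (M i) (M i))).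
rewrite /casimir_contr (sadj1 J_sqr) !subrr mulmx0 linear0 mulmx1 !mxtrace1.
have -> : \sum_i 2 * (\tr (M i) ^+ 2 + \tr (sadj J (M i) *m M i)) =
   \sum_i (2 * (\tr (M i) * \tr (M i)) + 2 * \tr (sadj J (M i) *m M i)).
  by apply: eq_bigr => i _; ring.
ring.
Qed.

End CasimirContraction.

(** * The Casimir identity for the Haar average, in terms of the spectrum *)

Section CasimirAverage.
Variables (R : realType) (m : nat) (mu : probability (borel_mx R m) R).
Hypothesis haar : is_haar_USp mu.
Local Notation G := (USp R m).
Local Notation J := (sympJ R m).
Local Notation mx := 'M[C R]_(m + m).
Local Notation E := (haarE mu).
Variables (n : nat) (a : 'I_n -> C R).
Hypothesis a_reg : forall (U : mx) i, G U -> 1%:M - a i *: U \in unitmx.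

Definition casimir (U : mx) : C R := casimir_contr J (fun i => cay (a i) U).

Lemma haarE_casimir :
  test (fun U => numer a U * casimir U) /\ E (fun U => numer a U * casimir U) = 0.
Proof.
pose q p (U : mx) :=
  numer a U * casimir_form a (sp_unit J p.1 p.2 - sp_unit J p.2 p.1) U +
  numer a U * casimir_form a ('i *: (sp_unit J p.1 p.2 + sp_unit J p.2 p.1)) U.
have tq p : test (q p).
  apply: testD.
    by have [] := casimir_usp haar a_reg (usp_sp_unit_sub R p.1 p.2).
  by have [] := casimir_usp haar a_reg (usp_sp_unit_add R p.1 p.2).
have Eq p : E (q p) = 0.
  have [t1 e1] := casimir_usp haar a_reg (usp_sp_unit_sub R p.1 p.2).
  have [t2 e2] := casimir_usp haar a_reg (usp_sp_unit_add R p.1 p.2).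
  by rewrite (haarED haar) // e1 e2 addr0.
have fE (U : mx) : G U -> (- 4^-1) * \sum_p q p U = numer a U * casimir U.
  move=> _; rewrite -(pair_bigA _ (fun p r => q (p, r) U)) /q /=.
  under eq_bigr do under eq_bigr do rewrite -mulrDr.
  under eq_bigr do rewrite -mulr_sumr.
  rewrite -mulr_sumr (sum_casimir_quad (sympJ_tr R m) (sympJ_sqr R m)) mulrCA; congr (_ * _).
  by rewrite !mulNr mulrN opprK mulrA mulVf ?mul1r // pnatr_eq0.
have tS : test (fun U => \sum_p q p U) by apply: test_sum.
split.
  by apply: (test_eq fE); apply: testM => //; exact: test_cst.
rewrite -(haarE_eq mu fE) (haarEZ haar) // (haarE_sum haar) // big1 ?mulr0 //.
Qed.

End CasimirAverage.

(** The contraction at the Cayley matrices of [U]: since the spectrum is paired, it depends on [U]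
    only through the sums [x l] of inverse eigenvalues. *)
Definition cayley_sum (K : fieldType) m n (alpha : 'I_n -> K) (x : 'I_m -> K) : K :=
  8 * \sum_l (x l ^+ 2 - 4) * (\sum_i (alpha i - x l)^-1) ^+ 2
  - 8 * \sum_i (alpha i ^+ 2 - 4) * (\sum_l (alpha i - x l)^-1) ^+ 2
  - 4 * \sum_i \sum_l (alpha i + x l) / (alpha i - x l)
  + 4 * n%:R * m%:R * (2 * m%:R + 1).

Lemma dg_cayley (K : fieldType) N (P : 'M[K]_N) (d : 'rV[K]_N) b :
  P \in unitmx -> (forall i, 1 - b * d 0 i != 0) ->
  (1%:M + b *: (invmx P *m diag_mx d *m P)) *m
    invmx (1%:M - b *: (invmx P *m diag_mx d *m P)) =
  invmx P *m diag_mx (\row_i ((1 + b * d 0 i) / (1 - b * d 0 i))) *m P.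
Proof.
move=> Pu nz; rewrite -scaleNr !dg_affine // dg_inv //; last first.
  by move=> i; rewrite mxE mulNr.
rewrite dg_mul //; congr (_ *m diag_mx _ *m _).
by apply/rowP => i; rewrite !mxE mulNr.
Qed.

(** [sadj] reverses products and sends [U] to its inverse; the reversed factors commute. *)
Lemma sadj_cayley (K : fieldType) N (J U : 'M[K]_N) b : J *m J = - 1%:M ->
  sadj J U = invmx U -> 1%:M - b *: U \in unitmx ->
  sadj J ((1%:M + b *: U) *m invmx (1%:M - b *: U)) =
  (1%:M + b *: invmx U) *m invmx (1%:M - b *: invmx U).
Proof.
move=> J2 aU bu.
have lin c : sadj J (1%:M + c *: U) = 1%:M + c *: invmx U.
  by rewrite sadjD sadj1 // sadjZ aU.
have [E Vu] : sadj J (invmx (1%:M - b *: U)) = invmx (1%:M - b *: invmx U) /\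
    1%:M - b *: invmx U \in unitmx.
  have E : sadj J (invmx (1%:M - b *: U)) *m (1%:M - b *: invmx U) = 1%:M.
    have -> : 1%:M - b *: invmx U = sadj J (1%:M - b *: U) by rewrite -!scaleNr lin.
    by rewrite -sadjM // mulmxV // sadj1.
  have [_ Vu] := mulmx1_unit E; split => //.
  by rewrite -[LHS](mulmxK Vu) E mul1mx.
rewrite sadjM // E lin; move: Vu; move: (invmx U) => V Vu.
have AB : (1%:M - b *: V) *m (1%:M + b *: V) = (1%:M + b *: V) *m (1%:M - b *: V).
  rewrite mulmxBl mulmxDl !mul1mx mulmxDr mulmxBr !mulmx1.
  by rewrite opprD !addrA addrK subrK.
by rewrite -[LHS](mulmxK Vu); congr (_ *m _); rewrite -mulmxA -AB mulKmx.
Qed.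

Section CasimirSpectrum.
Variables (K : numClosedFieldType) (m : nat) (zeta : 'I_m -> K).
Local Notation x l := (zeta l + (zeta l)^-1).

Lemma big_pairs (idx : K) (op : Monoid.com_law idx) (d : 'rV[K]_(m + m)) (h : K -> K) :
  perm_eq [seq d 0 i | i : 'I_(m + m)]
    ([seq zeta l | l : 'I_m] ++ [seq (zeta l)^-1 | l : 'I_m]) ->
  \big[op/idx]_i h (d 0 i) = \big[op/idx]_l op (h (zeta l)) (h (zeta l)^-1).
Proof.
move=> pd; have -> : \big[op/idx]_i h (d 0 i) =
    \big[op/idx]_(z <- [seq d 0 i | i : 'I_(m + m)]) h z by rewrite big_image.
by rewrite (perm_big _ pd) big_cat !big_image /= -big_split.
Qed.

Variables (J U P : 'M[K]_(m + m)) (d : 'rV[K]_(m + m)).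
Hypotheses (J_sqr : J *m J = - 1%:M) (aU : sadj J U = invmx U) (Pu : P \in unitmx).
Hypotheses (UE : U = invmx P *m diag_mx d *m P) (zeta1 : forall l, `|zeta l| = 1).
Hypothesis pd : perm_eq [seq d 0 i | i : 'I_(m + m)]
    ([seq zeta l | l : 'I_m] ++ [seq (zeta l)^-1 | l : 'I_m]).
Variables (n : nat) (a : 'I_n -> K).
Hypothesis a01 : forall i, 0 < `|a i| < 1.
Local Notation al i := (a i + (a i)^-1).

Let d1 i : `|d 0 i| = 1.
Proof.
have : d 0 i \in [seq d 0 i | i : 'I_(m + m)] by rewrite map_f ?mem_enum.
rewrite (perm_mem pd) mem_cat => /orP[] /mapP[l _ ->] //.
by rewrite normfV zeta1 invr1.
Qed.

Let a0 i : a i != 0. Proof. by rewrite -normr_gt0; case/andP: (a01 i). Qed.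
Let z0 l : zeta l != 0. Proof. by rewrite -normr_gt0 zeta1. Qed.
Let d0 i : d 0 i != 0. Proof. by rewrite -normr_gt0 d1. Qed.

Let nz i z : `|z| = 1 -> 1 - a i * z != 0.
Proof.
move=> z1; rewrite subr_eq0; apply/eqP => /(congr1 Num.norm).
rewrite normrM z1 normr1 mulr1 => /esym E.
by have /andP[_] := a01 i; rewrite E ltxx.
Qed.

Lemma det_spectrum b : \det (1%:M - b *: U) = \prod_l ((1 - b * zeta l) * (1 - b * (zeta l)^-1)).
Proof.
rewrite UE -scaleNr dg_affine // dg_det //.
rewrite -(big_pairs _ (fun z => 1 - b * z) pd).
by apply: eq_bigr => i _; rewrite mxE mulNr.
Qed.

Let M i := (1%:M + a i *: U) *m invmx (1%:M - a i *: U).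
Let xal i l : (1 - a i * zeta l) * (1 - a i * (zeta l)^-1) = a i * (al i - x l).
Proof. by have := a0 i; have := z0 l => h1 h2; field; rewrite h1 h2. Qed.

Let alx i l : al i - x l != 0.
Proof.
have : a i * (al i - x l) != 0.
  by rewrite -xal mulf_neq0 // nz // ?normfV ?zeta1 ?invr1.
by rewrite mulf_eq0 negb_or => /andP[].
Qed.

Let UVE : invmx U = invmx P *m diag_mx (\row_i (d 0 i)^-1) *m P.
Proof. by rewrite UE dg_inv. Qed.

Let ME i : M i = invmx P *m diag_mx (\row_j ((1 + a i * d 0 j) / (1 - a i * d 0 j))) *m P.
Proof. by rewrite /M UE dg_cayley // => j; exact: nz. Qed.

Let aME i : sadj J (M i) =
  invmx P *m diag_mx (\row_j ((1 + a i * (d 0 j)^-1) / (1 - a i * (d 0 j)^-1))) *m P.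
Proof.
rewrite /M sadj_cayley //; last first.
  rewrite unitmxE unitfE det_spectrum; apply/prodf_neq0 => l _.
  by rewrite xal mulf_neq0.
rewrite UVE dg_cayley // => [|j]; last by rewrite mxE nz // normfV d1 invr1.
by congr (_ *m diag_mx _ *m _); apply/rowP => j; rewrite !mxE.
Qed.

Let w i z : K := (1 + a i * z) / (1 - a i * z).
Let dgf (h : K -> K) : 'M[K]_(m + m) := invmx P *m diag_mx (\row_j h (d 0 j)) *m P.

Let dgf_tr h : \tr (dgf h) = \sum_l (h (zeta l) + h (zeta l)^-1).
Proof.
rewrite dg_tr // -(big_pairs _ h pd).
by apply: eq_bigr => j _; rewrite mxE.
Qed.

Let dgf_mul h h' : dgf h *m dgf h' = dgf (fun z => h z * h' z).
Proof.
rewrite dg_mul //; congr (_ *m diag_mx _ *m _).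
by apply/rowP => j; rewrite !mxE.
Qed.

Let dgf_sumB (I : finType) (h h' : I -> K -> K) :
  \sum_i dgf (h i) - \sum_i dgf (h' i) = dgf (fun z => \sum_i (h i z - h' i z)).
Proof.
rewrite /dgf !dg_sum -scaleN1r dg_scale dg_add; congr (_ *m diag_mx _ *m _).
apply/rowP => j; rewrite !mxE !summxE mulN1r sumrB.
by congr (_ - _); apply: eq_bigr => i _; rewrite mxE.
Qed.

Let MEw i : M i = dgf (w i). Proof. exact: ME. Qed.
Let aMEw i : sadj J (M i) = dgf (fun z => w i z^-1). Proof. exact: aME. Qed.

(** Only [x] and [al] survive in the contraction because the squares of zeta - 1/zeta and of 1/a - a
    are x^2 - 4 and al^2 - 4. *)
Let wz i l : [/\ w i (zeta l) - w i (zeta l)^-1 = 2 * (zeta l - (zeta l)^-1) / (al i - x l),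
  w i (zeta l) + w i (zeta l)^-1 = 2 * ((a i)^-1 - a i) / (al i - x l) &
  w i (zeta l)^-1 * w i (zeta l) = (al i + x l) / (al i - x l)].
Proof.
have h1 := nz i (zeta1 l); have h2 : 1 - a i * (zeta l)^-1 != 0.
  by rewrite nz // normfV zeta1 invr1.
have h3 := z0 l; have h4 := a0 i; have h5 := alx i l.
have -> : (al i - x l)^-1 = a i / ((1 - a i * zeta l) * (1 - a i * (zeta l)^-1)).
  by rewrite xal invfM mulVKf.
have h6 : zeta l - a i != 0.
  by move: h2; rewrite -[zeta l - _](mulVKf h3) mulrBr mulVf // mulf_eq0 negb_or h3 mulrC.
by rewrite /w; split; field; rewrite ?h1 ?h3 ?h4 ?h6.
Qed.

Lemma casimir_spectrum :
  casimir_contr J M = cayley_sum (fun i => al i) (fun l => x l).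
Proof.
rewrite /casimir_contr /cayley_sum.
have -> : \sum_i M i - sadj J (\sum_i M i) = dgf (fun z => \sum_i (w i z - w i z^-1)).
  rewrite sadj_sum; under eq_bigr do rewrite MEw.
  by under [X in _ - X]eq_bigr do rewrite aMEw; rewrite dgf_sumB.
rewrite dgf_mul dgf_tr.
have -> : \sum_l (((\sum_i (w i (zeta l) - w i (zeta l)^-1)) * \sum_i (w i (zeta l) - w i (zeta l)^-1)) +
   (\sum_i (w i (zeta l)^-1 - w i (zeta l)^-1^-1)) * \sum_i (w i (zeta l)^-1 - w i (zeta l)^-1^-1)) =
   8 * \sum_l (x l ^+ 2 - 4) * (\sum_i (al i - x l)^-1) ^+ 2.
  rewrite mulr_sumr; apply: eq_bigr => l _; rewrite invrK.
  have -> : \sum_i (w i (zeta l) - w i (zeta l)^-1) =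
      2 * (zeta l - (zeta l)^-1) * \sum_i (al i - x l)^-1.
    by rewrite mulr_sumr; apply: eq_bigr => i _; have [-> _ _] := wz i l.
  have -> : \sum_i (w i (zeta l)^-1 - w i (zeta l)) =
      - (2 * (zeta l - (zeta l)^-1)) * \sum_i (al i - x l)^-1.
    rewrite mulNr mulr_sumr -sumrN; apply: eq_bigr => i _; have [E _ _] := wz i l.
    by rewrite -E opprB.
  by have := z0 l => h; field; rewrite h.
have -> : \sum_i 2 * (\tr (M i) ^+ 2 + \tr (sadj J (M i) *m M i)) =
    8 * \sum_i (al i ^+ 2 - 4) * (\sum_l (al i - x l)^-1) ^+ 2 +
    4 * \sum_i \sum_l (al i + x l) / (al i - x l).
  rewrite !mulr_sumr -big_split; apply: eq_bigr => i _.
  rewrite aMEw MEw dgf_mul !dgf_tr /=.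
  have -> : \sum_l (w i (zeta l) + w i (zeta l)^-1) =
     2 * ((a i)^-1 - a i) * \sum_l (al i - x l)^-1.
    by rewrite mulr_sumr; apply: eq_bigr => l _; have [_ -> _] := wz i l.
  have -> : \sum_l (w i (zeta l)^-1 * w i (zeta l) + w i (zeta l)^-1^-1 * w i (zeta l)^-1) =
     2 * \sum_l (al i + x l) / (al i - x l).
    rewrite mulr_sumr; apply: eq_bigr => l _; have [_ _ E] := wz i l.
    by rewrite invrK [X in _ + X]mulrC E; ring.
  by have := a0 i => h; field; rewrite h.
rewrite natrD; ring.
Qed.

End CasimirSpectrum.

(** * Averages of products of characteristic polynomials *)

Section Chebyshev.
Variable K : numFieldType.
Implicit Types (p q : {poly K}).

(** [cheb n] is the monic rescaling U_n (X/2) of the Chebyshev polynomial of the second kind;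
    carrying two consecutive terms makes the recursion structural. *)
Fixpoint cheb2 n : {poly K} * {poly K} :=
  if n is n'.+1 then let: (u, v) := cheb2 n' in (v, 'X * v - u) else (1, 'X).
Definition cheb n := (cheb2 n).1.

Lemma cheb2E n : cheb2 n = (cheb n, cheb n.+1).
Proof. by rewrite /cheb /=; case: (cheb2 n). Qed.

Lemma cheb0 : cheb 0 = 1. Proof. by []. Qed.
Lemma cheb1 : cheb 1 = 'X. Proof. by []. Qed.
Lemma chebSS n : cheb n.+2 = 'X * cheb n.+1 - cheb n.
Proof. by rewrite {1}/cheb /= cheb2E. Qed.

Lemma cheb_monic_size n : cheb n \is monic /\ size (cheb n) = n.+1.
Proof.
elim/ltn_ind: n => -[_|[_|n IH]]; first by rewrite cheb0 monic1 size_poly1.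
  by rewrite cheb1 monicX size_polyX.
have [m1 s1] := IH n.+1 (ltnSn _); have [m0 s0] := IH n (ltnW (ltnSn _)).
have sX : size ('X * cheb n.+1) = n.+3.
  by rewrite size_monicM ?monicX ?monic_neq0 // size_polyX s1.
rewrite chebSS; split; last by rewrite size_polyDl ?size_polyN ?sX ?s0.
by rewrite monicE lead_coefDl ?size_polyN ?sX ?s0 // -monicE monicMl ?monicX.
Qed.

Lemma cheb_monic n : cheb n \is monic. Proof. by have [] := cheb_monic_size n. Qed.
Lemma size_cheb n : size (cheb n) = n.+1. Proof. by have [] := cheb_monic_size n. Qed.

Lemma horner_cheb n z : z != 0 -> (z - z^-1) * (cheb n).[z + z^-1] = z ^+ n.+1 - z^-1 ^+ n.+1.
Proof.
move=> z0; elim/ltn_ind: n => -[_|[_|n IH]].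
- by rewrite cheb0 hornerC mulr1 !expr1.
- by rewrite cheb1 hornerX; ring.
- have := IH n (ltnW (ltnSn _)); have := IH n.+1 (ltnSn _).
  rewrite chebSS !hornerE mulrBr mulrCA => -> ->.
  by rewrite !exprS; move: (z ^+ n) (z^-1 ^+ n) => A B; field.
Qed.

(** The operator of the Chebyshev differential equation, in the rescaled variable. *)
Definition lop p : {poly K} := ('X ^+ 2 - 4%:R) * p^`()^`() + 3 *: ('X * p^`()).

Lemma lopD p q : lop (p + q) = lop p + lop q.
Proof. by rewrite /lop !derivD !mulrDr scalerDr addrACA. Qed.

Lemma lopZ c p : lop (c *: p) = c *: lop p.
Proof. by rewrite /lop !derivZ -!mul_polyC; ring. Qed.

Lemma lopN p : lop (- p) = - lop p.
Proof. by rewrite -scaleN1r lopZ scaleN1r. Qed.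

Lemma lop_sum (I : finType) (F : I -> {poly K}) : lop (\sum_i F i) = \sum_i lop (F i).
Proof.
apply: (big_morph lop lopD); rewrite -(scale0r (0 : {poly K})) lopZ !scale0r //.
Qed.

Lemma lopM p q :
  lop (p * q) = lop p * q + 2 *: (('X ^+ 2 - 4%:R) * p^`() * q^`()) + p * lop q.
Proof. rewrite /lop !(derivM, derivD) -!mul_polyC; ring. Qed.

Lemma lopX : lop 'X = 3 *: 'X.
Proof. by rewrite /lop derivX -polyC1 derivC mulr0 add0r polyC1 mulr1. Qed.

(** The left-hand side is the cross term of [lopM] for the product 'X * cheb n, which makes the
    eigenvalue equation provable along the recurrence. *)
Lemma deriv_cheb n : ('X ^+ 2 - 4%:R) * (cheb n)^`() =
  (2 * n.+1)%:R * cheb n.+1 - n.+2%:R * ('X * cheb n).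
Proof.
elim/ltn_ind: n => -[_|[_|n IH]].
- by rewrite cheb0 cheb1 -polyC1 derivC; ring.
- by rewrite chebSS cheb0 cheb1 derivX; ring.
- have E0 := IH n (ltnW (ltnSn _)); have E1 := IH n.+1 (ltnSn _).
  rewrite [in LHS]chebSS derivB derivM derivX mul1r mulrBr mulrDr mulrCA E0 E1.
  by rewrite !(chebSS n.+1) !(chebSS n); ring.
Qed.

Lemma lop_cheb n : lop (cheb n) = (n * n.+2)%:R *: cheb n.
Proof.
elim/ltn_ind: n => -[_|[_|n IH]].
- by rewrite cheb0 /lop -polyC1 derivC deriv0 !mulr0 scaler0 addr0 mul0n scale0r.
- by rewrite cheb1 lopX.
- have E0 := IH n (ltnW (ltnSn _)); have E1 := IH n.+1 (ltnSn _).
  have F := deriv_cheb n.+1.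
  rewrite chebSS lopD lopN lopM lopX E0 E1 derivX mulr1 F chebSS.
  by rewrite -!mul_polyC !polyCMn; ring.
Qed.

End Chebyshev.

(** * Operators acting on one row of a determinant *)

Section RowReplacement.
Variables (K : comNzRingType) (n : nat).
Implicit Types (A : 'M[K]_n) (v : 'I_n -> K).

(** The determinant of [A] with row [i] replaced by [v], encoded by cofactors so that linearity in
    [v] is immediate. An operator in the variable alpha_i acts on det (P_j (alpha_i)) through row
    [i] alone. *)
Definition rdet A i v : K := \sum_j v j * cofactor A i j.

Lemma rdetE A i v : rdet A i v = \det (\matrix_(i', j) (if i' == i then v j else A i' j)).
Proof.
rewrite (expand_det_row _ i); apply: eq_bigr => j _; rewrite mxE eqxx; congr (_ * _).
rewrite /cofactor; congr (_ * \det _); apply/matrixP => r s; rewrite !mxE.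
by rewrite eq_sym (negPf (neq_lift _ _)).
Qed.

Lemma rdet_row A i i' : rdet A i (A i') = if i == i' then \det A else 0.
Proof.
have := congr1 (fun B : 'M[K]_n => B i' i) (mul_mx_adj A).
rewrite !mxE eq_sym => E; rewrite /rdet -[RHS]mulrb -E.
by apply: eq_bigr => j _; rewrite mxE.
Qed.

Lemma eq_rdet A i v v' : v =1 v' -> rdet A i v = rdet A i v'.
Proof. by move=> vv; apply: eq_bigr => j _; rewrite vv. Qed.

Lemma rdetD A i v v' : rdet A i (fun j => v j + v' j) = rdet A i v + rdet A i v'.
Proof. by rewrite -big_split; apply: eq_bigr => j _; rewrite mulrDl. Qed.

Lemma rdetZ A i c v : rdet A i (fun j => c * v j) = c * rdet A i v.
Proof. by rewrite mulr_sumr; apply: eq_bigr => j _; rewrite mulrA. Qed.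

(** Exchanging the sums groups the terms by column, and column [j] contributes its own expansion of
    the determinant, times [c j]. *)
Lemma sum_rdet_scale A (c : 'I_n -> K) :
  \sum_i rdet A i (fun j => c j * A i j) = (\sum_j c j) * \det A.
Proof.
rewrite exchange_big mulr_suml; apply: eq_bigr => j _ /=.
rewrite (expand_det_col A j) mulr_sumr; apply: eq_bigr => i _.
by rewrite -mulrA.
Qed.

Lemma rdet_diag A (D : 'rV[K]_n) i v :
  rdet (diag_mx D *m A) i (fun j => D 0 i * v j) = (\prod_i D 0 i) * rdet A i v.
Proof.
rewrite !rdetE -det_diag -det_mulmx; congr (\det _).
by apply/matrixP => r s; rewrite !mul_diag_mx !mxE; case: eqP => [->|].
Qed.

End RowReplacement.

Section Vandermonde.
Variables (K : fieldType) (n : nat).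
Implicit Type al : 'I_n -> K.

Definition vdm al : K := \prod_(i < n) \prod_(j < n | (i < j)%N) (al j - al i).

Lemma vdm_neq0 al : injective al -> vdm al != 0.
Proof.
move=> ali; apply/prodf_neq0 => i _; apply/prodf_neq0 => j ij.
by rewrite subr_eq0 (inj_eq ali) neq_ltn ij orbT.
Qed.

Lemma det_monic_basis (p : 'I_n -> {poly K}) al :
  (forall j, p j \is monic /\ size (p j) = j.+1) ->
  \det (\matrix_(i, j) (p j).[al i]) = vdm al.
Proof.
move=> pm; pose T : 'M[K]_n := \matrix_(j, k) (p j)`_k.
have T1 : \det T = 1.
  rewrite det_trig; last first.
    apply/is_trig_mxP => j k jk; rewrite mxE nth_default //.
    by rewrite (pm j).2.
  rewrite big1 // => j _; rewrite mxE; have [/monicP m s] := pm j.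
  by rewrite -[RHS]m lead_coefE s.
have -> : (\matrix_(i, j) (p j).[al i]) = (T *m Vandermonde n (\row_i al i))^T.
  apply/matrixP => i j; rewrite !mxE (@horner_coef_wide _ n); last first.
    by rewrite (pm j).2.
  by apply: eq_bigr => k _; rewrite !mxE.
rewrite det_tr det_mulmx T1 mul1r det_Vandermonde.
by apply: eq_bigr => i _; apply: eq_bigr => j _; rewrite !mxE.
Qed.

End Vandermonde.

Section LogDerivative.
Variable K : fieldType.

Lemma horner_deriv_prod (I : finType) (P : pred I) (x : I -> K) z :
  (forall i, P i -> z - x i != 0) ->
  let D := \prod_(i | P i) ('X - (x i)%:P) in
  D^`().[z] = D.[z] * \sum_(i | P i) (z - x i)^-1 /\
  D^`()^`().[z] = D.[z] * ((\sum_(i | P i) (z - x i)^-1) ^+ 2 - \sum_(i | P i) (z - x i)^-2).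
Proof.
move=> nz D.
pose Q (D : {poly K}) s t := D^`().[z] = D.[z] * s /\ D^`()^`().[z] = D.[z] * (s ^+ 2 - t).
apply: (big_rec3 (fun t s (D : {poly K}) => Q D s t)).
  by rewrite /Q -polyC1 derivC deriv0 horner0 !mulr0 expr0n subrr mulr0.
move=> i t s q Pi [q1 q2]; have := nz i Pi => xi; rewrite /Q.
have dX : ('X - (x i)%:P)^`() = 1 by rewrite derivB derivX derivC subr0.
have E1 : (('X - (x i)%:P) * q)^`() = q + ('X - (x i)%:P) * q^`().
  by rewrite derivM dX mul1r.
rewrite E1 derivD derivM dX mul1r !hornerE q1 q2 -exprVn; split=> /=; field; exact: xi.
Qed.

(** The degree bound leaves [p] a constant multiple of the product of the 'X - al j over j != i. *)
Lemma horner_deriv_roots n (p : {poly K}) (al : 'I_n -> K) i : injective al ->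
  (size p <= n)%N -> (forall j, j != i -> p.[al j] = 0) ->
  p^`().[al i] = p.[al i] * \sum_(j | j != i) (al i - al j)^-1.
Proof.
move=> ali sp p0.
have [q pE] : exists q, p = q * \prod_(j | j != i) ('X - (al j)%:P).
  pose s := [seq al j | j <- enum [pred j | j != i]].
  have : \prod_(z <- s) ('X - z%:P) %| p.
    apply: uniq_roots_dvdp; last by rewrite uniq_rootsE map_inj_uniq ?enum_uniq.
    apply/allP => _ /mapP[j + ->]; rewrite mem_enum inE => ji.
    by rewrite /root p0.
  move=> /dvdpP[q ->]; exists q; rewrite big_map big_enum //.
set D := \prod_(j | j != i) _ in pE.
have Dm : D \is monic by apply: monic_prod => j _; exact: monicXsubC.
have sD : size D = n.
  rewrite /D -big_enum -(big_map al xpredT (fun z => 'X - z%:P)) size_prod_XsubC.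
  rewrite size_map -cardE; have := cardC1 i; rewrite card_ord => ->.
  by rewrite prednK // (leq_ltn_trans _ (ltn_ord i)).
have [c qE] : exists c, q = c%:P.
  have [->|q0] := eqVneq q 0; first by exists 0; rewrite polyC0.
  exists q`_0; apply: size1_polyC; move: sp; rewrite pE size_Mmonic // sD.
  by rewrite -subn1 leq_subLR leq_add2r.
have nz j : j != i -> al i - al j != 0.
  by move=> ji; rewrite subr_eq0 (inj_eq ali) eq_sym.
have [d1 _] := horner_deriv_prod nz.
by rewrite pE qE derivM derivC mul0r add0r !hornerE d1 mulrA.
Qed.

End LogDerivative.

Section CayleySum.
Variables (K : numFieldType) (n m : nat) (al : 'I_n -> K) (x : 'I_m -> K).
Hypotheses (al_inj : injective al) (alx : forall i l, al i - x l != 0).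
Local Notation s i := (\sum_l (al i - x l)^-1).
Local Notation t i := (\sum_l (al i - x l)^-2).
Local Notation v i := (\sum_(j | j != i) (al i - al j)^-1).

Let al_neq i j : j != i -> al i - al j != 0.
Proof. by move=> ji; rewrite subr_eq0 (inj_eq al_inj) eq_sym. Qed.

(** Partial fractions in [x l] trade a product of poles at [al i] and [al j] for differences divided
    by al i - al j. The sums [v i] so obtained are logarithmic derivatives of the Vandermonde
    product, as needed for an operator applied to that product times the values of [xpoly]. *)
Lemma cayley_sum_derivE : cayley_sum al x =
  - 8 * (\sum_i ((al i ^+ 2 - 4) * (s i ^+ 2 - t i) + 3 * al i * s i
                 + 2 * (al i ^+ 2 - 4) * s i * v i)
         - n%:R * m%:R * (n%:R + m%:R + 1)).
Proof.
have diag i : \sum_l (x l ^+ 2 - 4) * ((al i - x l)^-1 * (al i - x l)^-1) =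
    (al i ^+ 2 - 4) * t i - 2 * al i * s i + m%:R.
  have -> : m%:R = \sum_(l < m) 1 :> K by rewrite sumr_const card_ord.
  rewrite !mulr_sumr -sumrB -big_split; apply: eq_bigr => l _ /=.
  by have := alx i l => h; field.
have offdiag i j : j != i -> \sum_l (x l ^+ 2 - 4) * ((al i - x l)^-1 * (al j - x l)^-1) =
    m%:R - (al i ^+ 2 - 4) * s i * (al i - al j)^-1 - (al j ^+ 2 - 4) * s j * (al j - al i)^-1.
  move=> ji; have -> : m%:R = \sum_(l < m) 1 :> K by rewrite sumr_const card_ord.
  rewrite !mulr_sumr !mulr_suml -!sumrB; apply: eq_bigr => l _ /=.
  have h1 := alx i l; have h2 := alx j l; have h3 := al_neq ji.
  have ij : i != j by rewrite eq_sym.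
  by have h4 := al_neq ij; field; rewrite h1 h2 h3 h4.
have swap (F : 'I_n -> 'I_n -> K) :
    \sum_i \sum_(j | j != i) F i j = \sum_i \sum_(j | j != i) F j i.
  rewrite (exchange_big_dep xpredT) //=; apply: eq_bigr => i _.
  by apply: eq_bigl => j; rewrite eq_sym.
have T : \sum_l (x l ^+ 2 - 4) * (\sum_i (al i - x l)^-1) ^+ 2 =
    \sum_i ((al i ^+ 2 - 4) * t i - 2 * al i * s i + m%:R
            + (n%:R - 1) * m%:R - 2 * (al i ^+ 2 - 4) * s i * v i).
  transitivity (\sum_i \sum_j \sum_l (x l ^+ 2 - 4) * ((al i - x l)^-1 * (al j - x l)^-1)).
    under [RHS]eq_bigr do rewrite exchange_big; rewrite exchange_big; apply: eq_bigr => l _ /=.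
    by rewrite [X in _ * X]expr2 big_distrlr mulr_sumr; apply: eq_bigr => i _; rewrite mulr_sumr.
  transitivity (\sum_i ((al i ^+ 2 - 4) * t i - 2 * al i * s i + m%:R)
     + \sum_i \sum_(j | j != i) (m%:R - (al i ^+ 2 - 4) * s i * (al i - al j)^-1
          - (al j ^+ 2 - 4) * s j * (al j - al i)^-1)).
    rewrite -big_split; apply: eq_bigr => i _ /=; rewrite (bigD1 i) //= diag.
    by congr (_ + _); apply: eq_bigr => j ji; rewrite offdiag.
  have sub2 (F F' : 'I_n -> 'I_n -> K) : \sum_i \sum_(j | j != i) (F i j - F' i j) =
      \sum_i \sum_(j | j != i) F i j - \sum_i \sum_(j | j != i) F' i j.
    by rewrite -sumrB; apply: eq_bigr => i _; rewrite sumrB.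
  have card1 (i : 'I_n) : \sum_(j | j != i) m%:R = (n%:R - 1) * m%:R :> K.
    have E : #|predC1 i| = n.-1 by rewrite cardC1 card_ord.
    rewrite (eq_bigl (mem (predC1 i))) // sumr_const E.
    rewrite -[in RHS](ltn_predK (ltn_ord i)) -natr1 addrK.
    by rewrite mulr_natl.
  have offs (F : 'I_n -> K) : \sum_i \sum_(j | j != i) F i * (al i - al j)^-1 =
      \sum_i F i * v i by apply: eq_bigr => i _; rewrite mulr_sumr.
  rewrite !sub2 [X in _ + (_ - _ - X)]swap (offs (fun i => (al i ^+ 2 - 4) * s i)).
  under [X in _ + (X - _ - _)]eq_bigr do rewrite card1.
  rewrite -!sumrB -big_split; apply: eq_bigr => i _ /=; ring.
have U : \sum_i \sum_l (al i + x l) / (al i - x l) = \sum_i (2 * al i * s i - m%:R).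
  apply: eq_bigr => i _; have -> : m%:R = \sum_(l < m) 1 :> K by rewrite sumr_const card_ord.
  rewrite mulr_sumr -sumrB; apply: eq_bigr => l _.
  by have := alx i l => h; field.
have nE : n%:R = \sum_(i < n) 1 :> K by rewrite sumr_const card_ord.
rewrite /cayley_sum T U.
have -> : 4 * n%:R * m%:R * (2 * m%:R + 1) = \sum_(i < n) 4 * m%:R * (2 * m%:R + 1) :> K.
  by rewrite sumr_const card_ord -mulr_natl; ring.
have -> : n%:R * m%:R * (n%:R + m%:R + 1) = \sum_(i < n) m%:R * (n%:R + m%:R + 1) :> K.
  by rewrite sumr_const card_ord -mulr_natl; ring.
rewrite ![8 * \sum_(i < n) _]mulr_sumr [4 * \sum_(i < n) _]mulr_sumr -!sumrB.
rewrite [RHS]mulr_sumr -big_split; apply: eq_bigr => i _ /=; ring.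
Qed.

End CayleySum.

Section CasimirDet.
Variables (K : numFieldType) (n m : nat).

Definition xpoly (x : 'I_m -> K) : {poly K} := \prod_l ('X - (x l)%:P).
Definition xcheb (x : 'I_m -> K) j : {poly K} := cheb K j * xpoly x.
(** Column [j] holds a monic polynomial of degree m + j, while the determinant is still the
    Vandermonde product times the values of [xpoly x]. *)
Definition xmat (x : 'I_m -> K) (al : 'I_n -> K) : 'M[K]_n :=
  \matrix_(i, j) (xcheb x j).[al i].
Definition cheb_mat (al : 'I_n -> K) : 'M[K]_n := \matrix_(i, j) (cheb K j).[al i].
Definition cheb_wt q : K := (q * q.+2)%:R.

Lemma det_cheb_mat al : \det (cheb_mat al) = vdm al.
Proof. by apply: det_monic_basis => j; split; rewrite ?cheb_monic ?size_cheb. Qed.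

Lemma xmatE x al : xmat x al = diag_mx (\row_i (xpoly x).[al i]) *m cheb_mat al.
Proof. by apply/matrixP => i j; rewrite mul_diag_mx !mxE hornerM mulrC. Qed.

Lemma det_xmat x al : \det (xmat x al) = vdm al * \prod_i (xpoly x).[al i].
Proof.
rewrite xmatE det_mulmx det_diag det_cheb_mat mulrC; congr (_ * _).
by apply: eq_bigr => i _; rewrite mxE.
Qed.

(** As a polynomial in the variable of row [i], the determinant has degree below [n] and vanishes at
    the other [al j], so [horner_deriv_roots] gives its derivative. *)
Lemma rdet_deriv_cheb al i : injective al ->
  rdet (cheb_mat al) i (fun j => (cheb K j)^`().[al i]) =
  \det (cheb_mat al) * \sum_(j | j != i) (al i - al j)^-1.
Proof.
move=> ali; pose p := \sum_j cofactor (cheb_mat al) i j *: cheb K j.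
have pE z : p.[z] = rdet (cheb_mat al) i (fun j => (cheb K j).[z]).
  by rewrite horner_sum; apply: eq_bigr => j _; rewrite hornerZ mulrC.
have pal j : p.[al j] = if i == j then \det (cheb_mat al) else 0.
  by rewrite pE -rdet_row; apply: eq_rdet => k; rewrite mxE.
have -> : rdet (cheb_mat al) i (fun j => (cheb K j)^`().[al i]) = p^`().[al i].
  rewrite raddf_sum horner_sum /=; apply: eq_bigr => j _.
  by rewrite derivZ hornerZ mulrC.
rewrite (horner_deriv_roots ali) ?pal ?eqxx // => [|j ji].
  apply: (leq_trans (size_sum _ _ _)); apply/bigmax_leqP => j _.
  by apply: (leq_trans (size_scale_leq _ _)); rewrite size_cheb.
by rewrite pal eq_sym (negPf ji).
Qed.

(** The left-hand side is the sum over [i] of [lop] in alpha_i, applied to the determinant. Once the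
    term in [cayley_sum] averages to zero, the average is an eigenvector with the total weight of
    the degrees m, ..., m + n - 1. *)
Lemma casimir_det x al : injective al -> (forall i l, al i - x l != 0) ->
  \sum_i rdet (xmat x al) i (fun j => (lop (xcheb x j)).[al i]) =
  (\sum_(j < n) cheb_wt (m + j) - cayley_sum al x / 8) * \det (xmat x al).
Proof.
move=> ali alx; set D := xpoly x.
have Dal i : D.[al i] != 0.
  rewrite horner_prod; apply/prodf_neq0 => l _; rewrite !hornerE.
  exact: alx.
have dD i : D^`().[al i] = D.[al i] * \sum_l (al i - x l)^-1 /\
  D^`()^`().[al i] = D.[al i] * ((\sum_l (al i - x l)^-1) ^+ 2 - \sum_l (al i - x l)^-2).
  by apply: (@horner_deriv_prod _ _ xpredT) => l _; exact: alx.
set s := fun i => \sum_l (al i - x l)^-1; set t := fun i => \sum_l (al i - x l)^-2.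
set v := fun i => \sum_(j | j != i) (al i - al j)^-1.
have rowE i (j : 'I_n) : (lop (xcheb x j)).[al i] = D.[al i] * (cheb_wt j * (cheb_mat al) i j
   + 2 * (al i ^+ 2 - 4) * s i * (cheb K j)^`().[al i]
   + ((al i ^+ 2 - 4) * (s i ^+ 2 - t i) + 3 * al i * s i) * (cheb_mat al) i j).
  have [d1 d2] := dD i.
  rewrite /xcheb -/D lopM lop_cheb /lop !hornerE d1 d2 -/(s i) -/(t i) !mxE /cheb_wt.
  by move=> /=; ring.
transitivity (\prod_i D.[al i] * (\sum_i rdet (cheb_mat al) i (fun j => cheb_wt j * (cheb_mat al) i j)
  + \sum_i (2 * (al i ^+ 2 - 4) * s i * v i
   + ((al i ^+ 2 - 4) * (s i ^+ 2 - t i) + 3 * al i * s i)) * \det (cheb_mat al))).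
  rewrite -big_split mulr_sumr; apply: eq_bigr => i _ /=.
  rewrite (eq_rdet _ _ (rowE i)) xmatE.
  have -> : D.[al i] = (\row_i D.[al i]) 0 i by rewrite mxE.
  rewrite rdet_diag; congr (_ * _); first by apply: eq_bigr => k _; rewrite mxE.
  rewrite !rdetD !rdetZ rdet_row eqxx rdet_deriv_cheb // -/(v i); ring.
(* The constant n m (n + m + 1) of [cayley_sum_derivE] is the difference of the two total
   weights. *)
have key : \sum_(j < n) cheb_wt j + \sum_i (2 * (al i ^+ 2 - 4) * s i * v i
   + ((al i ^+ 2 - 4) * (s i ^+ 2 - t i) + 3 * al i * s i)) =
   \sum_(j < n) cheb_wt (m + j) - cayley_sum al x / 8.
  rewrite cayley_sum_derivE //.
  have -> : \sum_(j < n) cheb_wt (m + j) = \sum_(j < n) cheb_wt j + n%:R * m%:R * (n%:R + m%:R + 1).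
    elim: (n) => [|k IH]; first by rewrite !big_ord0 !mul0r addr0.
    rewrite !big_ord_recr /= IH /cheb_wt !natrM -!natr1 !natrD.
    by rewrite -[LHS]addrA -[RHS]addrA; congr (_ + _); ring.
  rewrite [X in _ + X = _](eq_bigr (fun i => (al i ^+ 2 - 4) * (s i ^+ 2 - t i) + 3 * al i * s i
                 + 2 * (al i ^+ 2 - 4) * s i * v i)); last first.
    by move=> i _; rewrite addrC.
  by rewrite /s /t /v; field.
rewrite sum_rdet_scale -mulr_suml -mulrDl key det_xmat -det_cheb_mat /D; ring.
Qed.

End CasimirDet.

(** * Coefficients in products of Chebyshev polynomials *)

Section Expansion.
Variable K : numFieldType.

Lemma cheb_expand N (p : {poly K}) : (size p <= N)%N ->
  exists c : 'I_N -> K, [/\ p = \sum_q c q *: cheb K q,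
    forall q : 'I_N, (size p <= q)%N -> c q = 0 &
    forall q : 'I_N, size p = q.+1 -> c q = lead_coef p].
Proof.
have [k] := ubnP (size p); elim: k p => // k IH p; rewrite ltnS => pk pN.
have [->|p0] := eqVneq p 0.
  exists (fun=> 0); split => [||q]; rewrite ?size_poly0 //.
  by rewrite big1 // => q _; rewrite scale0r.
have sp : (0 < size p)%N by rewrite size_poly_gt0.
pose d := (size p).-1; have dN : (d < N)%N by rewrite /d prednK.
pose r := p - lead_coef p *: cheb K d.
have sr : (size r < size p)%N.
  rewrite -[X in (_ < X)%N](prednK sp) ltnS; apply/leq_sizeP => j.
  rewrite leq_eqVlt => /orP[/eqP <-|jd].
    have := monicP (cheb_monic K d); rewrite lead_coefE size_cheb /= /r coefB coefZ => ->.
    by rewrite mulr1 lead_coefE subrr.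
  rewrite /r coefB coefZ !nth_default ?mulr0 ?subr0 ?size_cheb //.
  by move: jd; rewrite prednK.
have [||c [rE c0 _]] := IH r.
- exact: leq_trans sr pk.
- exact: leq_trans (ltnW sr) pN.
exists (fun q => c q + (q == Ordinal dN)%:R * lead_coef p); split.
- rewrite -[LHS](subrK (lead_coef p *: cheb K d)) -/r {1}rE.
  under [RHS]eq_bigr do rewrite scalerDl; rewrite big_split /=; congr (_ + _).
  rewrite (bigD1 (Ordinal dN)) //= eqxx mul1r big1 ?addr0 // => q /negPf ->.
  by rewrite mul0r scale0r.
- move=> q pq; rewrite c0; last exact: leq_trans (ltnW sr) pq.
  have -> : (q == Ordinal dN) = false; last by rewrite mul0r addr0.
  by apply/eqP => /(congr1 val) /= E; move: pq; rewrite E /d leqNgt prednK // leqnn.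
- move=> q pq; rewrite c0; last by rewrite -ltnS -pq.
  have -> : q == Ordinal dN by apply/eqP/val_inj; rewrite /= /d pq.
  by rewrite mul1r add0r.
Qed.

Lemma det_rows_expand n N (b : 'I_n -> 'I_N -> K) (k : 'I_N -> 'I_n -> K) :
  \det (\matrix_(i, j) \sum_q b i q * k q j) =
  \sum_(d : {ffun 'I_n -> 'I_N}) (\prod_i b i (d i)) * \det (\matrix_(i, j) k (d i) j).
Proof.
transitivity (\sum_(s : 'S_n) \sum_(d : {ffun 'I_n -> 'I_N})
    (-1) ^+ s * \prod_i (b i (d i) * k (d i) (s i))).
  apply: eq_bigr => s _; rewrite -mulr_sumr -(bigA_distr_bigA (fun i q => b i q * k q (s i))); congr (_ * _).
  by apply: eq_bigr => i _; rewrite mxE.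
rewrite exchange_big; apply: eq_bigr => d _; rewrite mulr_sumr; apply: eq_bigr => s _.
rewrite big_split /= mulrCA; congr (_ * (_ * _)).
by apply: eq_bigr => i _; rewrite mxE.
Qed.

Lemma cheb_dual N (t : 'I_N -> K) : injective t ->
  exists W : 'I_N -> 'I_N -> K, forall q q' : 'I_N,
    \sum_r W q r * (cheb K q').[t r] = (q' == q)%:R.
Proof.
move=> ti; pose A := \matrix_(i, j < N) (cheb K j).[t i].
have Au : A \in unitmx.
  rewrite unitmxE unitfE det_monic_basis ?vdm_neq0 // => j.
  by rewrite cheb_monic size_cheb.
exists (fun q r => invmx A q r) => q q'.
have := congr1 (fun B : 'M[K]_N => B q q') (mulVmx Au); rewrite !mxE eq_sym => <-.
by apply: eq_bigr => r _; rewrite mxE.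
Qed.

(** A coefficient is recovered from the values on a grid with its own nodes for each variable. The
    formula is finite and linear, so it serves before and after averaging. *)
Lemma multi_extract n N (W : 'I_n -> 'I_N -> 'I_N -> K) (u : 'I_n -> 'I_N -> K)
    (d : {ffun 'I_n -> 'I_N}) (k : {ffun 'I_n -> 'I_N} -> K) :
  (forall i (q q' : 'I_N), \sum_r W i q r * (cheb K q').[u i r] = (q' == q)%:R) ->
  \sum_(r : {ffun 'I_n -> 'I_N}) (\prod_i W i (d i) (r i)) *
    (\sum_(d' : {ffun 'I_n -> 'I_N}) (\prod_i (cheb K (d' i)).[u i (r i)]) * k d') = k d.
Proof.
move=> dual; under eq_bigr do rewrite mulr_sumr.
rewrite exchange_big (bigD1 d) //= [X in _ + X]big1 ?addr0.
  under eq_bigr do rewrite mulrA -big_split /=.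
  rewrite -mulr_suml -(bigA_distr_bigA (fun i r => W i (d i) r * (cheb K (d i)).[u i r])).
  by rewrite big1 ?mul1r // => i _; rewrite dual eqxx.
move=> d' dd; under eq_bigr do rewrite mulrA -big_split /=.
rewrite -mulr_suml -(bigA_distr_bigA (fun i r => W i (d i) r * (cheb K (d' i)).[u i r])).
have [i di] : exists i, d' i != d i.
  apply/existsP; rewrite -negb_forall; apply: contraNN dd => /forallP dE.
  by apply/eqP/ffunP => i; apply/eqP; rewrite (eqP (dE i)).
rewrite (bigD1 i) //= dual; case: eqP => [E|_]; last by rewrite !mul0r.
by rewrite E eqxx in di.
Qed.

End Expansion.

(* The weight q (q + 2) is strictly increasing, so among n-subsets of
   {0, ..., m + n - 1} the total weight is maximal only for the top one. *)
Lemma cheb_wt_max (K : numFieldType) n m (d : {ffun 'I_n -> 'I_(m + n)}) :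
  injective d -> \sum_i cheb_wt K (d i) = \sum_(j < n) cheb_wt K (m + j) ->
  forall i, (m <= d i)%N.
Proof.
move=> di; rewrite /cheb_wt -!natr_sum => /eqP; rewrite eqr_nat => /eqP E i0.
rewrite leqNgt; apply/negP => i0m.
pose A := [set d i | i in [set: 'I_n]]%SET; pose B := [set j : 'I_(m + n) | (m <= j)%N]%SET.
pose w (q : nat) := (q * q.+2)%N.
have sA : (\sum_(q in A) w q = \sum_i w (d i))%N.
  rewrite big_imset /=; last by move=> ? ? _ _; exact: di.
  by apply: eq_bigl => i; rewrite inE.
have sB : (\sum_(q in B) w q = \sum_(j < n) w (m + j))%N.
  rewrite big_split_ord /= [X in (X + _)%N]big1 ?add0n => [|i].
    by apply: eq_bigl => j; rewrite inE /= leq_addr.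
  by rewrite inE /= leqNgt ltn_ord.
have cA : #|A| = n by rewrite card_imset // cardsT card_ord.
have cB : #|B| = n.
  rewrite -sum1_card big_split_ord /= [X in (X + _)%N]big1 ?add0n => [|i].
    rewrite -[RHS]card_ord -sum1_card; apply: eq_bigl => j.
    by rewrite inE /= leq_addr.
  by rewrite inE /= leqNgt ltn_ord.
have wmono p q : (p < q)%N -> (w p < w q)%N by rewrite /w; nia.
have wle p q : (p <= q)%N -> (w p <= w q)%N.
  by rewrite leq_eqVlt => /orP[/eqP -> //|/wmono/ltnW].
have DAB : #|A :\: B|%SET = #|B :\: A|%SET.
  by apply/eqP; rewrite -(eqn_add2l #|(A :&: B)%SET|) cardsID finset.setIC cardsID cA cB.
have i0D : d i0 \in (A :\: B)%SET by rewrite !inE -ltnNge i0m /= imset_f.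
have : (\sum_(q in A) w q < \sum_(q in B) w q)%N.
  rewrite (big_setID B) /= [X in (_ < X)%N](big_setID A) /= finset.setIC ltn_add2l.
  apply: (@leq_ltn_trans (#|(A :\: B)%SET| * w m.-1)%N).
    rewrite -sum_nat_const; apply: leq_sum => q; rewrite !inE -ltnNge => /andP[qm _].
    have : (q <= m.-1)%N by rewrite -ltnS prednK // (leq_ltn_trans _ qm).
    exact: wle.
  apply: (@leq_trans (#|(B :\: A)%SET| * w m)%N).
    rewrite -DAB ltn_mul2l (cardD1 (d i0)) i0D /= wmono // prednK //.
    exact: leq_ltn_trans i0m.
  rewrite -sum_nat_const; apply: leq_sum => q; rewrite !inE => /andP[_ mq].
  exact: wle.
by rewrite sA sB /w E ltnn.
Qed.

(** * Averages determined by the Casimir identity *)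

Section AbstractAverage.
Variables (K : numFieldType) (n m : nat) (T : Type) (x : T -> 'I_m -> K).
Variables (test : (T -> K) -> Prop) (E : (T -> K) -> K).
Hypothesis test_cst : forall c, test (fun=> c).
Hypothesis testM : forall f g, test f -> test g -> test (fun u => f u * g u).
Hypothesis test_sum : forall (I : finType) (F : I -> T -> K),
  (forall i, test (F i)) -> test (fun u => \sum_i F i u).
Hypothesis E_cst : forall c, E (fun=> c) = c.
Hypothesis EZ : forall c f, test f -> E (fun u => c * f u) = c * E f.
Hypothesis E_sum : forall (I : finType) (F : I -> T -> K),
  (forall i, test (F i)) -> E (fun u => \sum_i F i u) = \sum_i E (F i).

Variable node : nat -> K.
Hypothesis node_inj : injective node.
Hypothesis node_x : forall k u l, node k - x u l != 0.
Let F (al : 'I_n -> K) u := \prod_i (xpoly (x u)).[al i].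
Hypothesis test_F : forall al, test (F al).
Hypothesis cas : forall k : 'I_n -> nat, injective k ->
  let al i := node (k i) in
  test (fun u => F al u * cayley_sum al (x u)) /\
  E (fun u => F al u * cayley_sum al (x u)) = 0.

Local Notation N := (m + n)%N.

(** The coefficient of a tuple [d] of Chebyshev indices vanishes if [d] has a repetition, and has
    average 0 if the weight of [d] is not the top one. What remains are the permutations of m, ...,
    m + n - 1, whose coefficients are constant signs. *)
Lemma average_xmat (al : 'I_n -> K) :
  E (fun u => \det (xmat (x u) al)) = \det (\matrix_(i, j < n) (cheb K (m + j)).[al i]).
Proof.
have size_D u : size (xpoly (x u)) = m.+1.
  by rewrite /xpoly size_prod_XsubC /index_enum -enumT size_enum_ord.
have monic_D u : xpoly (x u) \is monic by apply: monic_prod => l _; exact: monicXsubC.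
have size_P u (j : nat) : size (xcheb (x u) j) = (m + j).+1.
  by rewrite size_monicM ?cheb_monic ?monic_neq0 // size_cheb size_D addSn addnS /= addnC.
have monic_P u j : xcheb (x u) j \is monic by rewrite monicMl ?cheb_monic.
have [c cP] : exists c : T * 'I_n -> 'I_N -> K, forall p : T * 'I_n,
    [/\ xcheb (x p.1) p.2 = \sum_q c p q *: cheb K q,
    forall q : 'I_N, (size (xcheb (x p.1) p.2) <= q)%N -> c p q = 0 &
    forall q : 'I_N, size (xcheb (x p.1) p.2) = q.+1 -> c p q = lead_coef (xcheb (x p.1) p.2)].
  have sP (p : T * 'I_n) : (size (xcheb (x p.1) p.2) <= N)%N.
    by rewrite size_P -addnS leq_add2l.
  by have [c cP] := choice (fun p => cheb_expand (sP p)); exists c.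
pose kap (d : {ffun 'I_n -> 'I_N}) u := \det (\matrix_(i, j) c (u, j) (d i)).
have expand u al' : \det (xmat (x u) al') =
    \sum_(d : {ffun 'I_n -> 'I_N}) (\prod_i (cheb K (d i)).[al' i]) * kap d u.
  rewrite /kap -(det_rows_expand (fun i q => (cheb K q).[al' i]) (fun q j => c (u, j) q)).
  congr (\det _); apply/matrixP => i j; rewrite !mxE.
  have [-> _ _] := cP (u, j); rewrite horner_sum; apply: eq_bigr => q _.
  by rewrite hornerZ mulrC.
have expand_lop u al' : \sum_i rdet (xmat (x u) al') i (fun j => (lop (xcheb (x u) j)).[al' i]) =
    \sum_(d : {ffun 'I_n -> 'I_N}) (\prod_i (cheb K (d i)).[al' i]) *
      ((\sum_i cheb_wt K (d i)) * kap d u).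
  transitivity (\sum_i \sum_(d : {ffun 'I_n -> 'I_N})
      (cheb_wt K (d i) * \prod_i' (cheb K (d i')).[al' i']) * kap d u).
    apply: eq_bigr => i _; rewrite rdetE.
    pose b i' (q : 'I_N) := (if i' == i then cheb_wt K q else 1) * (cheb K q).[al' i'].
    transitivity (\det (\matrix_(i', j) \sum_q b i' q * c (u, j) q)).
      congr (\det _); apply/matrixP => i' j; rewrite !mxE /b.
      have [PE _ _] := cP (u, j); rewrite PE; case: eqP => [->|_].
        rewrite lop_sum horner_sum; apply: eq_bigr => q _.
        by rewrite lopZ lop_cheb !hornerZ mulrC.
      by rewrite horner_sum; apply: eq_bigr => q _; rewrite hornerZ mul1r mulrC.
    rewrite det_rows_expand; apply: eq_bigr => d _; congr (_ * _).
    by rewrite /b big_split /= -big_mkcond big_pred1_eq.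
  rewrite exchange_big; apply: eq_bigr => d _ /=.
  by rewrite mulr_suml mulr_sumr; apply: eq_bigr => i _; rewrite mulrCA mulrA.
(* Row [i] owns a block of [N] nodes, so any choice of one node per row has distinct alpha_i, as
   [cas] requires. *)
pose nd (i : 'I_n) (r : 'I_N) := node (i * N + r).
have nd_inj i : injective (nd i).
  by move=> r r' /node_inj /eqP; rewrite eqn_add2l => /eqP/val_inj.
have [W dual] : exists W : 'I_n -> 'I_N -> 'I_N -> K, forall i (q q' : 'I_N),
    \sum_r W i q r * (cheb K q').[nd i r] = (q' == q)%:R.
  have /choice[W WP] := fun i => cheb_dual (nd_inj i).
  by exists W => i q q'; exact: WP.
have kapE d u : kap d u = \sum_(r : {ffun 'I_n -> 'I_N}) (\prod_i W i (d i) (r i)) *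
    \det (xmat (x u) (fun i => nd i (r i))).
  rewrite -(multi_extract d (kap^~ u) dual); apply: eq_bigr => r _.
  by rewrite expand.
have testZ a f : test f -> test (fun u => a * f u).
  exact: (testM (test_cst a)).
have test_det (al' : 'I_n -> K) : test (fun u => \det (xmat (x u) al')).
  have -> : (fun u => \det (xmat (x u) al')) = fun u => vdm al' * F al' u.
    by apply/funext => u; rewrite det_xmat.
  exact: testZ.
have test_kap d : test (kap d).
  have -> : kap d = fun u => \sum_(r : {ffun 'I_n -> 'I_N}) (\prod_i W i (d i) (r i)) *
      \det (xmat (x u) (fun i => nd i (r i))) by apply/funext => u; exact: kapE.
  by apply: test_sum => r; apply: testZ; exact: test_det.
(* The eigenvalue equation is known on the grid only; [multi_extract] makes it an equation for each
   averaged coefficient. *)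
have wt_kap (d : {ffun 'I_n -> 'I_N}) :
    (\sum_i cheb_wt K (d i) - \sum_(j < n) cheb_wt K (m + j)) * E (kap d) = 0.
  rewrite -(multi_extract d (fun d : {ffun 'I_n -> 'I_N} => (\sum_i cheb_wt K (d i) -
    \sum_(j < n) cheb_wt K (m + j)) * E (kap d)) dual).
  rewrite big1 // => r _; apply/eqP; rewrite mulf_eq0; apply/orP; right; apply/eqP.
  pose k (i : 'I_n) := (i * N + r i)%N.
  have ki : injective k.
    move=> i i' /(congr1 (fun q => q %/ N)%N).
    have N0 : (0 < N)%N := leq_ltn_trans (leq0n _) (ltn_ord (r i)).
    by rewrite !divnMDl // !divn_small // !addn0 => /val_inj.
  have [tc Ec] := cas ki.
  have ali : injective (fun i => node (k i)) by move=> i i' /node_inj/ki.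
  transitivity (E (fun u => - (vdm (fun i => node (k i)) / 8) *
      (F (fun i => node (k i)) u * cayley_sum (fun i => node (k i)) (x u)))); last first.
    by rewrite EZ // Ec mulr0.
  transitivity (\sum_(d' : {ffun 'I_n -> 'I_N}) E (fun u => (\prod_i (cheb K (d' i)).[nd i (r i)]) *
      ((\sum_i cheb_wt K (d' i) - \sum_(j < n) cheb_wt K (m + j)) * kap d' u))).
    by apply: eq_bigr => d' _; rewrite (EZ _ (testZ _ _ (test_kap d'))) (EZ _ (test_kap d')).
  rewrite -E_sum; last by move=> d'; exact: (testZ _ _ (testZ _ _ (test_kap d'))).
  congr (E _); apply/funext => u.
  have := casimir_det (x := x u) ali (fun i l => node_x (k i) u l).
  rewrite expand_lop det_xmat => cd.
  transitivity (\sum_(d' : {ffun 'I_n -> 'I_N}) (\prod_i (cheb K (d' i)).[node (k i)]) *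
      ((\sum_i cheb_wt K (d' i)) * kap d' u) - (\sum_(j < n) cheb_wt K (m + j)) *
      \sum_(d' : {ffun 'I_n -> 'I_N}) (\prod_i (cheb K (d' i)).[node (k i)]) * kap d' u).
    rewrite mulr_sumr -sumrB; apply: eq_bigr => d' _.
    by rewrite mulrBl mulrBr; congr (_ - _); rewrite mulrCA.
  by rewrite cd -expand det_xmat /F; field.
(* For tuples of top weight the coefficient matrix is triangular up to a row permutation, with the
   leading coefficients 1 on its diagonal. *)
pose h (s : 'S_n) := [ffun i => rshift m (s i)] : {ffun 'I_n -> 'I_N}.
have h_inj : injective h.
  move=> s1 s2 /ffunP E12; apply/permP => i; have := E12 i.
  by rewrite !ffunE => /rshift_inj.
have kap_h s : E (kap (h s)) = (-1) ^+ s.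
  rewrite (_ : kap (h s) = fun=> (-1) ^+ s) ?E_cst //; apply/funext => u.
  pose M := \matrix_(i, j < n) c (u, j) (rshift m i).
  have -> : kap (h s) u = \det (row_perm s M).
    by congr (\det _); apply/matrixP => i j; rewrite !mxE ffunE.
  rewrite row_permE det_mulmx det_perm -det_tr det_trig.
    rewrite big1 ?mulr1 // => i _; rewrite !mxE; have [_ _ ->] := cP (u, i) => //.
      exact/monicP.
  apply/is_trig_mxP => i j ij; rewrite !mxE; have [_ -> //] := cP (u, i).
  by rewrite /= size_P ltn_add2l.
have other (d : {ffun 'I_n -> 'I_N}) : d \notin [set h s | s in [set: 'S_n]]%SET -> E (kap d) = 0.
  move=> dh; have [/injectiveP di|/injectivePn[i [i' ii' dd]]] := boolP (injectiveb d); last first.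
    rewrite (_ : kap d = fun=> 0) ?E_cst //; apply/funext => u.
    by apply: (determinant_alternate ii') => j; rewrite !mxE dd.
  have /eqP := wt_kap d; rewrite mulf_eq0 subr_eq0 => /orP[/eqP wE|/eqP //].
  have md := cheb_wt_max di wE.
  have lt_d i : (d i - m < n)%N by rewrite ltn_subLR.
  pose s' i := Ordinal (lt_d i).
  have s'i : injective s'.
    move=> i i' /(congr1 val) /= E12; apply: di; apply/val_inj => /=.
    by rewrite -(subnK (md i)) -(subnK (md i')) E12.
  case/imsetP: dh; exists (perm s'i); first by rewrite inE.
  by apply/ffunP => i; rewrite ffunE permE; apply/val_inj; rewrite /= subnKC.
rewrite (_ : (fun u => _) = fun u => \sum_(d : {ffun 'I_n -> 'I_N})
   (\prod_i (cheb K (d i)).[al i]) * kap d u); last by apply/funext => u; exact: expand.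
rewrite E_sum; last by move=> d; exact: (testZ _ _ (test_kap d)).
rewrite (bigID (mem [set h s | s in [set: 'S_n]]%SET)) /= [X in _ + X]big1 ?addr0; last first.
  by move=> d dh; rewrite EZ // other // mulr0.
rewrite big_imset /=; last by move=> s1 s2 _ _; exact: h_inj.
apply: eq_big => [s|s _]; first by rewrite inE.
rewrite EZ // kap_h mulrC; congr (_ * _); apply: eq_bigr => i _.
by rewrite mxE ffunE.
Qed.

End AbstractAverage.

Definition xval (K : fieldType) m (zeta : 'I_m -> K) l : K := zeta l + (zeta l)^-1.

Lemma joukowski_surj (K : numClosedFieldType) (al : K) : exists2 a, a != 0 & al = a + a^-1.
Proof.
pose a := (al + sqrtC (al ^+ 2 - 4)) / 2; pose b := (al - sqrtC (al ^+ 2 - 4)) / 2.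
have ab : a * b = 1.
  have -> : a * b = (al ^+ 2 - sqrtC (al ^+ 2 - 4) ^+ 2) / 4 by rewrite /a /b; field.
  by rewrite sqrtCK; field.
have a0 : a != 0 by apply/eqP => a0; move/eqP: ab; rewrite a0 mul0r eq_sym oner_eq0.
exists a => //; have -> : a^-1 = b by rewrite -[RHS](mulKf a0) ab mulr1.
by rewrite /a /b; field.
Qed.

(** * Products of characteristic polynomials under the Haar measure *)

Section HaarNumerators.
Variables (R : realType) (m : nat).
Local Notation G := (USp R m).
Local Notation mx := 'M[C R]_(m + m).

Definition angle_spec (U : mx) (zeta : 'I_m -> C R) :=
  [/\ forall b, \det (1%:M - b *: U) = \prod_l ((1 - b * zeta l) * (1 - b * (zeta l)^-1)),
   perm_eq (eigenvalues U) ([seq zeta l | l : 'I_m] ++ [seq (zeta l)^-1 | l : 'I_m]) &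
   forall n (a : 'I_n -> C R), (forall i, 0 < `|a i| < 1) ->
     casimir a U = cayley_sum (fun i => a i + (a i)^-1) (xval zeta)].

(** Outside [G] the angles are set to 1, so that the condition on the modulus holds for every
    matrix. *)
Lemma USp_angles : exists ang : mx -> 'I_m -> C R,
  (forall U l, `|ang U l| = 1) /\ (forall U, G U -> angle_spec U (ang U)).
Proof.
have H U : exists zeta : 'I_m -> C R, (forall l, `|zeta l| = 1) /\ (G U -> angle_spec U zeta).
  have [GU|nGU] := pselect (G U); last by exists (fun=> 1); split => // l; rewrite normr1.
  have [zeta [P Pu [zeta1 [d UE pd]]]] := USp_spectrum GU.
  exists zeta; split => // _.
  have [uU sU] := GU; have Uu := unitarymx_unit uU.
  have aU : sadj (sympJ R m) U = invmx U.
    rewrite /sadj -mulmxA -[_^T *m _](mulmxK Uu) sU mulmxA sympJ_sqr mulNmx mul1mx.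
    by rewrite opprK.
  split.
  - exact: (det_spectrum Pu UE pd).
  - rewrite -(permPr pd); apply: prod_XsubC_eq; rewrite -char_poly_diag.
    rewrite /eigenvalues; case: (closed_field_poly_normal _) => r /= rE.
    move: rE; rewrite (monicP (char_poly_monic U)) scale1r => <-.
    by rewrite [in LHS]UE char_poly_conj.
  - move=> n a a01.
    exact: (casimir_spectrum (sympJ_sqr R m) aU Pu UE zeta1 pd a01).
have [ang angP] := choice H.
by exists ang; split => [U l|U GU]; have [] := angP U => // ? /(_ GU).
Qed.

Variable mu : probability (borel_mx R m) R.
Hypothesis haar : is_haar_USp mu.
Variable ang : mx -> 'I_m -> C R.
Hypothesis ang1 : forall U l, `|ang U l| = 1.
Hypothesis angP : forall U, G U -> angle_spec U (ang U).
Local Notation x U := (xval (ang U)).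
Local Notation E := (haarE mu).

Let ang0 U l : ang U l != 0. Proof. by rewrite -normr_gt0 ang1. Qed.

Lemma det_xpoly U a : G U -> a != 0 ->
  \det (1%:M - a *: U) = a ^+ m * (xpoly (x U)).[a + a^-1].
Proof.
move=> GU a0; have [-> _ _] := angP GU.
rewrite horner_prod -[m in a ^+ m]card_ord -prodr_const -big_split.
apply: eq_bigr => l _ /=; rewrite !hornerE /xval.
by have := ang0 U l => h; field; rewrite a0 h.
Qed.

(** Every [al] has the form a + 1/a, so the value is a determinant up to a power of [a], whatever
    angles were chosen. *)
Lemma test_xpoly al : test (fun U : borel_mx R m => (xpoly (x U)).[al]).
Proof.
have [a a0 ->] := joukowski_surj al.
apply: (@test_eq _ _ (fun U => a ^- m * \det (1%:M - a *: (U : mx)))).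
  by move=> U GU; rewrite det_xpoly // mulKf // expf_neq0.
apply: testM; first exact: test_cst.
apply: (@test_eq _ _ (numer (fun _ : 'I_1 => a))); last exact: test_numer.
by move=> U _; rewrite /numer big_ord1.
Qed.

Lemma haarE_xmat n (al : 'I_n -> C R) :
  E (fun U => \det (xmat (x U) al)) = \det (\matrix_(i, j < n) (cheb (C R) (m + j)).[al i]).
Proof.
(* For a in (0, 1) the matrix 1 - a U is invertible on [G], and a + 1/a avoids the [x l], which lie
   in [-2, 2]. Starting at 1/2 keeps [a] off the unit circle. *)
pose na (k : nat) : C R := k.+2%:R^-1.
have na0 k : na k != 0 by rewrite invr_eq0 pnatr_eq0.
have na01 k : 0 < `|na k| < 1.
  rewrite normr_gt0 na0 normfV normr_nat invf_lt1 ?ltr1n //.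
pose node k := na k + (na k)^-1.
have nz k z : `|z| = 1 -> 1 - na k * z != 0.
  move=> z1; rewrite subr_eq0; apply/eqP => /(congr1 Num.norm).
  rewrite normrM z1 normr1 mulr1 => /esym e.
  by have /andP[_] := na01 k; rewrite e ltxx.
apply: (@average_xmat (C R) n m (borel_mx R m) (fun U => x U) (@test R m) E _ _ _ _ _ _ node).
- exact: test_cst.
- exact: testM.
- by move=> I F tF; exact: test_sum.
- exact: haarE_cst.
- by move=> c f tf; rewrite (haarEZ haar).
- by move=> I F tF; rewrite (haarE_sum haar).
- move=> k k'; rewrite /node /na !invrK => e.
  have p0 (j : nat) : j.+2%:R != 0 :> C R by rewrite pnatr_eq0.
  have : (k.+2%:R - k'.+2%:R) * (k.+2%:R * k'.+2%:R - 1) = 0 :> C R.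
    transitivity ((k.+2%:R * k'.+2%:R) * ((k.+2%:R^-1 + k.+2%:R) - (k'.+2%:R^-1 + k'.+2%:R)) : C R).
      move: (p0 k) (p0 k'); move: (k.+2%:R : C R) (k'.+2%:R : C R) => u v u0 v0.
      by field; rewrite u0 v0.
    by rewrite e subrr mulr0.
  move/eqP; rewrite mulf_eq0 !subr_eq0 -natrM => /orP[|]; last first.
    by rewrite -[1]/(1%:R) eqr_nat.
  by rewrite eqr_nat => /eqP[].
- move=> k U l; have : na k * (node k - x U l) != 0.
    have -> : na k * (node k - x U l) = (1 - na k * ang U l) * (1 - na k * (ang U l)^-1).
      by rewrite /node /xval; have := ang0 U l => h; field; rewrite h na0.
    by rewrite mulf_neq0 // nz // ?normfV ang1 ?invr1.
  by rewrite mulf_eq0 negb_or => /andP[].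
- move=> al'; apply: test_prod => i; exact: test_xpoly.
- move=> k ki.
  have a_reg (U : mx) i : G U -> 1%:M - na (k i) *: U \in unitmx.
    move=> GU; have [dE _ _] := angP GU; rewrite unitmxE unitfE dE.
    by apply/prodf_neq0 => l _; rewrite mulf_neq0 // nz // ?normfV ang1 ?invr1.
  have [tc Ec] := haarE_casimir haar a_reg.
  pose c := \prod_i na (k i) ^+ m.
  have c0 : c != 0 by apply/prodf_neq0 => i _; rewrite expf_neq0.
  have fE U : G U -> c^-1 * (numer (fun i => na (k i)) U * casimir (fun i => na (k i)) U) =
     (\prod_i (xpoly (x U)).[node (k i)]) * cayley_sum (fun i => node (k i)) (x U).
    move=> GU; have [_ _ ->] := angP GU; last by [].
    rewrite mulrA; congr (_ * _); rewrite /numer.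
    rewrite (eq_bigr (fun i => na (k i) ^+ m * (xpoly (x U)).[node (k i)])).
      by rewrite big_split /= mulKf.
    by move=> i _; rewrite det_xpoly.
  split.
    by apply: (test_eq fE); apply: testM => //; exact: test_cst.
  by rewrite -(haarE_eq mu fE) (haarEZ haar) // Ec mulr0.
Qed.

End HaarNumerators.

(** * Quadrature at roots of unity *)

Section RootsOfUnity.
Variables (K : numClosedFieldType) (L : nat) (w : K).
Hypothesis prim : L.-primitive_root w.

Let L0 : (0 < L)%N. Proof. exact: prim_order_gt0 prim. Qed.
Let w0 : w != 0.
Proof.
apply/eqP => w0; have /eqP := prim_expr_order prim.
by rewrite w0 expr0n gtn_eqF // eq_sym oner_eq0.
Qed.
Local Notation z r := (w ^+ r).

Lemma rootz_neq0 r : z r != 0. Proof. by rewrite expf_neq0. Qed.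

Lemma rootz_norm r : `|z r| = 1.
Proof.
apply/eqP; rewrite -(@pexpr_eq1 _ _ L) ?normr_ge0 // -normrX -exprM mulnC exprM.
by rewrite (prim_expr_order prim) expr1n normr1.
Qed.

Lemma sum_root_powers a b :
  \sum_(r < L) z r ^+ a / z r ^+ b = if a == b %[mod L] then L%:R else 0.
Proof.
transitivity (\sum_(r < L) (w ^+ a / w ^+ b) ^+ r).
  by apply: eq_bigr => r _; rewrite expr_div_n -!exprM mulnC [(b * _)%N]mulnC.
rewrite -(eq_prim_root_expr prim); case: eqP => [->|/eqP ab].
  rewrite divff ?expf_neq0 // (eq_bigr (fun=> 1)) ?sumr_const ?card_ord // => r _.
  by rewrite expr1n.
set t := w ^+ a / w ^+ b.
have t1 : t != 1.
  apply: contraNneq ab => t1; rewrite -[w ^+ a](divfK (expf_neq0 b w0)).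
  by rewrite -/t t1 mul1r.
have tL : t ^+ L = 1.
  by rewrite expr_div_n -!exprM ![(_ * L)%N]mulnC !exprM (prim_expr_order prim) !expr1n divr1.
apply: (mulfI (x := t - 1)); first by rewrite subr_eq0.
by rewrite -subrX1 tL subrr mulr0.
Qed.

Definition qnode (r : 'I_L) : K := z r + (z r)^-1.
(** A discrete semicircle weight: minus the square of z - 1/z is 4 sin^2 of the angle, and 1 / (2 L)
    makes the total mass 1 once 2 < L. *)
Definition qwt (r : 'I_L) : K := - (z r - (z r)^-1) ^+ 2 / (2 * L%:R).

Let LK : L%:R != 0 :> K. Proof. by rewrite pnatr_eq0 -lt0n. Qed.

Let sum2 a b : \sum_(r < L) (z r ^+ a - (z r)^-1 ^+ a) * (z r ^+ b - (z r)^-1 ^+ b) =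
  2 * L%:R * ((a + b == 0 %[mod L])%:R - (a == b %[mod L])%:R).
Proof.
transitivity (\sum_(r < L) z r ^+ (a + b) / z r ^+ 0 - \sum_(r < L) z r ^+ a / z r ^+ b
   - \sum_(r < L) z r ^+ b / z r ^+ a + \sum_(r < L) z r ^+ 0 / z r ^+ (a + b)).
  rewrite -!sumrB -big_split; apply: eq_bigr => r _ /=.
  by rewrite !exprVn !exprD expr0 divr1 invfM; ring.
rewrite !sum_root_powers [b == a %[mod L]]eq_sym [0 == _ %[mod L]]eq_sym.
by do 2 case: (_ == _) => /=; ring.
Qed.

(** The bound excludes aliasing: the exponent p + q + 2 is not 0 modulo [L]. *)
Lemma qwt_ortho p q : (p + q + 2 < L)%N ->
  \sum_r qwt r * ((cheb K p).[qnode r] * (cheb K q).[qnode r]) = (p == q)%:R.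
Proof.
move=> pqL.
transitivity (- (2 * L%:R)^-1 * \sum_(r < L) (z r ^+ p.+1 - (z r)^-1 ^+ p.+1) * (z r ^+ q.+1 - (z r)^-1 ^+ q.+1)).
  rewrite mulr_sumr; apply: eq_bigr => r _; rewrite /qwt /qnode.
  rewrite -!(horner_cheb _ (rootz_neq0 r)); ring.
rewrite sum2 mod0n !modn_small; try lia.
by rewrite (_ : (p.+1 + q.+1 == 0)%N = false) // sub0r eqSS; field.
Qed.

(** At roots of unity the geometric series of 1 / (1 - c z) becomes a finite sum divided by 1 - c^L,
    and orthogonality keeps the exponents p + 1 and L - (p + 1). The second is an aliasing term,
    negligible for large [L] when [c] is in the unit disc. *)
Lemma qwt_resolvent p c : (p.+1 < L)%N -> c != 0 -> c ^+ L != 1 ->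
  \sum_r qwt r * ((cheb K p).[qnode r] / (c + c^-1 - qnode r)) =
  (c ^+ p.+1 - c ^+ (L - p.+1)) / (1 - c ^+ L).
Proof.
move=> pL c0 cL.
have cL0 : 1 - c ^+ L != 0 by rewrite subr_eq0 eq_sym.
have geo (y : K) : y ^+ L = 1 -> (1 - c * y)^-1 = (1 - c ^+ L)^-1 * \sum_(e < L) c ^+ e * y ^+ e /\ 1 - c * y != 0.
  move=> yL; have E : (1 - c * y) * \sum_(e < L) c ^+ e * y ^+ e = 1 - c ^+ L.
    under eq_bigr do rewrite -exprMn.
    by rewrite -opprB mulNr -subrX1 exprMn yL mulr1 opprB.
  have n0 : 1 - c * y != 0 by apply: contraNneq cL0 => e0; rewrite -E e0 mul0r.
  by split => //; apply: (mulfI n0); rewrite divff // mulrCA E mulVf.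
have zL (r : 'I_L) : z r ^+ L = 1 by rewrite exprAC (prim_expr_order prim) expr1n.
have zVL (r : 'I_L) : (z r)^-1 ^+ L = 1 by rewrite exprVn zL invr1.
transitivity (- (2 * L%:R)^-1 * (1 - c ^+ L)^-1 * \sum_(e < L) c ^+ e *
   \sum_(r < L) (z r ^+ p.+1 - (z r)^-1 ^+ p.+1) * (z r ^+ e - (z r)^-1 ^+ e)).
  under [in RHS]eq_bigr do rewrite mulr_sumr.
  rewrite exchange_big mulr_sumr; apply: eq_bigr => r _ /=.
  have [g1 n1] := geo _ (zL r); have [g2 n2] := geo _ (zVL r).
  have -> : \sum_(e < L) c ^+ e * ((z r ^+ p.+1 - (z r)^-1 ^+ p.+1) * (z r ^+ e - (z r)^-1 ^+ e)) =
     (z r ^+ p.+1 - (z r)^-1 ^+ p.+1) * (\sum_(e < L) c ^+ e * z r ^+ e - \sum_(e < L) c ^+ e * (z r)^-1 ^+ e).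
    by rewrite -sumrB mulr_sumr; apply: eq_bigr => e _; rewrite mulrCA mulrBr.
  have s1 : \sum_(e < L) c ^+ e * z r ^+ e = (1 - c ^+ L) / (1 - c * z r) by rewrite g1 mulVKf.
  have s2 : \sum_(e < L) c ^+ e * (z r)^-1 ^+ e = (1 - c ^+ L) / (1 - c * (z r)^-1) by rewrite g2 mulVKf.
  rewrite s1 s2 -(horner_cheb _ (rootz_neq0 r)) /qwt -/(qnode r).
  have -> : (c + c^-1 - qnode r)^-1 = c / ((1 - c * z r) * (1 - c * (z r)^-1)).
    have -> : c + c^-1 - qnode r = (1 - c * z r) * (1 - c * (z r)^-1) / c.
      by rewrite /qnode; have h := rootz_neq0 r; field; rewrite c0 h.
    by rewrite invf_div.
  move: (cheb K p).[_] => u; have h := rootz_neq0 r.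
  have n2' : z r - c != 0 by move: n2; rewrite -{1}(divff h) -mulrBl mulf_eq0 negb_or => /andP[].
  by field; rewrite LK h n1 n2' cL0.
under eq_bigr do rewrite sum2.
have i1 : (p.+1 < L)%N := pL.
have i2 : (L - p.+1 < L)%N by lia.
have -> : \sum_(e < L) c ^+ e * (2 * L%:R * ((p.+1 + e == 0 %[mod L])%:R - (p.+1 == e %[mod L])%:R)) =
   2 * L%:R * (c ^+ (L - p.+1) - c ^+ p.+1).
  rewrite (eq_bigr (fun e : 'I_L => 2 * L%:R * (c ^+ e * (e == Ordinal i2)%:R) - 2 * L%:R * (c ^+ e * (e == Ordinal i1)%:R))).
    rewrite sumrB -!mulr_sumr -mulrBr; congr (_ * (_ - _)).
      rewrite (bigD1 (Ordinal i2)) //= eqxx mulr1 big1 ?addr0 // => e /negPf ->.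
      by rewrite mulr0.
    rewrite (bigD1 (Ordinal i1)) //= eqxx mulr1 big1 ?addr0 // => e /negPf ->.
    by rewrite mulr0.
  move=> e _; have -> : (p.+1 + e == 0 %[mod L]) = (e == Ordinal i2).
    rewrite mod0n -val_eqE /=; apply/eqP/eqP => [|->]; last by rewrite subnKC ?modnn // ltnW.
    move=> /eqP; rewrite -/(dvdn L _) => /dvdnP[q qE].
    have := ltn_ord e; case: q qE => [|[|q]]; nia.
  have -> : (p.+1 == e %[mod L]) = (e == Ordinal i1).
    by rewrite !modn_small // -val_eqE /= eq_sym.
  ring.
by field; rewrite LK cL0.
Qed.

End RootsOfUnity.

Lemma prim_root_exists (K : numClosedFieldType) L : (0 < L)%N -> exists w : K, L.-primitive_root w.
Proof.
move=> L0; pose p : {poly K} := 'X^L - 1; have [r Dp] := closed_field_poly_normal p.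
rewrite (monicP _) ?monicXnsubC // scale1r in Dp.
have rn1 : all L.-unity_root r by apply/allP => z; rewrite -root_prod_XsubC -Dp.
have sz_r : (L < (size r).+1)%N by rewrite -(size_prod_XsubC r id) -Dp size_XnsubC.
have [|z] := hasP (has_prim_root L0 rn1 _ sz_r); last by exists z.
by rewrite -separable_prod_XsubC -Dp separable_Xn_sub_1 // pnatr_eq0 -lt0n.
Qed.

(** * Andreief and Cauchy-Vandermonde determinants *)

Section Andreief.
Variables (K : comNzRingType) (m k L : nat).
Local Notation N := (m + k)%N.

Lemma det_rows_sum (b : 'I_m -> 'I_L -> K) (phi : 'I_L -> 'I_N -> K) (A : 'M[K]_(k, N)) :
  \sum_(r : {ffun 'I_m -> 'I_L}) (\prod_l b l (r l)) *
     \det (col_mx (\matrix_(l, j) phi (r l) j) A) =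
  \det (col_mx (\matrix_(l, j) \sum_r b l r * phi r j) A).
Proof.
transitivity (\sum_(s : 'S_N) \sum_(r : {ffun 'I_m -> 'I_L})
    (-1) ^+ s * ((\prod_l (b l (r l) * phi (r l) (s (lshift k l)))) * \prod_i A i (s (rshift m i)))).
  rewrite [RHS]exchange_big; apply: eq_bigr => r _; rewrite mulr_sumr; apply: eq_bigr => s _.
  rewrite big_split_ord /= mulrCA; congr (_ * _); rewrite big_split /= !mulrA.
  congr (_ * _ * _); apply: eq_bigr => i _; first by rewrite col_mxEu mxE.
  by rewrite col_mxEd.
apply: eq_bigr => s _; rewrite -mulr_sumr -mulr_suml; congr (_ * _).
rewrite -(bigA_distr_bigA (fun l r => b l r * phi r (s (lshift k l)))) big_split_ord /=.
congr (_ * _); apply: eq_bigr => i _; first by rewrite col_mxEu mxE.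
by rewrite col_mxEd.
Qed.

Lemma det_row_perm_up (B : 'M[K]_(m, N)) (A : 'M[K]_(k, N)) (s : 'S_m) :
  \det (col_mx (row_perm s B) A) = (-1) ^+ s * \det (col_mx B A).
Proof.
rewrite row_permE; have -> : col_mx (perm_mx s *m B) A = block_mx (perm_mx s) 0 0 1%:M *m col_mx B A.
  by rewrite mul_block_col !mul0mx mul1mx addr0 add0r.
by rewrite det_mulmx det_ublock det1 mulr1 det_perm.
Qed.

(** Andreief's identity bordered by [k] rows [A] that do not depend on the summation variables. In
    the expansion of the m x m determinant all permutations contribute equally, whence the
    factorial. *)
Lemma andreief (wt : 'I_L -> K) (psi : 'I_L -> 'I_m -> K) (phi : 'I_L -> 'I_N -> K)
    (A : 'M[K]_(k, N)) :
  \sum_(r : {ffun 'I_m -> 'I_L}) (\prod_l wt (r l)) *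
    (\det (\matrix_(l, p) psi (r l) p) * \det (col_mx (\matrix_(l, j) phi (r l) j) A)) =
  m`!%:R * \det (col_mx (\matrix_(p, j) \sum_r wt r * (psi r p * phi r j)) A).
Proof.
transitivity (\sum_(s : 'S_m) (-1) ^+ s * \sum_(r : {ffun 'I_m -> 'I_L})
    (\prod_l (wt (r l) * psi (r l) (s l))) * \det (col_mx (\matrix_(l, j) phi (r l) j) A)).
  have detE r : \det (\matrix_(l, p) psi (r l) p) =
      \sum_(s : 'S_m) (-1) ^+ s * \prod_l psi (r l) (s l).
    by apply: eq_bigr => s _; congr (_ * _); apply: eq_bigr => l _; rewrite mxE.
  under [RHS]eq_bigr do rewrite mulr_sumr.
  rewrite exchange_big; apply: eq_bigr => r _ /=; rewrite detE.
  move: (\det _) => D; rewrite mulr_suml mulr_sumr; apply: eq_bigr => s _.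
  by rewrite big_split /= mulrA mulrCA -!mulrA; congr (_ * _).
rewrite (eq_bigr (fun=> \det (col_mx (\matrix_(p, j) \sum_r wt r * (psi r p * phi r j)) A))).
  by rewrite sumr_const card_Sn mulr_natl.
move=> s _; rewrite (det_rows_sum (fun l r => wt r * psi r (s l))).
set B := \matrix_(p, j) (\sum_r wt r * (psi r p * phi r j)).
have -> : \matrix_(l, j) (\sum_r wt r * psi r (s l) * phi r j) = row_perm s B.
  apply/matrixP => l j; rewrite !mxE; apply: eq_bigr => r _.
  by rewrite mulrA.
by rewrite det_row_perm_up mulrA -expr2 sqrr_sign mul1r.
Qed.

End Andreief.

Section VdmSplit.
Variable K : fieldType.

Definition cat_ord (m k : nat) (y : 'I_m -> K) (al : 'I_k -> K) (i : 'I_(m + k)) : K :=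
  match fintype.split i with inl l => y l | inr j => al j end.

Lemma cat_ordl m k y al l : @cat_ord m k y al (lshift k l) = y l.
Proof. by rewrite /cat_ord (unsplitK (inl l)). Qed.
Lemma cat_ordr m k y al l : @cat_ord m k y al (rshift m l) = al l.
Proof. by rewrite /cat_ord (unsplitK (inr l)). Qed.

Lemma vdm_cat m k (y : 'I_m -> K) (al : 'I_k -> K) :
  vdm (cat_ord y al) = vdm y * vdm al * \prod_i \prod_l (al i - y l).
Proof.
rewrite /vdm big_split_ord /=.
have -> : \prod_i \prod_l (al i - y l) = \prod_(l < m) \prod_(i < k) (al i - y l).
  by rewrite exchange_big.
rewrite mulrAC -big_split /=; congr (_ * _); apply: eq_bigr => i _.
  rewrite big_split_ord /=; congr (_ * _).
    by apply: eq_bigr => j _; rewrite !cat_ordl.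
  apply: eq_big => [j|j _]; first by rewrite (leq_trans (ltn_ord i)) // leq_addr.
  by rewrite cat_ordl cat_ordr.
rewrite big_split_ord /= big_pred0 ?mul1r => [|j].
  by apply: eq_big => [j|j _]; rewrite ?ltn_add2l // !cat_ordr.
by apply/negbTE; rewrite -leqNgt (leq_trans (ltnW (ltn_ord j))) // leq_addr.
Qed.

(** The sign (-1)^(k (k - 1) / 2), kept as a product over the pairs that index [vdm] so that it
    merges with it factor by factor. *)
Definition vdm_sign k : K := \prod_(i < k) \prod_(j < k | (i < j)%N) (-1).

Lemma vdm_sign_sqr k : vdm_sign k * vdm_sign k = 1.
Proof.
rewrite /vdm_sign -big_split big1 // => i _; rewrite -big_split big1 // => j _.
by rewrite /= mulrNN mulr1.
Qed.

Lemma prod_offdiag k (g : 'I_k -> K) :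
  \prod_j \prod_(i | i != j) (g i - g j) = vdm_sign k * vdm g * vdm g.
Proof.
transitivity (vdm g * \prod_(j < k) \prod_(i < k | (i < j)%N) (g i - g j)).
  rewrite /vdm -big_split; apply: eq_bigr => j _ /=.
  rewrite (bigID (fun i : 'I_k => (j < i)%N)) /=; congr (_ * _); apply: eq_bigl => i.
    by rewrite andbC -val_eqE /=; case: ltngtP.
  by rewrite -leqNgt ltn_neqAle.
rewrite mulrC; congr (_ * _); rewrite (exchange_big_dep xpredT) //= /vdm /vdm_sign -big_split.
apply: eq_bigr => i _; rewrite -big_split; apply: eq_bigr => j _.
by rewrite /= mulN1r opprB.
Qed.

Lemma det_poly_values N (q : 'I_N -> {poly K}) (Y : 'I_N -> K) :
  (forall j, (size (q j) <= N)%N) ->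
  \det (\matrix_(i, j) (q j).[Y i]) = vdm Y * \det (\matrix_(j, e < N) (q j)`_e).
Proof.
move=> sq; pose T := \matrix_(j, e < N) (q j)`_e.
transitivity (\det (T *m Vandermonde N (\row_i Y i))^T).
  congr (\det _); apply/matrixP => i j; rewrite !mxE (horner_coef_wide _ (sq j)).
  by apply: eq_bigr => e _; rewrite !mxE.
rewrite det_tr det_mulmx det_Vandermonde mulrC -/T; congr (_ * _).
by apply: eq_bigr => i _; apply: eq_bigr => j _; rewrite !mxE.
Qed.

Lemma vdm_repeat N (Y : 'I_N -> K) i j : i != j -> Y i = Y j -> vdm Y = 0.
Proof.
move=> ij Yij.
have -> : vdm Y = \det (\matrix_(i, e < N) ('X^e : {poly K}).[Y i]).
  by rewrite det_monic_basis // => e; rewrite monicXn size_polyXn.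
by apply: (determinant_alternate ij) => e; rewrite !mxE Yij.
Qed.

(* After clearing denominators the matrix is a fixed matrix times a Vandermonde
   matrix; its determinant is found by evaluating at the poles. *)
Lemma cauchy_vandermonde m k (y : 'I_m -> K) (al g : 'I_k -> K) (p : 'I_m -> {poly K}) :
  (forall j, p j \is monic /\ size (p j) = j.+1) ->
  injective g -> (forall j l, g j - y l != 0) -> (forall j i, g j - al i != 0) ->
  \det (block_mx (\matrix_(l, j) (p j).[y l]) (\matrix_(l, j) (g j - y l)^-1)
                 (\matrix_(i, j) (p j).[al i]) (\matrix_(i, j) (g j - al i)^-1)) *
    (\prod_l \prod_j (g j - y l)) * (\prod_i \prod_j (g j - al i)) =
  vdm_sign k * vdm g * vdm (cat_ord y al).
Proof.
move=> pm gi gy gal.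
(* If two [y l] coincide, both sides vanish; otherwise [vdm y] can be cancelled. *)
have [/injectiveP yi|/injectivePn[l1 [l2 l12 yl]]] := boolP (injectiveb y); last first.
  have nel : lshift k l1 != lshift k l2 by rewrite (inj_eq (@lshift_inj _ _)).
  rewrite (vdm_repeat nel) ?cat_ordl // mulr0.
  rewrite (determinant_alternate nel) ?mul0r // => j.
  by rewrite -(splitK j); case: (fintype.split j) => e /=;
    rewrite ?block_mxEul ?block_mxEur !mxE yl.
pose G : {poly K} := \prod_j ((g j)%:P - 'X).
pose Gj j : {poly K} := \prod_(i | i != j) ((g i)%:P - 'X).
have GE z : G.[z] = \prod_j (g j - z).
  by rewrite horner_prod; apply: eq_bigr => j _; rewrite !hornerE.
have GjE j z : (Gj j).[z] = \prod_(i | i != j) (g i - z).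
  by rewrite horner_prod; apply: eq_bigr => i _; rewrite !hornerE.
have GjV j z : g j - z != 0 -> (Gj j).[z] = G.[z] * (g j - z)^-1.
  by move=> gz; rewrite GE GjE [in RHS](bigD1 j) //= mulrAC divff // mul1r.
pose q (j : 'I_(m + k)) : {poly K} :=
  match fintype.split j with inl e => p e * G | inr e => Gj e end.
have ql e : q (lshift k e) = p e * G.
  by rewrite /q (unsplitK (inl e)).
have qr e : q (rshift m e) = Gj e.
  by rewrite /q (unsplitK (inr e)).
have size_lin z : size (z%:P - 'X : {poly K}) = 2.
  by rewrite -opprB size_polyN size_XsubC.
have size_prod_lin (P : pred 'I_k) : (size (\prod_(i | P i) ((g i)%:P - 'X))%R <= #|P|.+1)%N.
  apply: (leq_trans (size_poly_prod_leq _ _)).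
  by rewrite (eq_bigr (fun=> 2%N)) ?sum_nat_const 1?mulnC ?mul2n -?addnn ?leq_subLR ?addnS // => i _; rewrite size_lin.
have sq j : (size (q j) <= m + k)%N.
  rewrite -(splitK j); case: (fintype.split j) => e /=; rewrite ?ql ?qr.
    apply: (leq_trans (size_polyMleq _ _)); rewrite (pm e).2 addSn /=.
    apply: (@leq_trans (e + k.+1)%N); last by rewrite addnS -addSn leq_add2r.
    by rewrite leq_add2l (leq_trans (size_prod_lin _)) // cardT size_enum_ord.
  apply: (leq_trans (size_prod_lin _)); have := cardC1 e; rewrite card_ord => ->.
  by rewrite prednK ?leq_addl // (leq_ltn_trans _ (ltn_ord e)).
set cf := \det (\matrix_(j, e < m + k) (q j)`_e).
have blockE (z : 'I_k -> K) : (\matrix_(i, j) (q j).[cat_ord y z i]) =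
    block_mx (\matrix_(l, j) ((p j).[y l] * G.[y l])) (\matrix_(l, j) (Gj j).[y l])
             (\matrix_(i, j) ((p j).[z i] * G.[z i])) (\matrix_(i, j) (Gj j).[z i]).
  apply/matrixP => i j; rewrite mxE -(splitK i) -(splitK j).
  case: (fintype.split i) => i'; case: (fintype.split j) => j' /=;
    rewrite ?(block_mxEul, block_mxEur, block_mxEdl, block_mxEdr) mxE ?cat_ordl ?cat_ordr ?ql ?qr //.
  - by rewrite hornerM.
  - by rewrite hornerM.
have cfE : cf = vdm_sign k * vdm g.
  (* With [g] in place of [al] the lower left block vanishes and the lower right one is diagonal, so
     [cf] can be read off. *)
  have := det_poly_values (cat_ord y g) sq; rewrite blockE vdm_cat -/cf.
  have -> : (\matrix_(i, j) ((p j).[g i] * G.[g i])) = (0 : 'M[K]_(k, m)).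
    by apply/matrixP => i j; rewrite !mxE GE (bigD1 i) //= subrr mul0r mulr0.
  rewrite det_ublock.
  have -> : (\matrix_(i, j) (Gj j).[g i]) = diag_mx (\row_i (Gj i).[g i]).
    apply/matrixP => i j; rewrite !mxE; case: eqVneq => [->|ij]; first by rewrite mulr1n.
    by rewrite mulr0n GjE (bigD1 i) //= subrr mul0r.
  have -> : (\matrix_(l, j) ((p j).[y l] * G.[y l])) =
      diag_mx (\row_l G.[y l]) *m (\matrix_(l, j) (p j).[y l]).
    by apply/matrixP => l j; rewrite mul_diag_mx !mxE mulrC.
  rewrite det_mulmx !det_diag det_monic_basis //.
  have -> : \prod_i (\row_l G.[y l]) 0 i = \prod_i \prod_l (g i - y l).
    by rewrite exchange_big; apply: eq_bigr => l _; rewrite mxE GE.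
  have -> : \prod_i (\row_i (Gj i).[g i]) 0 i = vdm_sign k * vdm g * vdm g.
    by rewrite -prod_offdiag; apply: eq_bigr => i _; rewrite mxE GjE.
  set D := \prod_i \prod_l _ => E.
  have D0 : D != 0 by apply/prodf_neq0 => i _; apply/prodf_neq0 => l _.
  apply: (mulfI (x := vdm y * vdm g * D)).
    by rewrite !mulf_neq0 // vdm_neq0.
  by rewrite -E; ring.
have := det_poly_values (cat_ord y al) sq; rewrite blockE -/cf cfE => E.
transitivity (vdm (cat_ord y al) * (vdm_sign k * vdm g)); last by rewrite mulrC.
rewrite -E.
set M := block_mx _ _ _ _.
have -> : block_mx (\matrix_(l, j) ((p j).[y l] * G.[y l])) (\matrix_(l, j) (Gj j).[y l])
             (\matrix_(i, j) ((p j).[al i] * G.[al i])) (\matrix_(i, j) (Gj j).[al i]) =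
   block_mx (diag_mx (\row_l G.[y l])) 0 0 (diag_mx (\row_i G.[al i])) *m M.
  rewrite /M mulmx_block !mul0mx !addr0 !add0r; congr block_mx;
    by apply/matrixP => i j; rewrite mul_diag_mx !mxE ?GjV // mulrC.
rewrite det_mulmx det_ublock !det_diag -mulrA mulrC; congr (_ * _ * _).
  by apply: eq_bigr => l _; rewrite mxE GE.
by apply: eq_bigr => l _; rewrite mxE GE.
Qed.

End VdmSplit.

(** * The quadrature average *)

Section Quadrature.
Variables (K : numClosedFieldType) (m L : nat) (w : K).
Hypothesis prim : L.-primitive_root w.
Local Notation node := (@qnode K L w).
Local Notation wt := (@qwt K L w).
Implicit Types (f : ('I_m -> K) -> K).

Definition qpoint (r : {ffun 'I_m -> 'I_L}) (l : 'I_m) : K := node (r l).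

(* The Weyl integration formula for USp(2m), with the angles restricted to L-th
   roots of unity. *)
Definition qavg f : K :=
  (m`!%:R)^-1 * \sum_(r : {ffun 'I_m -> 'I_L}) (\prod_l wt (r l)) * vdm (qpoint r) ^+ 2 * f (qpoint r).

Let fact0 : m`!%:R != 0 :> K. Proof. by rewrite pnatr_eq0 -lt0n fact_gt0. Qed.

(** Orthonormality turns the Chebyshev block into the identity in Andreief's identity; eliminating
    it leaves the Schur complement. *)
Lemma qavg_block k (phi : 'I_k -> K -> K) (A1 : 'M[K]_(k, m)) (A2 : 'M[K]_k) : (m + m < L)%N ->
  \sum_(r : {ffun 'I_m -> 'I_L}) (\prod_l wt (r l)) * (vdm (qpoint r) *
     \det (block_mx (\matrix_(l < m, p < m) (cheb K p).[qpoint r l])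
                    (\matrix_(l, j) phi j (qpoint r l)) A1 A2)) =
  m`!%:R * \det (A2 - A1 *m \matrix_(p < m, j < k) \sum_r wt r * ((cheb K p).[node r] * phi j (node r))).
Proof.
move=> mL; set T := \matrix_(p, j) \sum_r wt r * _.
pose psi r (p : 'I_m) := (cheb K p).[node r].
pose ph r (j : 'I_(m + k)) := match fintype.split j with inl p => psi r p | inr j => phi j (node r) end.
have := andreief wt psi ph (row_mx A1 A2).
have -> : \matrix_(p, j) (\sum_r wt r * (psi r p * ph r j)) = row_mx 1%:M T.
  apply/matrixP => p j; rewrite -(splitK j) mxE /ph; case: (fintype.split j) => e /=.
    rewrite row_mxEl mxE; under eq_bigr do rewrite (unsplitK (inl e)).
    by rewrite (qwt_ortho prim) //; have := ltn_ord p; have := ltn_ord e; lia.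
  by rewrite row_mxEr mxE; apply: eq_bigr => r _; rewrite (unsplitK (inr e)).
have <- : \det (A2 - A1 *m T) = \det (col_mx (row_mx 1%:M T) (row_mx A1 A2)).
  have M1 : \det (block_mx 1%:M 0 A1 1%:M : 'M[K]_(m + k)) = 1 by rewrite det_lblock !det1 mulr1.
  have M2 : \det (block_mx 1%:M T 0 (A2 - A1 *m T) : 'M[K]_(m + k)) = \det (A2 - A1 *m T).
    by rewrite det_ublock det1 mul1r.
  rewrite -M2 -[LHS]mul1r -[X in X * _]M1 -det_mulmx mulmx_block !mul1mx !mul0mx !mulmx1 !addr0.
  by rewrite addrC subrK.
move=> <-; apply: eq_bigr => r _; congr (_ * (_ * _)).
  by rewrite det_monic_basis // => j; rewrite cheb_monic size_cheb.
congr (\det _); rewrite /block_mx; congr col_mx; apply/matrixP => l j.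
rewrite -(splitK j) [RHS]mxE /ph; case: (fintype.split j) => e /=.
  by rewrite row_mxEl mxE (unsplitK (inl e)).
by rewrite row_mxEr mxE (unsplitK (inr e)).
Qed.

Lemma block_cat_ord n (y : 'I_m -> K) (al : 'I_n -> K) (q : 'I_m -> {poly K}) (q' : 'I_n -> {poly K}) :
  block_mx (\matrix_(l, p) (q p).[y l]) (\matrix_(l, j) (q' j).[y l])
           (\matrix_(i, p) (q p).[al i]) (\matrix_(i, j) (q' j).[al i]) =
  \matrix_(i, j) (match fintype.split j with inl p => q p | inr e => q' e end).[cat_ord y al i].
Proof.
apply/matrixP => i j; rewrite mxE -(splitK i) -(splitK j) !unsplitK.
case: (fintype.split i) => i'; case: (fintype.split j) => j' /=;
  by rewrite ?(block_mxEul, block_mxEur, block_mxEdl, block_mxEdr) mxE ?cat_ordl ?cat_ordr.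
Qed.

(** The added columns are Chebyshev polynomials of degree at least m, orthogonal to the first m, so
    the correction in [qavg_block] is zero. The value is the one found in [haarE_xmat]. *)
Lemma qavg_num n (al : 'I_n -> K) : (m + m + n < L)%N ->
  vdm al * qavg (fun y => \prod_i \prod_l (al i - y l)) =
  \det (\matrix_(i, j < n) (cheb K (m + j)).[al i]).
Proof.
move=> mnL; have mL : (m + m < L)%N by rewrite (leq_ltn_trans _ mnL) // leq_addr.
have := @qavg_block n (fun j => horner (cheb K (m + j)))
   (\matrix_(i < n, p < m) (cheb K p).[al i]) (\matrix_(i, j) (cheb K (m + j)).[al i]) mL.
rewrite [X in _ *m X](_ : _ = 0) ?mulmx0 ?subr0 => [E|]; last first.
  apply/matrixP => p j; rewrite !mxE (qwt_ortho prim); last by have := ltn_ord p; have := ltn_ord j; lia.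
  by rewrite ltn_eqF // (leq_trans (ltn_ord p)) // leq_addr.
rewrite /qavg mulrCA; apply: (mulfI fact0); rewrite mulVKf // -E mulr_sumr.
apply: eq_bigr => r _; rewrite block_cat_ord det_monic_basis; last first.
  move=> j; rewrite -(splitK j) unsplitK.
  by case: (fintype.split j) => e /=; rewrite cheb_monic size_cheb.
rewrite vdm_cat; set F := \prod_i \prod_l (al i - qpoint r l).
move: F (\prod_l wt (r l)) (vdm al) (vdm (qpoint r)) => F A B D; ring.
Qed.

Lemma qavg1 : (m + m < L)%N -> qavg (fun=> 1) = 1.
Proof.
move=> mL; have := @qavg_num 0 (fun i => 0); rewrite addn0 => /(_ mL).
rewrite det_mx00 {1}/vdm big_ord0 mul1r => E; rewrite -[RHS]E /qavg; congr (_ * _).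
by apply: eq_bigr => r _; rewrite big_ord0.
Qed.

(** Of the two Vandermonde factors in [qavg], one is the Chebyshev determinant of [qavg_block]; the
    other combines with the ratio into a Cauchy-Vandermonde determinant. *)
Lemma qavg_ratio k (al g : 'I_k -> K) : (m + m < L)%N -> injective g ->
  (forall j (s : 'I_L), g j != node s) -> (forall j i, g j != al i) ->
  vdm_sign K k * vdm g * vdm al *
    qavg (fun y => (\prod_i \prod_l (al i - y l)) / (\prod_j \prod_l (g j - y l))) =
  (\prod_i \prod_j (g j - al i)) *
  \det (\matrix_(i, j) ((g j - al i)^-1 -
     \sum_(p < m) (cheb K p).[al i] * \sum_s wt s * ((cheb K p).[node s] / (g j - node s)))).
Proof.
move=> mL gi gn ga.
have := qavg_block (fun j z => (g j - z)^-1)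
   (\matrix_(i < k, p < m) (cheb K p).[al i]) (\matrix_(i, j) (g j - al i)^-1) mL.
have -> : \matrix_(i, j) (g j - al i)^-1 - (\matrix_(i < k, p < m) (cheb K p).[al i]) *m
    (\matrix_(p, j) \sum_s wt s * ((cheb K p).[node s] * (g j - node s)^-1)) =
  \matrix_(i, j) ((g j - al i)^-1 -
     \sum_(p < m) (cheb K p).[al i] * \sum_s wt s * ((cheb K p).[node s] / (g j - node s))).
  apply/matrixP => i j; rewrite !mxE; congr (_ - _); apply: eq_bigr => p _.
  by rewrite !mxE.
move: (\det _) => D E.
rewrite /qavg mulrCA; apply: (mulfI fact0); rewrite mulVKf // mulrCA -E !mulr_sumr.
apply: eq_bigr => r _.
have gy j l : g j - qpoint r l != 0 by rewrite subr_eq0; exact: gn.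
have ga' j i : g j - al i != 0 by rewrite subr_eq0.
have pm (p : 'I_m) : cheb K p \is monic /\ size (cheb K p) = p.+1 by rewrite cheb_monic size_cheb.
have := cauchy_vandermonde (y := qpoint r) pm gi gy ga'.
rewrite vdm_cat.
have -> : \prod_j \prod_l (g j - qpoint r l) = \prod_l \prod_j (g j - qpoint r l) by rewrite exchange_big.
have B0 : \prod_l \prod_j (g j - qpoint r l) != 0.
  by apply/prodf_neq0 => l _; apply/prodf_neq0 => j _.
move: B0; set P := \prod_l \prod_j (g j - qpoint r l); set A := \prod_i \prod_l (al i - qpoint r l).
set Q := \prod_i \prod_j (g j - al i).
move: P A Q (\prod_l wt (r l)) (\det _).
move: (vdm_sign _ _) (vdm g) (vdm al) (vdm (qpoint r)) => s G A Y P F Q W M P0 H.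
have -> : s * G * A * (W * Y ^+ 2 * (F / P)) = W * Y * (s * G * (Y * A * F)) / P by ring.
by rewrite -H; field.
Qed.

Lemma qavgZ c f : qavg (fun y => c * f y) = c * qavg f.
Proof. by rewrite /qavg [RHS]mulrCA; congr (_ * _); rewrite mulr_sumr; apply: eq_bigr => r _; rewrite mulrCA. Qed.

Lemma qavgB f f' : qavg (fun y => f y - f' y) = qavg f - qavg f'.
Proof.
by rewrite /qavg -mulrBr -sumrB; congr (_ * _); apply: eq_bigr => r _; rewrite mulrBr.
Qed.

Let zconj s : (w ^+ s)^* = (w ^+ s)^-1 :> K.
Proof.
by rewrite [RHS]invC_norm (rootz_norm prim) expr1n invr1 mul1r.
Qed.

Lemma qnode_real s : node s \is Num.real.
Proof. by apply/CrealP; rewrite /qnode rmorphD fmorphV /= zconj invrK addrC. Qed.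

Lemma qwt_ge0 s : 0 <= wt s.
Proof.
rewrite /qwt; have -> : - (w ^+ s - (w ^+ s)^-1) ^+ 2 = `|w ^+ s - (w ^+ s)^-1| ^+ 2.
  by rewrite normCK rmorphB fmorphV /= zconj invrK; ring.
by rewrite divr_ge0 ?exprn_ge0 // mulr_ge0.
Qed.

(** The weights are nonnegative and the nodes real, so [qavg] is a probability average. *)
Lemma qavg_norm f e : (m + m < L)%N -> (forall r, `|f (qpoint r)| <= e) -> `|qavg f| <= e.
Proof.
move=> mL fe; have W0 (r : {ffun 'I_m -> 'I_L}) : 0 <= (\prod_l wt (r l)) * vdm (qpoint r) ^+ 2.
  rewrite mulr_ge0 //; first by apply: prodr_ge0 => l _; exact: qwt_ge0.
  rewrite real_exprn_even_ge0 // /vdm; apply: rpred_prod => i _; apply: rpred_prod => j _.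
  by rewrite rpredB // qnode_real.
rewrite -[leRHS]mul1r -(qavg1 mL) /qavg normrM ger0_norm ?invr_ge0 ?ler0n // -mulrA.
rewrite ler_wpM2l ?invr_ge0 ?ler0n // mulr_suml; apply: (le_trans (ler_norm_sum _ _ _)).
by apply: ler_sum => r _; rewrite mulr1 normrM (ger0_norm (W0 r)) ler_wpM2l.
Qed.

End Quadrature.

(** * Ratios *)

Section LimitDeterminant.
Variables (K : numFieldType) (m k : nat).

Lemma det_rowsD (F G : 'M[K]_k) :
  \det (F + G) = \sum_(S : {set 'I_k}) \det (\matrix_(i, j) (if i \in S then F i j else G i j)).
Proof.
rewrite exchange_big; apply: eq_bigr => s _ /=; rewrite -mulr_sumr; congr (_ * _).
transitivity (\prod_i (F i (s i) + G i (s i))); first by apply: eq_bigr => i _; rewrite mxE.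
rewrite bigA_distr; apply: eq_bigr => S _; apply: eq_bigr => i _.
by rewrite mxE.
Qed.

(* Multiplied by [b - b^-1], the left-hand side is a difference of two geometric
   tails, with ratios [c b] and [c / b]. *)
Lemma cheb_tail (b c : K) : b != 0 -> c != 0 -> b * b != 1 -> 1 - c * b != 0 -> 1 - c / b != 0 ->
  (c + c^-1 - (b + b^-1))^-1 - \sum_(p < m) (cheb K p).[b + b^-1] * c ^+ p.+1 =
  c ^+ m * b ^+ m / ((1 - b^-1 * b^-1) * (c^-1 - b)) +
  c ^+ m * b^-1 ^+ m / ((1 - b * b) * (c^-1 - b^-1)).
Proof.
move=> b0 c0 bb cb cVb.
have bV0 : b - b^-1 != 0.
  by apply: contraNneq bb => /eqP; rewrite subr_eq0 => /eqP bE; rewrite {1}bE mulVf.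
have geo (q : K) : (1 - q) * \sum_(p < m) q ^+ p.+1 = q * (1 - q ^+ m).
  under eq_bigr do rewrite exprS.
  by rewrite -mulr_sumr mulrCA -opprB mulNr -subrX1 opprB.
have sumE : (b - b^-1) * \sum_(p < m) (cheb K p).[b + b^-1] * c ^+ p.+1 =
    c * b * (1 - (c * b) ^+ m) / (1 - c * b) - c / b * (1 - (c / b) ^+ m) / (1 - c / b).
  rewrite mulr_sumr -!geo ![_ * (\sum_(_ < _) _) / _]mulrAC !divff // !mul1r -sumrB.
  apply: eq_bigr => p _; rewrite mulrA horner_cheb // mulrBl.
  by rewrite ![_ * c ^+ _]mulrC !exprMn.
apply: (mulfI bV0); rewrite mulrBr sumE !exprMn !exprVn.
have b1 : 1 - b * b != 0 by rewrite subr_eq0 eq_sym.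
have b2 : b * b - 1 != 0 by rewrite subr_eq0.
have cb' : b - c != 0.
  by apply: contraNneq cVb => /eqP; rewrite subr_eq0 => /eqP ->; rewrite divff // subrr.
have ga : c + c^-1 - (b + b^-1) = (1 - c * b) * (b - c) / (c * b) by field; rewrite b0 c0.
have bm : b ^+ m != 0 by rewrite expf_neq0.
rewrite ga; move: (b ^+ m) (c ^+ m) bm => B D B0.
by field; rewrite b0 c0 B0 b1 b2 /= mulN1r cb' (mulrC (- b)) mulrN cb.
Qed.

Lemma vdm_joukowski (e : 'I_k -> K) : (forall i, e i != 0) ->
  vdm (fun i => e i + (e i)^-1) =
  vdm (fun i => (e i)^-1) * \prod_(i < k) \prod_(j < k | (i < j)%N) (1 - e i * e j).
Proof.
move=> e0; rewrite /vdm -big_split; apply: eq_bigr => i _.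
rewrite -big_split; apply: eq_bigr => j _ /=.
by field; rewrite !e0.
Qed.

Lemma det_cauchy (al g : 'I_k -> K) : injective g -> (forall j i, g j - al i != 0) ->
  \det (\matrix_(i, j) (g j - al i)^-1) * (\prod_i \prod_j (g j - al i)) =
  vdm_sign K k * vdm g * vdm al.
Proof.
move=> gi ga; pose y := (fun=> 0) : 'I_0 -> K.
have := @cauchy_vandermonde K 0 k y al g (fun=> 0).
rewrite [X in block_mx _ _ X _]thinmx0 det_ublock det_mx00 mul1r vdm_cat.
have -> : vdm y = 1 by rewrite /vdm big_ord0.
rewrite [\prod_(l < 0) _]big_ord0 mulr1 mul1r [X in _ * (_ * X)]big1 ?mulr1 => [|i _]; last first.
  by rewrite big_ord0.
by move=> H; apply: H => // [[]|j []].
Qed.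

(** For each S, the powers (a/c)^m, e^-m and c^m combine into a^(2m) over S. The factors 1 - e_i^2
    come from the rows; 1 - e_i e_j and 1 - c_i c_j from comparing the Vandermonde products of e +
    1/e and c + 1/c with those of 1/e and 1/c; and 1 - e_i c_j from g - al = (1/c - 1/e)(1 - e
    c). *)
Lemma limit_determinant (a c : 'I_k -> K) :
  (forall i, a i != 0) -> (forall i j, a i * a j != 1) -> injective a ->
  (forall j, c j != 0) -> (forall i j, c i * c j != 1) -> injective c ->
  (forall i j, c j * a i != 1) -> (forall i j, c j != a i) ->
  let al i := a i + (a i)^-1 in let g j := c j + (c j)^-1 in
  let e (S : {set 'I_k}) i := if i \in S then (a i)^-1 else a i in
  (\prod_i (a i / c i) ^+ m) *
    ((\prod_i \prod_j (g j - al i)) *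
      \det (\matrix_(i, j) ((g j - al i)^-1 - \sum_(p < m) (cheb K p).[al i] * c j ^+ p.+1))) =
  vdm_sign K k * vdm g * vdm al *
  \sum_(S : {set 'I_k}) (\prod_(i in S) a i ^+ (2 * m)) *
   ((\prod_(i < k) \prod_(j < k | (i <= j)%N) (1 - e S i * e S j)^-1) *
    (\prod_(i < k) \prod_(j < k | (i < j)%N) (1 - c i * c j)^-1) *
    (\prod_i \prod_j (1 - e S i * c j))).
Proof.
move=> a0 a1 ai c0 c1 ci ca cna al g e.
have e0 S i : e S i != 0 by rewrite /e; case: ifP; rewrite ?invr_eq0.
have e1 S i : e S i * e S i != 1.
  by rewrite /e; case: ifP => // _; rewrite -invfM invr_eq1.
have ce S i j : (c j)^-1 - (e S i)^-1 != 0.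
  rewrite subr_eq0 (inj_eq invr_inj) /e; case: ifP => // _.
  by apply: contraNneq (ca i j) => ->; rewrite mulVf.
have alE S i : al i = e S i + (e S i)^-1.
  by rewrite /e /al; case: ifP => // _; rewrite invrK addrC.
have -> : \matrix_(i, j) ((g j - al i)^-1 - \sum_(p < m) (cheb K p).[al i] * c j ^+ p.+1) =
  \matrix_(i, j) (c j ^+ m * a i ^+ m / ((1 - (a i)^-1 * (a i)^-1) * ((c j)^-1 - a i))) +
  \matrix_(i, j) (c j ^+ m * (a i)^-1 ^+ m / ((1 - a i * a i) * ((c j)^-1 - (a i)^-1))).
  apply/matrixP => i j; rewrite !mxE cheb_tail // subr_eq0 eq_sym //.
  by apply: contraNneq (cna i j) => E; rewrite -[c j](divfK (a0 i)) E mul1r.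
rewrite det_rowsD !mulr_sumr; apply: eq_bigr => S _.
have -> : \matrix_(i, j) (if i \in S then
     (\matrix_(i, j) (c j ^+ m * a i ^+ m / ((1 - (a i)^-1 * (a i)^-1) * ((c j)^-1 - a i)))) i j else
     (\matrix_(i, j) (c j ^+ m * (a i)^-1 ^+ m / ((1 - a i * a i) * ((c j)^-1 - (a i)^-1)))) i j) =
   diag_mx (\row_i ((e S i)^-1 ^+ m / (1 - e S i * e S i))) *m
   \matrix_(i, j) ((c j)^-1 - (e S i)^-1)^-1 *m diag_mx (\row_j c j ^+ m).
  apply/matrixP => i j; rewrite mul_mx_diag mul_diag_mx !mxE /e; case: ifP => _;
    by rewrite ?invrK invfM; ring.
rewrite !det_mulmx !det_diag.
set M := \matrix_(i, j) ((c j)^-1 - (e S i)^-1)^-1.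
set PE := \prod_(i < k) \prod_(j < k | (i < j)%N) (1 - e S i * e S j).
set PC := \prod_(i < k) \prod_(j < k | (i < j)%N) (1 - c i * c j).
set D := \prod_i (1 - e S i * e S i).
set W := \prod_i \prod_j (1 - e S i * c j).
set P := \prod_i \prod_j ((c j)^-1 - (e S i)^-1).
have PE0 : PE != 0.
  apply/prodf_neq0 => i _; apply/prodf_neq0 => j ij; rewrite subr_eq0 eq_sym /e.
  have ij' : i != j by rewrite neq_ltn ij.
  case: ifP; case: ifP => _ _ //.
  - by rewrite -invfM invr_eq1.
  - by apply: contraNneq ij' => E; rewrite -(inj_eq ai) -[a j](mulVKf (a0 i)) E mulr1.
  - by apply: contraNneq ij' => E; rewrite -(inj_eq ai) -[a i](divfK (a0 j)) E mul1r.
have PC0 : PC != 0.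
  by apply/prodf_neq0 => i _; apply/prodf_neq0 => j ij; rewrite subr_eq0 eq_sym.
have D0 : D != 0 by apply/prodf_neq0 => i _; rewrite subr_eq0 eq_sym.
have -> : \prod_i \prod_j (g j - al i) = P * W.
  rewrite -big_split; apply: eq_bigr => i _; rewrite -big_split; apply: eq_bigr => j _ /=.
  by rewrite (alE S) /g; field; rewrite c0 e0.
have gi : injective (fun j => (c j)^-1) by apply: inj_comp => //; exact: invr_inj.
have detM : \det M * P = vdm_sign K k * vdm (fun j => (c j)^-1) * vdm (fun i => (e S i)^-1).
  exact: det_cauchy.
have -> : vdm g = vdm (fun j => (c j)^-1) * PC by exact: vdm_joukowski.
have -> : vdm al = vdm (fun i => (e S i)^-1) * PE.
  by rewrite -vdm_joukowski //; congr vdm; apply/funext => i; exact: alE.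
have -> : \prod_(i < k) \prod_(j < k | (i < j)%N) (1 - c i * c j)^-1 = PC^-1.
  by rewrite -prodfV; apply: eq_bigr => i _; rewrite prodfV.
have -> : \prod_(i < k) \prod_(j < k | (i <= j)%N) (1 - e S i * e S j)^-1 = (D * PE)^-1.
  rewrite -big_split -prodfV; apply: eq_bigr => i _ /=; rewrite prodfV; congr (_^-1).
  rewrite (bigD1 i) //=; congr (_ * _); apply: eq_bigl => j.
  by rewrite ltn_neqAle andbC -val_eqE eq_sym.
have -> : \prod_(i in S) a i ^+ (2 * m) =
    (\prod_i (a i / c i) ^+ m) * (\prod_i (e S i)^-1 ^+ m) * \prod_j c j ^+ m.
  rewrite -!big_split big_mkcond; apply: eq_bigr => i _ /=.
  rewrite -!exprMn mulrAC divfK // /e; case: ifP => _; last by rewrite divff // expr1n.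
  by rewrite invrK exprM expr2.
have -> : \prod_i (\row_i ((e S i)^-1 ^+ m / (1 - e S i * e S i))) 0 i =
    (\prod_i (e S i)^-1 ^+ m) / D.
  by rewrite -prodfV -big_split; apply: eq_bigr => i _; rewrite mxE.
have -> : \prod_j (\row_j c j ^+ m) 0 j = \prod_j c j ^+ m by apply: eq_bigr => j _; rewrite mxE.
move: detM; move: (\det M) (vdm _) (vdm _) (vdm_sign _ _) => DM V1 V2 s detM.
move: (\prod_i (a i / c i) ^+ m) (\prod_i (e S i)^-1 ^+ m) (\prod_j c j ^+ m) => X1 X2 X3.
transitivity (X1 * X2 * X3 * W * (DM * P) / D); first by field.
by rewrite detM; field; rewrite PC0 PE0 D0.
Qed.

End LimitDeterminant.

(** * Uniform convergence *)

Section UniformConvergence.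
Variables (K : numFieldType) (T I : Type) (F : set_system I) (D : set T).
Context {FF : Filter F}.
Implicit Types (u : I -> T -> K) (v : T -> K).

(** The bound on the limit is part of the notion because products of uniformly convergent families
    need it. *)
Definition ucvg u v :=
  (exists2 M, 0 < M & forall x, D x -> `|v x| <= M) /\
  forall e, 0 < e -> \forall i \near F, forall x, D x -> `|v x - u i x| <= e.

Lemma ucvgM u1 u2 v1 v2 : ucvg u1 v1 -> ucvg u2 v2 ->
  ucvg (fun i x => u1 i x * u2 i x) (fun x => v1 x * v2 x).
Proof.
move=> [[M1 M10 vM1] c1] [[M2 M20 vM2] c2]; split.
  by exists (M1 * M2); rewrite ?mulr_gt0 // => x Dx; rewrite normrM ler_pM ?vM1 ?vM2.
move=> e e0; have M21 : 0 < M2 + 1 by rewrite addr_gt0.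
near=> i => x Dx.
have n1 : `|v1 x - u1 i x| <= e / 2 / (M2 + 1).
  by move: x Dx; near: i; apply: c1; rewrite !divr_gt0.
have n2 : `|v2 x - u2 i x| <= e / 2 / M1.
  by move: x Dx {n1}; near: i; apply: c2; rewrite !divr_gt0.
have n3 : `|v2 x - u2 i x| <= 1.
  by move: x Dx {n1 n2}; near: i; apply: c2.
have -> : v1 x * v2 x - u1 i x * u2 i x =
    v1 x * (v2 x - u2 i x) + (v1 x - u1 i x) * (v2 x - (v2 x - u2 i x)) by ring.
have -> : e = M1 * (e / 2 / M1) + e / 2 / (M2 + 1) * (M2 + 1).
  by field; rewrite !gt_eqF.
apply: (le_trans (ler_normD _ _)); rewrite !normrM lerD // ler_pM ?vM1 //.
by apply: (le_trans (ler_normB _ _)); rewrite lerD ?vM2.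
Unshelve. all: by end_near. Qed.

Lemma ucvg_prod (J : Type) (r : seq J) (u : J -> I -> T -> K) (v : J -> T -> K) :
  (forall j, ucvg (u j) (v j)) ->
  ucvg (fun i x => \prod_(j <- r) u j i x) (fun x => \prod_(j <- r) v j x).
Proof.
move=> uv; elim: r => [|j r IH].
  split; first by exists 1 => // x _; rewrite big_nil normr1.
  by move=> e e0; near=> i => x _; rewrite !big_nil subrr normr0 ltW.
have [[M M0 vM] c] := ucvgM (uv j) IH; split.
  by exists M => // x Dx; rewrite big_cons vM.
move=> e /c; apply: filterS => i H x Dx.
by rewrite !big_cons H.
Unshelve. all: by end_near. Qed.

Lemma ucvgV u v d : 0 < d -> (forall x, D x -> d <= `|v x|) -> ucvg u v ->
  ucvg (fun i x => (u i x)^-1) (fun x => (v x)^-1).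
Proof.
move=> d0 vd [_ c]; split.
  by exists d^-1; rewrite ?invr_gt0 // => x Dx; rewrite normfV lef_pV2 ?posrE ?vd // (lt_le_trans d0) ?vd.
move=> e e0; near=> i => x Dx.
have n1 : `|v x - u i x| <= d / 2.
  by move: x Dx; near: i; apply: c; rewrite divr_gt0.
have n2 : `|v x - u i x| <= e * (d * (d / 2)).
  by move: x Dx {n1}; near: i; apply: c; rewrite !mulr_gt0 ?invr_gt0.
have v0 : 0 < `|v x| by rewrite (lt_le_trans d0) ?vd.
have ud : d / 2 <= `|u i x|.
  have -> : d / 2 = d - d / 2 by field.
  rewrite lerBlDr (le_trans (vd x Dx)) // -lerBlDl.
  exact: le_trans (lerB_dist _ _) n1.
have u0 : 0 < `|u i x| by rewrite (lt_le_trans _ ud) ?divr_gt0.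
have -> : (v x)^-1 - (u i x)^-1 = (u i x - v x) / (v x * u i x).
  by field; rewrite -!normr_gt0 v0 u0.
rewrite normrM normfV normrM distrC ler_pdivrMr ?mulr_gt0 //.
apply: (le_trans n2); apply: ler_wpM2l; first exact: ltW.
by apply: ler_pM; rewrite ?vd // ltW ?divr_gt0.
Unshelve. all: by end_near. Qed.

Lemma ucvg_affine (p : I -> K) (q : K) (phi : T -> K) : (forall x, D x -> `|phi x| <= 1) ->
  p @ F --> q -> ucvg (fun i x => 1 - p i * phi x) (fun x => 1 - q * phi x).
Proof.
move=> phi1 /cvgrPdist_le pq; split.
  exists (1 + `|q|); first by rewrite ltr_pwDl.
  move=> x Dx; apply: (le_trans (ler_normB _ _)); rewrite normr1 lerD2l normrM.
  by rewrite ler_piMr ?phi1.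
move=> e e0; near=> i => x Dx.
have -> : 1 - q * phi x - (1 - p i * phi x) = - (q - p i) * phi x by ring.
rewrite normrM normrN; apply: (@le_trans _ _ `|q - p i|); first by rewrite ler_piMr ?phi1.
by near: i; exact: pq.
Unshelve. all: by end_near. Qed.

Lemma ucvg_small (p : I -> K) (phi : I -> T -> K) : (forall i x, D x -> `|phi i x| <= 1) ->
  p @ F --> 0 -> ucvg (fun i x => 1 - p i * phi i x) (fun=> 1).
Proof.
move=> phi1 /cvgrPdist_le p0; split; first by exists 1 => // x _; rewrite normr1.
move=> e e0; near=> i => x Dx.
rewrite opprB addrC subrK normrM; apply: (@le_trans _ _ `|0 - p i|).
  by rewrite sub0r normrN ler_piMr ?phi1.
by near: i; exact: p0.
Unshelve. all: by end_near. Qed.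

End UniformConvergence.

(** * Ratios on the torus as limits of products *)

Section CircleRatios.
Variables (K : numClosedFieldType) (m k : nat).
Local Notation circle := [set z : 'I_m -> K | forall l, `|z l| = 1].
Implicit Types (z : 'I_m -> K).

(** The contribution of the eigenvalues t and 1/t, in a form that still makes sense at a = 0, unlike
    that of [kfacE]. *)
Definition kfac (a t : K) := (1 - a * t) * (1 - a * t^-1).

Definition circ (a c : 'I_k -> K) z : K :=
  \prod_i \prod_l (kfac (a i) (z l) * (kfac (c i) (z l))^-1).

Lemma one_sub_lb (c t : K) : `|t| = 1 -> 1 - `|c| <= `|1 - c * t|.
Proof. by move=> t1; have := lerB_dist 1 (c * t); rewrite normrM t1 mulr1 normr1. Qed.

Lemma kfac_lb (c t : K) : `|c| < 1 -> `|t| = 1 -> (1 - `|c|) ^+ 2 <= `|kfac c t|.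
Proof.
move=> c1 t1; rewrite normrM expr2 ler_pM ?subr_ge0 ?(ltW c1) ?one_sub_lb //.
by rewrite normfV t1 invr1.
Qed.

Lemma kfac_neq0 (c t : K) : `|c| < 1 -> `|t| = 1 -> kfac c t != 0.
Proof.
move=> c1 t1; rewrite -normr_gt0; apply: lt_le_trans (kfac_lb c1 t1).
by rewrite exprn_gt0 ?subr_gt0.
Qed.

Lemma kfacE (a t : K) : a != 0 -> t != 0 -> kfac a t = a * (a + a^-1 - (t + t^-1)).
Proof. by move=> a0 t0; rewrite /kfac; field; rewrite a0 t0. Qed.

Lemma ucvg_kfac (I : Type) (F : set_system I) {FF : Filter F} (p : I -> K) (q : K) l :
  p @ F --> q -> ucvg F circle (fun i z => kfac (p i) (z l)) (fun z => kfac q (z l)).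
Proof.
move=> pq; apply: ucvgM.
  by apply: ucvg_affine pq => z z1; rewrite z1.
by apply: (ucvg_affine (phi := fun z => (z l)^-1)) pq => z z1; rewrite normfV z1 invr1.
Qed.

Lemma ucvg_kfacV (I : Type) (F : set_system I) {FF : Filter F} (p : I -> K) (q : K) l :
  `|q| < 1 -> p @ F --> q ->
  ucvg F circle (fun i z => (kfac (p i) (z l))^-1) (fun z => (kfac q (z l))^-1).
Proof.
move=> q1 pq; apply: (ucvgV (d := (1 - `|q|) ^+ 2)).
- by rewrite exprn_gt0 ?subr_gt0.
- by move=> z z1; exact: kfac_lb.
- exact: ucvg_kfac.
Qed.

Lemma ucvg_circ (I : Type) (F : set_system I) {FF : Filter F} (p q : I -> 'I_k -> K) (a c : 'I_k -> K) :
  (forall j, `|c j| < 1) ->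
  (forall j, p i j @[i --> F] --> a j) -> (forall j, q i j @[i --> F] --> c j) ->
  ucvg F circle (fun i => circ (p i) (q i)) (circ a c).
Proof.
move=> c1 pa qc; apply: ucvg_prod => j; apply: ucvg_prod => l; apply: ucvgM.
  exact: ucvg_kfac.
exact: ucvg_kfacV.
Qed.

Variable w : nat -> K.
Hypothesis wP : forall n, n.+1.-primitive_root (w n).

(* [circ] with every pole factor replaced by the product of the factors at the
   nontrivial rotations of the pole by (n+1)-st roots of unity. *)
Definition ncirc (a c : 'I_k -> K) n z : K :=
  (\prod_i \prod_l kfac (a i) (z l)) * \prod_i \prod_(s < n) \prod_l kfac (c i * w n ^+ s.+1) (z l).

Lemma prod_roots n t : \prod_(s < n.+1) (1 - w n ^+ s * t) = 1 - t ^+ n.+1.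
Proof.
have [->|t0] := eqVneq t 0.
  by rewrite expr0n subr0 big1 // => s _; rewrite mulr0 subr0.
have := congr1 (fun p : {poly K} => t ^+ n.+1 * p.[t^-1]) (factor_Xn_sub_1 (wP n)).
rewrite horner_prod !hornerE mulrBr exprVn divff ?expf_neq0 // mulr1 => <-.
have -> : t ^+ n.+1 = \prod_(s < n.+1) t by rewrite prodr_const card_ord.
rewrite big_mkord -big_split; apply: eq_bigr => s _ /=.
by rewrite !hornerE mulrBr divff // mulrC.
Qed.

Lemma prod_kfac_roots n c t :
  kfac c t * \prod_(s < n) kfac (c * w n ^+ s.+1) t =
  (1 - c ^+ n.+1 * t ^+ n.+1) * (1 - c ^+ n.+1 * t^-1 ^+ n.+1).
Proof.
rewrite -!exprMn -!prod_roots -big_split big_ord_recl /= expr0 !mul1r; congr (_ * _).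
by apply: eq_bigr => s _; rewrite /kfac !mulrA ![w n ^+ _ * _]mulrC.
Qed.

Lemma ncircE a c n z : (forall j, `|c j| < 1) -> circle z ->
  ncirc a c n z = \prod_i \prod_l (kfac (a i) (z l) * (kfac (c i) (z l))^-1 *
    ((1 - c i ^+ n.+1 * z l ^+ n.+1) * (1 - c i ^+ n.+1 * (z l)^-1 ^+ n.+1))).
Proof.
move=> c1 z1; rewrite /ncirc -big_split; apply: eq_bigr => i _ /=.
rewrite exchange_big -big_split; apply: eq_bigr => l _ /=.
by rewrite -prod_kfac_roots -mulrA mulKf // kfac_neq0.
Qed.

Lemma ucvg_ncirc (a c : 'I_k -> K) : (forall j, `|c j| < 1) -> (forall j, (c j ^+ n : K) @[n --> \oo] --> (0 : K)) ->
  ucvg \oo circle (ncirc a c) (circ a c).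
Proof.
move=> c1 cn.
have H : ucvg \oo circle (fun n z => \prod_i \prod_l (kfac (a i) (z l) * (kfac (c i) (z l))^-1 *
    ((1 - c i ^+ n.+1 * z l ^+ n.+1) * (1 - c i ^+ n.+1 * (z l)^-1 ^+ n.+1))))
  (fun z => \prod_i \prod_l (kfac (a i) (z l) * (kfac (c i) (z l))^-1 * (1 * 1))).
  have pow1 (t : K) n : `|t| = 1 -> `|t ^+ n| <= 1 by move=> t1; rewrite normrX t1 expr1n.
  apply: ucvg_prod => i; apply: ucvg_prod => l; apply: ucvgM.
    apply: ucvgM.
      by apply: (ucvg_kfac (p := fun=> a i)); exact: cvg_cst.
    by apply: (ucvg_kfacV (p := fun=> c i)) => //; exact: cvg_cst.
  have c0 : (c i ^+ n.+1 : K) @[n --> \oo] --> (0 : K) by rewrite (cvg_shiftS (fun n => c i ^+ n)).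
  apply: ucvgM; first by apply: ucvg_small c0 => n z z1; exact: pow1.
  by apply: (ucvg_small (phi := fun n z => (z l)^-1 ^+ n.+1)) c0 => n z z1; apply: pow1; rewrite normfV z1 invr1.
have -> : circ a c = fun z => \prod_i \prod_l (kfac (a i) (z l) * (kfac (c i) (z l))^-1 * (1 * 1)).
  by apply/funext => z; apply: eq_bigr => i _; apply: eq_bigr => l _; rewrite !mulr1.
case: H => B H; split => // e /H; apply: filterS => n Hn z z1.
by rewrite ncircE // Hn.
Qed.

End CircleRatios.

Lemma cvg_expr0 (R : realType) (c : C R) : `|c| < 1 -> (c ^+ n : C R) @[n --> \oo] --> (0 : C R).
Proof.
move=> c1; pose r := complex.Re `|c|.
have rE : `|c| = r%:C%C by rewrite RRe_real // normr_real.
have r0 : 0 <= r by rewrite -lecR -rE normr_ge0.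
have r1 : `|r| < 1 by rewrite ger0_norm // -ltcR -rE.
apply/cvgrPdist_le => e e0.
have eE : e = (complex.Re e)%:C%C by rewrite RRe_real // gtr0_real.
have e0' : 0 < complex.Re e by rewrite -ltcR -eE.
have /cvgrPdist_le/(_ _ e0') := cvg_expr r1.
apply: filterS => n; rewrite sub0r normrN sub0r normrN normrX ger0_norm ?exprn_ge0 // => H.
by rewrite normrX rE eE -rmorphXn lecR.
Qed.

Section HaarRatios.
Variables (R : realType) (m : nat).
Local Notation G := (USp R m).
Local Notation mx := 'M[C R]_(m + m).
Local Notation K := (C R).
Variable mu : probability (borel_mx R m) R.
Hypothesis haar : is_haar_USp mu.
Variable ang : mx -> 'I_m -> C R.
Hypothesis ang1 : forall U l, `|ang U l| = 1.
Hypothesis angP : forall U, G U -> angle_spec U (ang U).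
Local Notation x U := (xval (ang U)).
Local Notation E := (haarE mu).

Lemma detg_circ k (a c : 'rV[K]_k) U : G U ->
  detg (gratio a c) U = circ (a 0) (c 0) (ang U).
Proof.
move=> GU; have [_ pe _] := angP GU; rewrite /detg (perm_big _ pe) big_cat /=.
rewrite !big_image -big_split /= /circ exchange_big; apply: eq_bigr => l _ /=.
rewrite /gratio -big_split; apply: eq_bigr => i _ /=.
by rewrite /kfac mulf_div.
Qed.

Lemma test_kfac b : test (fun U : borel_mx R m => \prod_l kfac b (ang U l)).
Proof.
apply: (@test_eq _ _ (numer (fun _ : 'I_1 => b))); last exact: test_numer.
by move=> U GU; rewrite /numer big_ord1; have [-> _ _] := angP GU.
Qed.

Lemma haarE_norm_le f e : test f -> 0 <= e -> (forall U, G U -> `|f U| <= e) -> `|E f| <= 2 * e.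
Proof.
move=> tf e0 fe; have eE : e = (complex.Re e)%:C%C by rewrite RRe_real // ger0_real.
have := @haarE_norm _ _ _ haar f (complex.Re e) tf; rewrite -eE rmorphM /= -eE.
by rewrite rmorph_nat; exact.
Qed.

Lemma haarE_cvg (I : Type) (F : set_system I) {FF : Filter F} u (v : ('I_m -> K) -> K) :
  ucvg F [set z | forall l, `|z l| = 1] u v ->
  (\forall i \near F, test (fun U : borel_mx R m => u i (ang U))) ->
  test (fun U : borel_mx R m => v (ang U)) ->
  E (fun U => u i (ang U)) @[i --> F] --> E (fun U => v (ang U)).
Proof.
move=> [_ uv] tu tv; apply/cvgrPdist_le => e e0; near=> i.
have ti : test (fun U : borel_mx R m => u i (ang U)) by near: i.
have -> : E (fun U => v (ang U)) - E (fun U => u i (ang U)) =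
    E (fun U => v (ang U) + (-1) * u i (ang U)).
  by rewrite (haarED haar) ?(haarEZ haar) ?mulN1r //; apply: testM => //; exact: test_cst.
have -> : e = 2 * (e / 2) by field.
apply: haarE_norm_le.
- by apply: testD => //; apply: testM => //; exact: test_cst.
- by rewrite ltW // divr_gt0.
- move=> U _; rewrite mulN1r.
  have /(_ (ang U)) : forall x, (forall l, `|x l| = 1) -> `|v x - u i x| <= e / 2.
    by near: i; apply: uv; rewrite divr_gt0.
  by apply.
Unshelve. all: by end_near. Qed.

Variable w : nat -> K.
Hypothesis wP : forall n, n.+1.-primitive_root (w n).

Lemma test_ncirc k (a c : 'I_k -> K) n : test (fun U : borel_mx R m => ncirc w a c n (ang U)).
Proof.
apply: testM; first by apply: test_prod => i; exact: test_kfac.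
by apply: test_prod => i; apply: test_prod => s; exact: test_kfac.
Qed.

Lemma ucvg_ncirc_circ k (a c : 'I_k -> K) : (forall j, `|c j| < 1) ->
  ucvg \oo [set z : 'I_m -> K | forall l, `|z l| = 1] (ncirc w a c) (circ a c).
Proof. by move=> c1; apply: ucvg_ncirc => // j; exact: cvg_expr0. Qed.

(** Measurability is inherited, by pointwise limits, from [ncirc], which is a product of
    determinants on [G]. *)
Lemma test_circ k (a c : 'I_k -> K) : (forall j, `|c j| < 1) ->
  test (fun U : borel_mx R m => circ a c (ang U)).
Proof.
move=> c1; have [[M M0 cM] H] := ucvg_ncirc_circ a c1; split.
  apply: (@cmeas_cvg _ _ (borel_mx R m) _ (fun n (U : borel_mx R m) => ncirc w a c n (ang U))).
  - exact: measurable_USp.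
  - by move=> n; have [] := test_ncirc a c n.
  - move=> U _; apply/cvgrPdist_le => e /H; apply: filterS => n; apply.
    by move=> l; rewrite ang1.
exists (complex.Re M) => U _; rewrite RRe_real ?gtr0_real //.
by apply: cM => l; rewrite ang1.
Qed.

(** Multiplied by the Vandermonde product of the b + 1/b, both averages are the same Chebyshev
    determinant; injectivity permits cancelling it. *)
Lemma haarE_qavg (I : finType) (b : I -> K) L (v : K) : L.-primitive_root v ->
  (m + m + #|I| < L)%N -> (forall i, b i != 0) -> injective (fun i => b i + (b i)^-1) ->
  E (fun U => \prod_i \prod_l kfac (b i) (ang U l)) =
  (\prod_i b i ^+ m) * qavg L v (fun y : 'I_m -> K => \prod_i \prod_l (b i + (b i)^-1 - y l)).
Proof.
move=> prim nL b0 bi; pose n := #|I|.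
pose al (i : 'I_n) := b (enum_val i) + (b (enum_val i))^-1.
have ali : injective al by move=> i j /bi/enum_val_inj.
have re (F : I -> K) : \prod_i F i = \prod_(i < n) F (enum_val i).
  by rewrite (reindex _ (onW_bij _ (@enum_val_bij I))).
have -> : E (fun U => \prod_i \prod_l kfac (b i) (ang U l)) =
    E (fun U => (\prod_i b i ^+ m) * \prod_(i < n) (xpoly (x U)).[al i]).
  apply: haarE_eq => U GU; rewrite -(re (fun i => (xpoly (x U)).[b i + (b i)^-1])) -big_split; apply: eq_bigr => i _ /=.
  rewrite horner_prod -[m in b i ^+ m]card_ord -prodr_const -big_split; apply: eq_bigr => l _ /=.
  have z0 : ang U l != 0 by rewrite -normr_gt0 ang1.
  by rewrite kfacE // !hornerE.
have tx : test (fun U : borel_mx R m => \prod_(i < n) (xpoly (x U)).[al i]).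
  by apply: test_prod => i; exact: (test_xpoly ang1 angP).
rewrite (haarEZ haar) //; congr (_ * _); apply: (mulfI (vdm_neq0 ali)).
have -> : qavg L v (fun y : 'I_m -> K => \prod_i \prod_l (b i + (b i)^-1 - y l)) =
   qavg L v (fun y : 'I_m -> K => \prod_i \prod_l (al i - y l)).
  by congr qavg; apply/funext => y; rewrite (re (fun i => \prod_l (b i + (b i)^-1 - y l))).
rewrite (qavg_num prim al nL) -(haarE_xmat haar ang1 angP) -(haarEZ haar) //.
by apply: haarE_eq => U _; rewrite det_xmat.
Qed.

End HaarRatios.

Lemma resolvent_cvg (K : numFieldType) (q : K) p : (q ^+ n : K) @[n --> \oo] --> (0 : K) ->
  ((q ^+ p.+1 - q ^+ (n - p)) / (1 - q ^+ n.+1) : K) @[n --> \oo] --> (q ^+ p.+1 : K).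
Proof.
move=> cn.
have n0 : (q ^+ (n - p) : K) @[n --> \oo] --> (0 : K).
  by rewrite (cvg_centern p (fun n => q ^+ n)).
have n1 : (q ^+ p.+1 - q ^+ (n - p) : K) @[n --> \oo] --> (q ^+ p.+1 - 0 : K).
  by apply: cvgB => //; exact: cvg_cst.
have n2 : ((1 - q ^+ n.+1 : K)^-1) @[n --> \oo] --> ((1 - 0)^-1 : K).
  apply: cvgV; first by rewrite subr0 oner_neq0.
  apply: cvgB; first exact: cvg_cst.
  by rewrite (cvg_shiftS (fun n => q ^+ n)).
by have := cvgM n1 n2; rewrite !subr0 invr1 mulr1; exact.
Unshelve. all: by end_near. Qed.

(** * Ratios with generic poles *)

Section GenericRatios.
Variables (R : realType) (m k : nat).
Local Notation G := (USp R m).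
Local Notation mx := 'M[C R]_(m + m).
Local Notation K := (C R).
Variables (a c : 'I_k -> K).
Hypotheses (a0 : forall i, a i != 0) (a1 : forall i j, a i * a j != 1) (ainj : injective a).
Hypotheses (c0 : forall j, c j != 0) (c1 : forall j, `|c j| < 1).
Hypothesis cinj : forall i j, `|c i| = `|c j| -> i = j.
Hypotheses (ca : forall i j, `|c j| != `|a i|) (ca1 : forall i j, `|c j| * `|a i| != 1).

Let al i := a i + (a i)^-1.
Let g j := c j + (c j)^-1.

(** [circ] in the variables z + 1/z of the quadrature; the powers of a / c are those extracted by
    [kfacE]. *)
Definition ratio_fun (y : 'I_m -> K) :=
  (\prod_i (a i / c i) ^+ m) * ((\prod_i \prod_l (al i - y l)) / (\prod_j \prod_l (g j - y l))).

Let joukowski_inj (b b' : K) : b != 0 -> b' != 0 -> b * b' != 1 ->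
  b + b^-1 = b' + b'^-1 -> b = b'.
Proof.
move=> b0 b0' bb E; apply/eqP; rewrite -subr_eq0.
have : (b - b') * (b * b' - 1) = 0.
  transitivity ((b + b^-1 - (b' + b'^-1)) * (b * b')); first by field; rewrite b0 b0'.
  by rewrite E subrr mul0r.
by move/eqP; rewrite mulf_eq0 (subr_eq0 _ 1) (negPf bb) orbF.
Qed.

Let c_lt1 i j : c i * c j != 1.
Proof.
apply/eqP => /(congr1 Num.norm); rewrite normrM normr1 => E.
by have := mulr_ilt1 (normr_ge0 _) (normr_ge0 _) (c1 i) (c1 j); rewrite E ltxx.
Qed.

Let ginj : injective g.
Proof. by move=> i j /joukowski_inj E; apply: cinj; rewrite E. Qed.

Let g_neq_al j i : g j != al i.
Proof.
apply/eqP => /joukowski_inj E; have /eqP := ca i j; apply; rewrite E //.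
by apply: contraNneq (ca1 i j) => /(congr1 Num.norm); rewrite normrM normr1 => ->.
Qed.

Let alinj : injective al.
Proof. by move=> i j /joukowski_inj E; apply: ainj; rewrite E. Qed.

Let gy j (t : K) : `|t| = 1 -> g j != t + t^-1.
Proof.
move=> t1; have t0 : t != 0 by rewrite -normr_gt0 t1.
have := kfac_neq0 (c1 j) t1; rewrite kfacE // mulf_eq0 (negPf (c0 j)) /=.
by rewrite subr_eq0.
Qed.

Lemma ratio_fun_circ (z : 'I_m -> K) : (forall l, `|z l| = 1) ->
  ratio_fun (xval z) = circ a c z.
Proof.
move=> z1; have z0 l : z l != 0 by rewrite -normr_gt0 z1.
rewrite /ratio_fun /circ -prodf_div -big_split; apply: eq_bigr => i _ /=.
rewrite -prodf_div -[m in _ ^+ m]card_ord -prodr_const -big_split; apply: eq_bigr => l _ /=.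
rewrite !kfacE // -/(al i) -/(g i) invfM /xval.
by rewrite !mulrA; congr (_ * _); rewrite mulrAC.
Qed.

Variable w : nat -> K.
Hypothesis wP : forall n, n.+1.-primitive_root (w n).

Definition ratio_limit : K :=
  let e (S : {set 'I_k}) i := if i \in S then (a i)^-1 else a i in
  \sum_(S : {set 'I_k}) (\prod_(i in S) a i ^+ (2 * m)) *
   ((\prod_(i < k) \prod_(j < k | (i <= j)%N) (1 - e S i * e S j)^-1) *
    (\prod_(i < k) \prod_(j < k | (i < j)%N) (1 - c i * c j)^-1) *
    (\prod_i \prod_j (1 - e S i * c j))).

(** The determinant in [qavg_ratio] has fixed size [k], so convergence of its entries is enough. *)
Lemma qavg_ratio_cvg : qavg n.+1 (w n) ratio_fun @[n --> \oo] --> ratio_limit.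
Proof.
pose s : K := vdm_sign K k * vdm g * vdm al.
have s0 : s != 0.
  rewrite !mulf_neq0 ?vdm_neq0 //; apply/eqP => e.
  by have /eqP := vdm_sign_sqr K k; rewrite e mul0r eq_sym oner_eq0.
pose B : K := (\prod_i (a i / c i) ^+ m) * (\prod_i \prod_j (g j - al i)).
pose ent (n : nat) i j : K := (g j - al i)^-1 - \sum_(p < m) (cheb K p).[al i] *
  ((c j ^+ p.+1 - c j ^+ (n - p)) / (1 - c j ^+ n.+1)).
have cL n j : c j ^+ n.+1 != 1.
  apply/eqP => /(congr1 Num.norm); rewrite normrX normr1 => e.
  by have := exprn_ilt1 n.+1 (normr_ge0 (c j)) (c1 j); rewrite e ltxx.
have qE n : (m + m <= n)%N -> qavg n.+1 (w n) ratio_fun = s^-1 * B * \det (\matrix_(i, j) ent n i j).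
  move=> mn; rewrite qavgZ; apply: (mulfI s0).
  have -> : s * (s^-1 * B * \det (\matrix_(i, j) ent n i j)) = B * \det (\matrix_(i, j) ent n i j).
    by rewrite !mulrA divff // mul1r.
  rewrite mulrCA (qavg_ratio (wP n)) //; last by move=> j r; apply: gy; rewrite (rootz_norm (wP n)).
  rewrite mulrA; congr (_ * \det _); apply/matrixP => i j; rewrite !mxE; congr (_ - _).
  apply: eq_bigr => p _; congr (_ * _); rewrite (qwt_resolvent (wP n)) // ltnS.
  by have := ltn_ord p; lia.
have limE : ratio_limit = s^-1 * B * \det (\matrix_(i, j)
    ((g j - al i)^-1 - \sum_(p < m) (cheb K p).[al i] * c j ^+ p.+1)).
  apply: (mulfI s0); rewrite [in RHS]mulrA [in RHS]mulrA divff // mul1r -[in RHS]mulrA.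
  rewrite [RHS](limit_determinant m a0 a1 ainj c0 c_lt1) //.
  - by move=> i j E; apply: cinj; rewrite E.
  - by move=> i j; apply: contraNneq (ca1 i j) => /(congr1 Num.norm); rewrite normrM normr1 => ->.
  - by move=> i j; apply: contraNneq (ca i j) => ->.
rewrite limE; apply: (cvg_trans (G := s^-1 * B * \det (\matrix_(i, j) ent n i j) @[n --> \oo])).
  apply: near_eq_cvg; near=> n; rewrite qE //; near: n; exact: nbhs_infty_ge.
apply: cvgMr; apply: cvg_sum_seq => t _; apply: cvgMr; apply: cvg_prod_seq => i _.
under eq_fun do rewrite mxE.
rewrite mxE; apply: cvgB; first exact: cvg_cst.
apply: cvg_sum_seq => p _; apply: cvgMr.
have cn : ((c (t i)) ^+ n : K) @[n --> \oo] --> (0 : K) := cvg_expr0 (c1 (t i)).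
exact: resolvent_cvg.
Unshelve. all: by end_near. Qed.

Definition rotated n (i : 'I_k + 'I_k * 'I_n) : K :=
  match i with inl i => a i | inr p => c p.1 * w n ^+ p.2.+1 end.

Lemma rotated_neq0 n i : @rotated n i != 0.
Proof.
case: i => [i|[j s]] //=; rewrite mulf_neq0 //.
by rewrite -normr_gt0 (rootz_norm (wP n)).
Qed.

Lemma norm_rotated n j s : `|@rotated n (inr (j, s))| = `|c j|.
Proof. by rewrite /= normrM (rootz_norm (wP n)) mulr1. Qed.

(** Rotation preserves the modulus, so the conditions on moduli separate the points for every [n],
    even up to inversion. Rotations of the same [c j] differ because the roots of unity do. *)
Lemma rotated_inj n : injective (fun i => @rotated n i + (@rotated n i)^-1).
Proof.
have ne (p q : 'I_k + 'I_k * 'I_n) :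
    rotated p * rotated q != 1 -> rotated p + (rotated p)^-1 = rotated q + (rotated q)^-1 ->
    rotated p = rotated q.
  by move=> pq; apply: joukowski_inj => //; exact: rotated_neq0.
have n1 (u : K) : `|u| != 1 -> u != 1 by apply: contraNneq => ->; rewrite normr1.
have cc i j : `|c i| * `|c j| != 1.
  by have := mulr_ilt1 (normr_ge0 _) (normr_ge0 _) (c1 i) (c1 j); apply: contraTneq => ->; rewrite ltxx.
move=> [i|[i s]] [j|[j t]] /ne E.
- by congr inl; apply: ainj; apply: E => /=.
- have /eqP := ca i j; case; rewrite -(norm_rotated j t) -E //.
  by apply: n1; rewrite normrM norm_rotated mulrC; exact: ca1.
- have /eqP := ca j i; case; rewrite -(norm_rotated i s) E //.
  by apply: n1; rewrite normrM norm_rotated; exact: ca1.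
- have {}E : rotated (inr (i, s)) = rotated (inr (j, t)).
    by apply: E; apply: n1; rewrite normrM !norm_rotated.
  have ij : i = j by apply: cinj; rewrite -(norm_rotated i s) E norm_rotated.
  move: E; rewrite -ij => /(mulfI (c0 i)) /eqP; rewrite (eq_prim_root_expr (wP n)).
  by rewrite !modn_small ?ltnS // => /eqP[] /val_inj ->.
Qed.

Variable mu : probability (borel_mx R m) R.
Hypothesis haar : is_haar_USp mu.
Variable ang : mx -> 'I_m -> C R.
Hypothesis ang1 : forall U l, `|ang U l| = 1.
Hypothesis angP : forall U, G U -> angle_spec U (ang U).
Local Notation E := (haarE mu).

Lemma ncirc_rotated n z : ncirc w a c n z = \prod_i \prod_(l < m) kfac (@rotated n i) (z l).
Proof.
rewrite /ncirc big_sumType /=; congr (_ * _); rewrite pair_bigA /=.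
by apply: eq_bigr => -[].
Qed.

Lemma haarE_circ_generic : E (fun U => circ a c (ang U)) = ratio_limit.
Proof.
have tc := test_circ ang1 angP wP a c1.
suff H e : 0 < e -> `|E (fun U => circ a c (ang U)) - ratio_limit| <= 4 * e.
  apply/eqP; rewrite -subr_eq0 -normr_eq0; set d := `|_|.
  have d0 : 0 <= d by exact: normr_ge0.
  apply: contraT => dn; have dp : 0 < d by rewrite lt_neqAle eq_sym dn.
  have := H (d / 8) (divr_gt0 dp (ltr0n _ 8)); rewrite -/d.
  have -> : 4 * (d / 8) = d / 2 by field.
  by rewrite ler_pdivlMr // mulr_natr mulr2n gerDl (lt_geF dp).
(* [n] is fixed first, to approximate the ratio by a product; the quadrature order [q] comes
   afterwards, as it must exceed the number of factors, which grows with [n]. *)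
move=> e0; have [n Hn] : exists n, forall z : 'I_m -> K, (forall l, `|z l| = 1) ->
    `|circ a c z - ncirc w a c n z| <= e.
  have [_ /(_ _ e0)] := @ucvg_ncirc_circ R m w wP k a c c1.
  by move=> [N _ /(_ N (leqnn N))] H; exists N.
have /cvgrPdist_le/(_ _ e0) [N _ HN] := qavg_ratio_cvg.
pose b := @rotated n; pose q := (m + m + #|{: 'I_k + 'I_k * 'I_n}| + N)%N.
have mq : (m + m < q.+1)%N by rewrite ltnS /q -addnA leq_addr.
pose hy (y : 'I_m -> K) := (\prod_i b i ^+ m) * \prod_i \prod_l (b i + (b i)^-1 - y l).
have E1 : E (fun U => ncirc w a c n (ang U)) = qavg q.+1 (w q) hy.
  rewrite qavgZ -(haarE_qavg haar ang1 angP (wP q) _ (@rotated_neq0 n) (@rotated_inj n)).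
    by apply: haarE_eq => U _; rewrite ncirc_rotated.
  by rewrite ltnS /q leq_addr.
have hyE (z : 'I_m -> K) : (forall l, `|z l| = 1) -> hy (xval z) = ncirc w a c n z.
  move=> z1; rewrite ncirc_rotated /hy -big_split; apply: eq_bigr => i _ /=.
  rewrite -[m in _ ^+ m]card_ord -prodr_const -big_split; apply: eq_bigr => l _ /=.
  by rewrite kfacE ?rotated_neq0 // -normr_gt0 z1.
have tn := test_ncirc angP w a c n.
have -> : E (fun U => circ a c (ang U)) - ratio_limit =
   E (fun U => circ a c (ang U) + (-1) * ncirc w a c n (ang U)) +
   qavg q.+1 (w q) (fun y => hy y - ratio_fun y) +
   (qavg q.+1 (w q) ratio_fun - ratio_limit).
  rewrite (haarED haar) ?(haarEZ haar) ?mulN1r // ?E1 ?qavgB; first by ring.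
  by apply: testM => //; exact: test_cst.
(* The first error is doubled by the factor 2 in [haarE_norm_le]. *)
have -> : 4 * e = 2 * e + e + e by ring.
apply: (le_trans (ler_normD _ _)); apply: lerD; last first.
  by rewrite distrC; apply: HN; rewrite /= /q leq_addl.
apply: (le_trans (ler_normD _ _)); apply: lerD.
  apply: (haarE_norm_le haar); rewrite ?(ltW e0) //.
    by apply: testD => //; apply: testM => //; exact: test_cst.
  by move=> U _; rewrite mulN1r; apply: Hn.
apply: (qavg_norm (wP q) mq) => r.
have -> : qpoint (w q) r = xval (fun l => w q ^+ r l) by [].
have z1 l : `|w q ^+ r l| = 1 by exact: (rootz_norm (wP q)).
by rewrite hyE // ratio_fun_circ // distrC; exact: Hn.
Qed.

End GenericRatios.

(** * Removing the conditions on the poles *)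

Lemma ratio_sumE (R : realType) (m k : nat) (a c : 'rV[C R]_k) :
  ratio_sum (2 * m) a c = ratio_limit m (a 0) (c 0).
Proof.
apply: eq_bigr => S _; congr (_ * _); rewrite /ZSC; congr (_ * _ * _).
- by apply: eq_bigr => i _; apply: eq_bigr => j _; rewrite !mxE.
- rewrite /Z -prodfV; apply: eq_bigr => i _; rewrite -prodfV; apply: eq_bigr => j _.
  by rewrite invrK !mxE.
Qed.

(** With [a] fixed, the only varying denominators are the 1 - c_i c_j, which are nonzero in the unit
    disc. *)
Lemma ratio_limit_cvg (R : realType) (m k : nat) (I : Type) (F : set_system I) {FF : Filter F}
    (a c : 'I_k -> C R) (q : I -> 'I_k -> C R) : (forall j, `|c j| < 1) ->
  (forall j, q i j @[i --> F] --> c j) -> ratio_limit m a (q i) @[i --> F] --> ratio_limit m a c.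
Proof.
move=> c1 qc; apply: cvg_sum_seq => S _; apply: cvgMr.
apply: cvgM; last first.
  apply: cvg_prod_seq => i _; apply: cvg_prod_seq => j _.
  by apply: cvgB; [exact: cvg_cst|exact: cvgMr].
apply: cvgMr; apply: cvg_prod_seq => i _; apply: cvg_prod_seq => j _.
apply: cvgV; last by apply: cvgB; [exact: cvg_cst|exact: cvgM].
rewrite subr_eq0 eq_sym; apply/eqP => /(congr1 Num.norm); rewrite normrM normr1 => E.
by have := mulr_ilt1 (normr_ge0 _) (normr_ge0 _) (c1 i) (c1 j); rewrite E ltxx.
Qed.

(** The values 2^-n are distinct, so a nonzero affine function vanishes at one of them at most. *)
Lemma affine_neq0 (K : numFieldType) (p q : K) : (p != 0) || (q != 0) ->
  \forall n \near \oo, p + q * 2^-1 ^+ n != 0.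
Proof.
move=> pq0; have [[n0 E0]|ne] := pselect (exists n, p + q * 2^-1 ^+ n = 0); last first.
  by near=> n; apply/eqP => E; apply: ne; exists n.
near=> n; apply/eqP => E; have lt : (n0 < n)%N by near: n; exact: nbhs_infty_gt.
have hlt : 2^-1 ^+ n < 2^-1 ^+ n0 :> K by rewrite ltr_iXn2l ?invr_gt0 ?invf_lt1 ?ltr1n.
have : q * (2^-1 ^+ n0 - 2^-1 ^+ n) = 0.
  by rewrite mulrBr -[X in X - _](addKr p) E0 -[X in _ - X](addKr p) E subrr.
move/eqP; rewrite mulf_eq0 subr_eq0 (gt_eqF hlt) orbF => /eqP q0.
by move: pq0 E; rewrite q0 eqxx orbF mul0r addr0 => /eqP.
Unshelve. all: by end_near. Qed.

Lemma cvg_mul_one_sub (K : numFieldType) (x : K) (u : nat -> K) :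
  u n @[n --> \oo] --> (0 : K) -> x * (1 - u n) @[n --> \oo] --> x.
Proof.
move=> u0; rewrite -[X in _ --> X]mulr1 -[X in _ * X]subr0; apply: cvgMr.
by apply: cvgB => //; exact: cvg_cst.
Qed.

Section Perturbation.
Variables (R : realType) (k : nat) (c : 'I_k -> C R).
Local Notation K := (C R).
Hypothesis c1 : forall j, `|c j| < 1.

(* The moduli of these perturbations of [c] are distinct and nonzero for large [n]. *)
Definition spread n (j : 'I_k) : K :=
  let e := 2^-1 ^+ n * j.+1%:R in if c j == 0 then e else c j * (1 - e).

(** For large [n] the modulus of [spread n j] is affine in 2^-n with this slope; the factor j + 1
    separates the slopes wherever the moduli of the [c j] agree. *)
Let slope j : K := (if c j == 0 then 1 else - `|c j|) * j.+1%:R.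

Let slope_neq0 j : slope j != 0.
Proof.
rewrite mulf_neq0 ?pnatr_eq0 //; case: ifP => [_|/negbT c0]; first exact: oner_neq0.
by rewrite oppr_eq0 normr_eq0.
Qed.

Let half_cvg : (2^-1 ^+ n : K) @[n --> \oo] --> (0 : K).
Proof. by apply: cvg_expr0; rewrite normfV normr_nat invf_lt1 ?ltr1n. Qed.

Lemma spread_cvg j : spread n j @[n --> \oo] --> c j.
Proof.
have H : ((2^-1 ^+ n * j.+1%:R) : K) @[n --> \oo] --> (0 * j.+1%:R : K) by exact: cvgMl.
rewrite mul0r in H; rewrite /spread; case: eqVneq => [->//|_].
exact: cvg_mul_one_sub.
Qed.

Let small : \forall n \near \oo, forall j : 'I_k, (2^-1 ^+ n * j.+1%:R : K) < 1.
Proof.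
have k0 : 0 < (k.+1%:R : K)^-1 by rewrite invr_gt0 ltr0n.
have /cvgrPdist_lt/(_ _ k0) := half_cvg; apply: filterS => n; rewrite sub0r normrN.
rewrite ger0_norm ?exprn_ge0 ?invr_ge0 // => H j.
rewrite -ltr_pdivlMr ?ltr0n // div1r (lt_le_trans H) // lef_pV2 ?posrE ?ltr0n // ler_nat.
by rewrite ltnS ltnW.
Qed.

Let spread_norm : \forall n \near \oo, forall j, `|spread n j| = `|c j| + slope j * 2^-1 ^+ n /\ `|spread n j| < 1.
Proof.
near=> n => j; have sm : (2^-1 ^+ n * j.+1%:R : K) < 1 by move: j; near: n.
have h0 : 0 <= 2^-1 ^+ n * j.+1%:R :> K by rewrite mulr_ge0 ?exprn_ge0 ?invr_ge0.
rewrite /spread /slope; case: eqVneq => [->|c0].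
  by rewrite ger0_norm // normr0 add0r mul1r; split => //; rewrite mulrC.
have h1 : 0 <= 1 - 2^-1 ^+ n * j.+1%:R :> K by rewrite subr_ge0 ltW.
rewrite normrM (ger0_norm h1); split; first by ring.
by rewrite (le_lt_trans _ (c1 j)) // ler_piMr // gerBl.
Unshelve. all: by end_near. Qed.

(** Apart from the bound by 1, the conditions say that finitely many affine functions of 2^-n do not
    vanish. *)
Lemma spread_generic (a : 'I_k -> K) : (forall i, a i != 0) ->
  \forall n \near \oo, [/\ forall j, spread n j != 0, forall j, `|spread n j| < 1,
    forall i j, `|spread n i| = `|spread n j| -> i = j,
    forall i j, `|spread n j| != `|a i| & forall i j, `|spread n j| * `|a i| != 1].
Proof.
move=> a0.
have n1 : \forall n \near \oo, forall j, `|c j| + slope j * 2^-1 ^+ n != 0.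
  by apply: filter_forall => j; apply: affine_neq0; rewrite slope_neq0 orbT.
have n2 : \forall n \near \oo, forall p : 'I_k * 'I_k, p.1 != p.2 ->
    (`|c p.1| - `|c p.2|) + (slope p.1 - slope p.2) * 2^-1 ^+ n != 0.
  apply: filter_forall => -[i j] /=; have [_|ij] := eqVneq i j; first by near=> n.
  suff : (`|c i| - `|c j| != 0) || (slope i - slope j != 0).
    by move=> /affine_neq0; apply: filterS.
  rewrite !subr_eq0; have [E|//] := eqVneq `|c i| `|c j|.
  rewrite /slope -!(normr_eq0 (c _)) E /=; apply: contraNneq ij => /mulfI H.
  have /eqP : i.+1%:R = j.+1%:R :> K.
    apply: H; case: ifP => [_|/negbT c0]; first exact: oner_neq0.
    by rewrite oppr_eq0.
  by rewrite eqr_nat eqSS.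
have n3 : \forall n \near \oo, forall p : 'I_k * 'I_k, (`|c p.2| - `|a p.1|) + slope p.2 * 2^-1 ^+ n != 0.
  by apply: filter_forall => p; apply: affine_neq0; rewrite slope_neq0 orbT.
have n4 : \forall n \near \oo, forall p : 'I_k * 'I_k,
    (`|c p.2| * `|a p.1| - 1) + (slope p.2 * `|a p.1|) * 2^-1 ^+ n != 0.
  by apply: filter_forall => p; apply: affine_neq0; rewrite mulf_neq0 ?slope_neq0 ?orbT ?normr_eq0.
near=> n.
have E j : `|spread n j| = `|c j| + slope j * 2^-1 ^+ n /\ `|spread n j| < 1 by move: j; near: n.
split.
- move=> j; rewrite -normr_eq0 (E j).1; move: j; near: n; exact: n1.
- by move=> j; have [] := E j.
- move=> i j; rewrite (E i).1 (E j).1 => /eqP; apply: contraTeq => ij.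
  have : forall p : 'I_k * 'I_k, p.1 != p.2 ->
    (`|c p.1| - `|c p.2|) + (slope p.1 - slope p.2) * 2^-1 ^+ n != 0 by near: n.
  by move=> /(_ (i, j) ij); apply: contraNneq => /= F; rewrite mulrBl addrACA -opprD F subrr.
- have : forall p : 'I_k * 'I_k, (`|c p.2| - `|a p.1|) + slope p.2 * 2^-1 ^+ n != 0 by near: n.
  move=> H i j; have := H (i, j); rewrite (E j).1 /=; apply: contraNneq => <-.
  by rewrite opprD addrA subrr sub0r addNr.
- have : forall p : 'I_k * 'I_k, (`|c p.2| * `|a p.1| - 1) + (slope p.2 * `|a p.1|) * 2^-1 ^+ n != 0 by near: n.
  move=> H i j; have := H (i, j); rewrite (E j).1 /=; apply: contraNneq => F.
  by apply/eqP; rewrite -[X in _ - X]F; ring.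
Unshelve. all: by end_near. Qed.

End Perturbation.

Lemma haarE_circ (R : realType) (m k : nat) (mu : probability (borel_mx R m) R)
    (ang : 'M[C R]_(m + m) -> 'I_m -> C R) (a c : 'rV[C R]_k) : is_haar_USp mu ->
  (forall U l, `|ang U l| = 1) -> (forall U, USp R m U -> angle_spec U (ang U)) ->
  generic a -> (forall j, `|c 0 j| < 1) ->
  haarE mu (fun U => circ (a 0) (c 0) (ang U)) = ratio_sum (2 * m) a c.
Proof.
move=> haar ang1 angP [a0 a1 ai] c1.
have [w wP] := choice (fun n => prim_root_exists (C R) (ltn0Sn n)).
have ainj : injective (a 0) by move=> i j; apply: contra_eq; exact: ai.
have H1 : haarE mu (fun U => circ (a 0) (spread (c 0) n) (ang U)) @[n --> \oo] -->
    haarE mu (fun U => circ (a 0) (c 0) (ang U)).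
  apply: (haarE_cvg haar ang1 (u := fun n => circ (a 0) (spread (c 0) n))).
  - by apply: ucvg_circ => // j; [exact: cvg_cst|exact: spread_cvg].
  - have := spread_generic c1 a0; apply: filterS => n [_ s1 _ _ _].
    exact: (test_circ ang1 angP wP).
  - exact: (test_circ ang1 angP wP).
have /(_ _) H2 := @ratio_limit_cvg R m k nat \oo _ (a 0) (c 0) (spread (c 0)) c1 (@spread_cvg R k (c 0)).
have H3 : haarE mu (fun U => circ (a 0) (spread (c 0) n) (ang U)) @[n --> \oo] -->
    ratio_limit m (a 0) (c 0).
  apply: cvg_trans H2; apply: near_eq_cvg.
  have := spread_generic c1 a0; apply: filterS => n [s0 s1 s2 s3 s4].
  by rewrite (haarE_circ_generic a0 a1 ainj s0 s1 s2 s3 s4 wP haar ang1 angP).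
by rewrite ratio_sumE; apply: (cvg_unique (@norm_hausdorff _ (C R)) H1 H3).
Qed.

(* The right-hand side is a rational function of a with removable
   singularities; off the generic locus it is read as its limit. *)
Theorem theorem6p1 (R : realType) (m k : nat)
    (mu : probability (borel_mx R m) R) (a c : 'rV[C R]_k) :
  is_haar_USp mu ->
  (forall i, `|c 0 i| < 1) ->
  let I := integralC mu (USp R m) (detg (gratio a c)) in
  (generic a -> I = ratio_sum (2 * m) a c) /\
  (ratio_sum (2 * m) b c @[b --> within [set b | generic b] (nbhs a)] --> I).

Proof.
move=> haar c1 I.
have [ang [ang1 angP]] := USp_angles R m.
have [w wP] := choice (fun n => prim_root_exists (C R) (ltn0Sn n)).
have IE b : haarE mu (detg (gratio b c)) = haarE mu (fun U => circ (b 0) (c 0) (ang U)).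
  by apply: haarE_eq => U GU; exact: detg_circ.
have gE b : generic b -> haarE mu (detg (gratio b c)) = ratio_sum (2 * m) b c.
  by move=> gb; rewrite IE; exact: haarE_circ.
split; first exact: gE.
set W := within _ _.
(* Only the poles have to stay in the disc, so the average is continuous in the numerator parameters
   at every [a], generic or not. *)
have H : haarE mu (fun U => circ (b 0) (c 0) (ang U)) @[b --> W] -->
    haarE mu (fun U => circ (a 0) (c 0) (ang U)).
  apply: (haarE_cvg haar ang1 (u := fun b : 'rV[C R]_k => circ (b 0) (c 0))).
  - apply: ucvg_circ => // j; last exact: cvg_cst.
    apply: cvg_trans (@coord_continuous (C R) 1 k 0 j a); apply: cvg_app; exact: cvg_within.
  - by apply: nearW => b; exact: (test_circ ang1 angP wP).
  - exact: (test_circ ang1 angP wP).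
rewrite /I -/(haarE mu _) IE; apply: cvg_trans H; apply: near_eq_cvg.
by near=> b; rewrite -IE gE //; near: b; exact: withinT.
Unshelve. all: by end_near. Qed.
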